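(* Let $\alpha>-1$ and let $v\in C^1_{loc}(\mathbb R^N)$, with pressure $q$, be a self-similar profile with exponent $\alpha$, i.e. $\nabla\cdot v=0$ and $\frac{1}{1+\alpha}\,y\cdot\nabla v+\frac{\alpha}{1+\alpha}\,v=v\cdot\nabla v+\nabla q$ on $\mathbb R^N$. Suppose $v$ is homogeneous near infinity: there are $\beta\in\mathbb R$ and $V\in C^1(\mathbb S^{N-1};\mathbb R^N)$ such that $$v(y)=\frac{V(y/|y|)}{|y|^{\beta}}\qquad\text{for all } |y| \text{ large enough.}$$ Suppose any one of the following conditions is satisfied: (i) $0<\beta<\alpha$; (ii) $-1<\alpha<\beta$; (iii) $\alpha=\beta=\frac N2$. Then $v=0$, except in the case $\beta=0$, in which case $v$ is constant.
   Context: $N\ge 2$ is the space dimension; $v:\mathbb R^N\to\mathbb R^N$ is a vector field and $q:\mathbb R^N\to\mathbb R$ a scalar function; the equations are understood in the sense of distributions. These are the equations of the profile of a self-similar solution $u(x,t)=t^{-\alpha/(1+\alpha)}v(x\,t^{-1/(1+\alpha)})$, $p(x,t)=t^{-2\alpha/(1+\alpha)}q(x\,t^{-1/(1+\alpha)})$, $t>0$, of the incompressible Euler equations $u_t+u\cdot\nabla u+\nabla p=0$, $\nabla\cdot u=0$ (collapse at time $t=0$, time reversed). Pressure convention: in cases (i) and (iii) (where $\beta>0$, so $v\in L^p$ for all large $p$) $q$ is assumed to be the associated pressure $$q(y)=-\frac{|v(y)|^2}{N}+\mathrm{P.V.}\int_{\mathbb R^N}K_{ij}(y-z)\,v_i(z)v_j(z)\,dz,\qquad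 K_{ij}(y)=\frac{N y_iy_j-\delta_{ij}|y|^2}{N\omega_N|y|^{N+2}},$$ with summation over repeated indices, where $\omega_N$ is the volume of the unit ball in $\mathbb R^N$. In case (ii) $q$ may be any scalar function for which the equation holds. *)

(* Defs.v *)
From HB Require Import structures.
From mathcomp Require Import all_boot all_order all_algebra.
From mathcomp Require Import all_classical all_reals all_analysis.

Set Implicit Arguments.
Unset Strict Implicit.
Unset Printing Implicit Defensive.

Import Order.TTheory GRing.Theory Num.Theory.
Import numFieldNormedType.Exports.

Local Open Scope classical_set_scope.
Local Open Scope ring_scope.

(* The sigma-algebra on [R^n] generated by the coordinates, i.e. the Borel
   sigma-algebra (same construction as the library's one on [n.-tuple T]). *)

Definition measure_rV_display : measure_display.
Proof. exact: default_measure_display. Qed.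

Section measurable_rV.
Context {R : realType} (n : nat).

Let coors : 'I_n -> 'rV[R]_n -> measurableTypeR R := fun i x => x ord0 i.

Let rV_set0 : g_sigma_preimage coors set0.
Proof. exact: sigma_algebra0. Qed.

Let rV_setC A : g_sigma_preimage coors A -> g_sigma_preimage coors (~` A).
Proof. exact: sigma_algebraC. Qed.

Let rV_bigcup (F : _^nat) : (forall i, g_sigma_preimage coors (F i)) ->
  g_sigma_preimage coors (\bigcup_i (F i)).
Proof. exact: sigma_algebra_bigcup. Qed.

HB.instance Definition _ := @isMeasurable.Build measure_rV_display
  'rV[R]_n (g_sigma_preimage coors) rV_set0 rV_setC rV_bigcup.

End measurable_rV.

Lemma measurable_coord (R : realType) n (i : 'I_n) :
  measurable_fun [set: 'rV[R]_n] (fun x => x ord0 i : measurableTypeR R).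
Proof.
move=> _ Y mY; rewrite setTI; apply: sub_sigma_algebra => /=.
rewrite -bigcup_seq/=; exists i => /=; first by rewrite mem_index_enum.
by exists Y => //; rewrite setTI.
Qed.

Lemma measurable_fun_rVP d (T : measurableType d) (R : realType) n
    (f : T -> 'rV[R]_n) :
  (forall i, measurable_fun [set: T] (fun t => f t ord0 i : measurableTypeR R)) ->
  measurable_fun [set: T] f.
Proof.
move=> mf _ A mA; rewrite setTI.
suff : g_sigma_preimage (fun i (x : 'rV[R]_n) => x ord0 i : measurableTypeR R)
    `<=` [set A | measurable (f @^-1` A)] by apply.
apply: smallest_sub.
  split => /=.
  - by rewrite preimage_set0.
  - by move=> B mB; rewrite setTD preimage_setC; exact: measurableC.
  - by move=> F mF; rewrite preimage_bigcup; exact: bigcup_measurable.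
rewrite -bigcup_seq => B [i _ [C mC <-]] /=; rewrite setTI.
by rewrite -[X in measurable X]setTI; exact: mf.
Qed.

Section lebesgue_rV.
Context {R : realType}.

Definition rV_cons n (p : measurableTypeR R * 'rV[R]_n) : 'rV[R]_n.+1 :=
  row_mx (p.1 : R)%:M p.2.

Fixpoint lebesgue_rV n : set 'rV[R]_n -> \bar R :=
  match n with
  | 0 => @dirac _ 'rV[R]_0 0 R
  | n'.+1 => pushforward (lebesgue_measure \x @lebesgue_rV n')%E (@rV_cons n')
  end.

Lemma rV_cons0 n (p : measurableTypeR R * 'rV[R]_n) : rV_cons p ord0 ord0 = p.1.
Proof.
rewrite /rV_cons (_ : ord0 = lshift n (ord0 : 'I_1)); last exact/val_inj.
by rewrite (row_mxEl (p.1 : R)%:M) mxE eqxx mulr1n.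
Qed.

Lemma rV_consS n (p : measurableTypeR R * 'rV[R]_n) i :
  rV_cons p ord0 (lift ord0 i) = p.2 ord0 i.
Proof.
rewrite /rV_cons (_ : lift ord0 i = rshift 1 i); last exact/val_inj.
by rewrite (row_mxEr (p.1 : R)%:M).
Qed.

Lemma measurable_rV_cons n : measurable_fun setT (@rV_cons n).
Proof.
apply: measurable_fun_rVP => i; case: (unliftP ord0 i) => [j|] ->.
  rewrite (_ : (fun _ => _) =
      (fun x : 'rV[R]_n => x ord0 j : measurableTypeR R) \o snd); last first.
    by apply/funext => p; rewrite rV_consS.
  by apply: measurableT_comp => //; exact: measurable_coord.
by rewrite (_ : (fun _ => _) = fst) //; apply/funext => p; rewrite rV_cons0.
Qed.

Lemma rV_consK n (x : 'rV[R]_n.+1) :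
  rV_cons (x ord0 ord0 : measurableTypeR R, \row_j x ord0 (lift ord0 j)) = x.
Proof.
apply/rowP => i; case: (unliftP ord0 i) => [j|] ->.
  by rewrite rV_consS mxE.
by rewrite rV_cons0.
Qed.

Lemma lebesgue_rV_measure n :
  exists mu : {sigma_finite_measure set 'rV[R]_n -> \bar R},
    @lebesgue_rV n = mu.
Proof.
elim: n => [|n [mu muE]]; first by exists (@dirac _ 'rV[R]_0 0 R).
pose p : {measure set (measurableTypeR R * 'rV[R]_n)%type -> \bar R} :=
  (@lebesgue_measure R \x mu)%E.
pose m : {measure set 'rV[R]_n.+1 -> \bar R} :=
  measure_function_pushforward__canonical__measure_function_Measure p
    (@measurable_rV_cons n).
have mE : @lebesgue_rV n.+1 = m by rewrite /= muE.
have mS : sigma_finite setT m.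
  have /sigma_finiteP[F [FT ndF Foo]] := sigma_finiteT (@lebesgue_measure R).
  have /sigma_finiteP[G [GT ndG Goo]] := sigma_finiteT mu.
  pose g (x : 'rV[R]_n.+1) : measurableTypeR R * 'rV[R]_n :=
    (x ord0 ord0 : measurableTypeR R, \row_j x ord0 (lift ord0 j)).
  have cK : cancel (@rV_cons n) g.
    move=> [a x]; rewrite /g rV_cons0; congr pair.
    by apply/rowP => j; rewrite mxE rV_consS.
  have mg : measurable_fun setT g.
    apply/measurable_fun_pairP; split; first exact: measurable_coord.
    apply: measurable_fun_rVP => i; rewrite (_ : (fun _ => _) =
        fun x : 'rV[R]_n.+1 => x ord0 (lift ord0 i) : measurableTypeR R).
      exact: measurable_coord.
    by apply/funext => x; rewrite mxE.
  exists (fun k => g @^-1` (F k `*` G k)).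
    apply/seteqP; split => // x _.
    have [k _ Fk] : (\bigcup_k F k) (g x).1 by rewrite -FT.
    have [l _ Gl] : (\bigcup_k G k) (g x).2 by rewrite -GT.
    exists (maxn k l) => //; split.
      by move: Fk; exact/subsetPset/ndF/leq_maxl.
    by move: Gl; exact/subsetPset/ndG/leq_maxr.
  move=> k; have [? ?] := Foo k; have [? ?] := Goo k.
  have mFG : measurable (F k `*` G k) by exact: measurableX.
  split; first by rewrite -[X in measurable X]setTI; exact: mg.
  rewrite /m /= /pushforward -comp_preimage (_ : g \o @rV_cons n = id).
    by rewrite preimage_id product_measure1E// lte_mul_pinfty// ge0_fin_numE.
  exact/funext.
pose hm := Measure_isSigmaFinite.Build _ _ _ m mS.
pose m' : {sigma_finite_measure set 'rV[R]_n.+1 -> \bar R} :=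
  HB.pack (m : set _ -> _) (Measure.on m) hm.
by exists m'; rewrite mE.
Qed.

Lemma lebesgue_rV0 n : @lebesgue_rV n set0 = 0%E.
Proof. by have [mu ->] := lebesgue_rV_measure n; rewrite measure0. Qed.

Lemma lebesgue_rV_ge0 n A : (0 <= @lebesgue_rV n A)%E.
Proof. by have [mu ->] := lebesgue_rV_measure n; exact: measure_ge0. Qed.

Lemma lebesgue_rV_sigma_additive n : semi_sigma_additive (@lebesgue_rV n).
Proof.
by have [mu ->] := lebesgue_rV_measure n; exact: measure_semi_sigma_additive.
Qed.

HB.instance Definition _ n := isMeasure.Build _ _ _ (@lebesgue_rV n)
  (@lebesgue_rV0 n) (@lebesgue_rV_ge0 n) (@lebesgue_rV_sigma_additive n).

Lemma lebesgue_rV_sigma_finite n : sigma_finite setT (@lebesgue_rV n).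
Proof. by have [mu ->] := lebesgue_rV_measure n; exact: sigma_finiteT. Qed.

HB.instance Definition _ n := Measure_isSigmaFinite.Build _ _ _
  (@lebesgue_rV n) (@lebesgue_rV_sigma_finite n).

Lemma lebesgue_rV_box n (A : 'I_n -> set (measurableTypeR R)) :
  (forall i, measurable (A i)) ->
  @lebesgue_rV n [set x | forall i, A i (x ord0 i)] =
  (\prod_(i < n) lebesgue_measure (A i))%E.
Proof.
elim: n A => [|n ih] A mA.
  by rewrite big_ord0 /= diracE mem_set //= => -[].
pose B : set 'rV[R]_n := [set x | forall i, A (lift ord0 i) (x ord0 i)].
have mB : measurable B.
  rewrite (_ : B = \bigcap_(i in [set: 'I_n])
      ((fun x : 'rV[R]_n => x ord0 i) @^-1` A (lift ord0 i))); last first.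
    by apply/seteqP; split => x /= xA i; [move=> _|]; exact: xA.
  apply: fin_bigcap_measurable => // i _.
  by rewrite -[X in measurable X]setTI; exact: measurable_coord.
rewrite big_ord_recl -ih //= /pushforward -product_measure1E //.
congr (_ _); apply/seteqP; split => -[a x] /=.
  move=> H; split; first by have := H ord0; rewrite rV_cons0.
  by move=> i; have := H (lift ord0 i); rewrite rV_consS.
move=> [Ha Hx] i; case: (unliftP ord0 i) => [j|] ->.
  by rewrite rV_consS.
by rewrite rV_cons0.
Qed.

End lebesgue_rV.

(* The norm [`|x|] of the library on ['rV[R]_n] is the sup norm. *)
Definition enorm (R : realType) n (x : 'rV[R]_n) : R :=
  Num.sqrt (\sum_i x ord0 i ^+ 2).

Section calculus.
Context {R : realType} {n : nat}.
Local Notation E := 'rV[R]_n.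

Definition partial (W : normedModType R) (i : 'I_n) (f : E -> W) : E -> W :=
  fun x => 'D_(delta_mx ord0 i) f x.

(* [f] is of class [C^k] on [U]; meant for [U] open. *)
Fixpoint Ck_on (W : normedModType R) (k : nat) (U : set E) (f : E -> W) : Prop :=
  match k with
  | 0 => forall x, U x -> {for x, continuous f}
  | k'.+1 => (forall x, U x -> differentiable f x) /\
             (forall i, Ck_on k' U (partial i f))
  end.

(* Only the values of [V] on the unit sphere matter: [C^1] on this submanifold
   means being the restriction of a [C^1] map on a neighbourhood of it. *)
Definition C1_on_sphere (V : E -> E) : Prop :=
  exists U (W : E -> E), [/\ open U, [set x | enorm x = 1] `<=` U, Ck_on 1 U W &
    forall x, enorm x = 1 -> W x = V x].

Definition test_function (phi : E -> R) : Prop :=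
  (forall k, Ck_on k setT (phi : E -> R^o)) /\
  compact (closure [set x | phi x != 0]).

(* Every class in [L^1_loc] has a Borel representative, so Borel measurability
   loses no generality for what only depends on the class of [f]. *)
Definition locally_integrable_rV (f : E -> R) : Prop :=
  measurable_fun setT (f : E -> measurableTypeR R) /\
  forall K, compact K -> (\int[@lebesgue_rV R n]_(x in K) `|f x|%:E < +oo)%E.

(* A distribution is represented by its action on test functions. *)
Definition distr_of (f : E -> R) : (E -> R) -> R :=
  fun phi => \int[@lebesgue_rV R n]_x (f x * phi x).

Definition distr_partial (i : 'I_n) (T : (E -> R) -> R) : (E -> R) -> R :=
  fun phi => - T (partial i (phi : E -> R^o)).

Definition advection (w v : E -> E) (i : 'I_n) (y : E) : R :=
  \sum_j w y ord0 j * partial j ((fun z => v z ord0 i) : E -> R^o) y.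

(* The equations hold as equalities of distributions; since [v] is [C^1] in the
   intended use, [advection] is formed with its classical derivatives. *)
Definition self_similar_profile (a : R) (v : E -> E) (q : E -> R) : Prop :=
  [/\ locally_integrable_rV q,
      forall phi, test_function phi ->
        \sum_i distr_partial i (distr_of (fun y => v y ord0 i)) phi = 0 &
      forall i phi, test_function phi ->
        distr_of (fun y => 1 / (1 + a) * advection id v i y +
                           a / (1 + a) * v y ord0 i) phi =
        distr_of (advection v v i) phi + distr_partial i (distr_of q) phi].

Definition homogeneous_near_infinity (b : R) (V v : E -> E) : Prop :=
  exists2 r : R, 0 < r & forall y, r < enorm y ->
    v y = (enorm y `^ b)^-1 *: V ((enorm y)^-1 *: y).

Definition unit_ball_volume : R :=
  fine (@lebesgue_rV R n [set x | enorm x <= 1]).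

Definition pressure_kernel (i j : 'I_n) (y : E) : R :=
  (n%:R * y ord0 i * y ord0 j - (i == j)%:R * enorm y ^+ 2) /
  (n%:R * unit_ball_volume * enorm y ^+ (n + 2)).

Definition associated_pressure (v : E -> E) (q : E -> R) : Prop :=
  forall y, exists2 pv : R,
    (fun e : R => \int[@lebesgue_rV R n]_(z in [set z | e < enorm (y - z)])
      (\sum_i \sum_j pressure_kernel i j (y - z) * v z ord0 i * v z ord0 j))
      @ 0^'+ --> pv
    & q y = - (enorm (v y) ^+ 2 / n%:R) + pv.

End calculus.

(* Main.v *)
(* Let w = y / (1 + alpha) - v, so that div w = N / (1 + alpha) > 0. The vorticity is
   transported by w up to zeroth-order terms, and a compactly supported solution of
   such an equation vanishes, because w expands volumes. Then v is irrotational and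
   divergence free, so its derivatives are harmonic; they are homogeneous of degree
   - beta - 1 < 0 near infinity, hence vanish by the maximum principle, v is constant
   and homogeneity gives v = 0 unless beta = 0. It remains to see that the vorticity
   vanishes near infinity. If alpha <> beta, the linear part of the equation is there
   (alpha - beta) / (1 + alpha) v, of degree - beta, and the advection has degree
   - 2 beta - 1: comparing q with a dilation of it shows that v is a gradient. If
   alpha = beta = N / 2, the energy e = |v|^2 / 2 satisfies the local conservation law
   div (y e / (1 + alpha) - v (e + q)) = 0; tested against cutoffs at scale t, the first
   flux is independent of t and the second is O(1 / t), so v = 0 near infinity.
   By the equation grad q is a continuous field, so q may be replaced by a C^1 function;
   the vorticity is only continuous, and is mollified to make sense of its transport. *)
Require Import Defs.
From mathcomp Require Import all_boot all_order all_algebra.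
From mathcomp Require Import all_classical all_reals all_analysis.
From mathcomp Require Import measurable_realfun ring lra.

Set Implicit Arguments.
Unset Strict Implicit.
Unset Printing Implicit Defensive.

Import Order.TTheory GRing.Theory Num.Theory.
Import numFieldNormedType.Exports.

Local Open Scope classical_set_scope.
Local Open Scope ring_scope.

(** * Continuous functions on row vectors *)

(** The zeroth-order terms of the vorticity equation may be much larger than the expansion rate
    [N / (1 + alpha)], so an L^2 estimate need not close. With [U] the squared size of the
    vorticity, one integrates instead the divergence of [w U / (U + s)]: as [s] tends to 0,
    [U / (U + s)] tends to the indicator of [U != 0], while its derivative, paired with a growth
    term [K U], gives [K U s / (U + s)^2], which is bounded by [K] and tends to 0 everywhere. Growth
    terms of any size are therefore harmless. As [v] is only C^1, each identity with second
    derivatives (curl of a gradient, closedness of the vorticity, harmonicity of the derivatives of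
    [v]) is proved with the extra derivatives on a smooth kernel, and the mollification is removed
    afterwards. At the critical exponent, [2 alpha = N] acts twice: it makes the energy flux
    divergence free, and it gives [|v|^2] the degree [- N] that balances the volume [t^N] of a
    region rescaled by [t]. The conservation law allows any constant to be subtracted from the
    pressure, a different one at each scale, so no limit of the pressure at infinity has to be
    found. *)

Section row_vectors.
Context {R : realType} {n : nat}.
Implicit Types (x : 'rV[R]_n) (M : R).

Lemma coord_le_norm x i : `|x ord0 i| <= `|x|.
Proof.
rewrite [leRHS]/Num.norm /= mx_normrE; apply/bigmax_geP; right => /=.
by exists (ord0, i).
Qed.

Lemma norm_le_coord x M : 0 <= M -> (forall i, `|x ord0 i| <= M) -> `|x| <= M.
Proof.
move=> M0 xM; rewrite [leLHS]/Num.norm /= mx_normrE; apply/bigmax_leP; split=> //.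
by move=> [i j] _ /=; rewrite (ord1 i).
Qed.

Lemma norm_lt_coord x M : 0 < M -> (forall i, `|x ord0 i| < M) -> `|x| < M.
Proof.
move=> M0 xM; rewrite [ltLHS]/Num.norm /= mx_normrE; apply/bigmax_ltP; split=> //.
by move=> [i j] _ /=; rewrite (ord1 i).
Qed.


Lemma closed_ball_compact M : compact [set x : 'rV[R]_n | `|x| <= M].
Proof.
apply: bounded_closed_compact.
  by exists M; split=> [|N MN x /= xM]; [exact: num_real|rewrite (le_trans xM)// ltW].
have -> : [set x : 'rV[R]_n | `|x| <= M] = (fun x => `|x|) @^-1` [set t : R | t <= M] by [].
apply: preimage_closed; last exact: closed_le.
by move=> x _; exact: norm_continuous.
Qed.

Lemma continuous_bounded_on_ball (f : 'rV[R]_n -> R) M : continuous f ->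
  exists2 C, 0 < C & forall x, `|x| <= M -> `|f x| <= C.
Proof.
move=> cf; have [M0|M0] := ltP M 0.
  by exists 1 => // x xM; have := le_lt_trans xM M0; rewrite normr_lt0.
have [|||c _ cmax] := @EVT_max_rV R n (fun x => `|f x|) [set x : 'rV[R]_n | `|x| <= M].
- by exists 0 => /=; rewrite normr0.
- exact: closed_ball_compact.
- by apply/continuous_subspaceT => x; apply: continuous_comp;
    [exact: cf|exact: norm_continuous].
exists (`|f c| + 1) => [|x xM]; first by rewrite ltr_wpDl.
by rewrite (le_trans (cmax x _)) ?inE// lerDl.
Qed.

(** Only [x] is confined to the ball, so that a mollifier centred in the ball may reach slightly
    outside. Pairs violating the claim at the scales [1 / (k + 1)] would have first components
    clustering at some point, against continuity there. *)
Lemma continuous_unif (f : 'rV[R]_n -> R) M (e : R) : continuous f -> 0 < e ->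
  exists2 d, 0 < d &
    forall x y, `|x| <= M -> `|x - y| < d -> `|f x - f y| < e.
Proof.
move=> cf e0; apply: contrapT => /forall2NP H.
have /choice[u uP] k : exists p : 'rV[R]_n * 'rV[R]_n, [/\ `|p.1| <= M,
    `|p.1 - p.2| < k.+1%:R^-1 & e <= `|f p.1 - f p.2|].
  have [[]|] := H k.+1%:R^-1; first by rewrite invr_gt0 ltr0n.
  move=> /existsNP[x /existsNP[y /not_implyP[xM /not_implyP[xy /negP]]]].
  by rewrite -leNgt => fxy; exists (x, y).
have cK := @closed_ball_compact M.
have FA : \forall k \near \oo, `|(u k).1| <= M.
  by apply: nearW => k; have [] := uP k.
have [x [xM xcl]] := cK ((fun k => (u k).1) @ \oo) _ FA.
have e2 : 0 < e / 2 by rewrite divr_gt0.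
have /cvgrPdist_lt/(_ _ e2)/nbhs_normP[d /= d0 dP] := cf x.
have d2 : 0 < d / 2 by rewrite divr_gt0.
have Fn : \forall k \near \oo, k.+1%:R^-1 < d / 2.
  by apply: (cvgr_lt 0 _ _); [exact: cvg_harmonic|].
have := xcl [set z | exists k, (u k).1 = z /\ k.+1%:R^-1 < d / 2] (ball x (d / 2)) _ _.
case.
- have H1 : \forall k \near \oo, exists j, (u j).1 = (u k).1 /\ j.+1%:R^-1 < d / 2.
    by near=> k; exists k; split=> //; near: k.
  exact: H1.
- by apply: nbhsx_ballx.
move=> _ [[k [<- kd]]]; rewrite -ball_normE /= => xu.
have [uM uu fu] := uP k.
have : `|f x - f (u k).1| < e / 2.
  by apply: dP => /=; rewrite (lt_le_trans xu)// ler_pdivrMr// ler_pMr// ler1n.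
have : `|f x - f (u k).2| < e / 2.
  apply: dP => /=; rewrite (_ : x - _ = (x - (u k).1) + ((u k).1 - (u k).2)); last first.
    by rewrite addrA subrK.
  by rewrite (le_lt_trans (ler_normD _ _))// [ltRHS]splitr ltrD// (lt_trans uu).
move=> h2 h3; move: fu; apply/negP; rewrite -ltNge.
rewrite (_ : _ - _ = (f x - f (u k).2) - (f x - f (u k).1)); last by ring.
by rewrite (le_lt_trans (ler_normB _ _))// [ltRHS]splitr ltrD.
Unshelve. all: end_near. Qed.

Lemma line_coord x (t : R) (k i : 'I_n) :
  (x + t *: delta_mx ord0 k) ord0 i = x ord0 i + t * (i == k)%:R.
Proof. by rewrite !mxE. Qed.

Lemma subr_coord x (y : 'rV[R]_n) (i : 'I_n) :
  (x - y) ord0 i = x ord0 i - y ord0 i.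
Proof. by rewrite !mxE. Qed.

Implicit Types f g : 'rV[R]_n -> R.

Lemma continuous_mul f g : continuous f -> continuous g -> continuous (fun x => f x * g x).
Proof. by move=> cf cg x; exact: (cvgM (cf x) (cg x)). Qed.

Lemma continuous_add f g : continuous f -> continuous g -> continuous (fun x => f x + g x).
Proof. by move=> cf cg x; exact: (cvgD (cf x) (cg x)). Qed.

Lemma continuous_opp f : continuous f -> continuous (fun x => - f x).
Proof. by move=> cf x; exact: (cvgN (cf x)). Qed.

Lemma continuous_sub f g : continuous f -> continuous g -> continuous (fun x => f x - g x).
Proof. by move=> cf cg; apply: continuous_add => //; exact: continuous_opp. Qed.

Lemma continuous_sum (I : Type) (s : seq I) (F : I -> 'rV[R]_n -> R) :
  (forall i, continuous (F i)) -> continuous (fun x => \sum_(i <- s) F i x).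
Proof.
move=> cF; elim: s => [|i s IH].
  have -> : (fun x => \sum_(i <- [::]) F i x) = (fun=> 0).
    by apply/funext => x; rewrite big_nil.
  exact: cst_continuous.
have -> : (fun x => \sum_(i <- i :: s) F i x) = (fun x => F i x + \sum_(i <- s) F i x).
  by apply/funext => x; rewrite big_cons.
exact: (continuous_add (cF i) IH).
Qed.

End row_vectors.

(** * Integration on row vectors *)

Section lebesgue_rV_integration.
Context {R : realType}.
Local Notation E n := 'rV[R]_n.
Local Notation mu n := (@lebesgue_rV R n).

(** The sigma-algebra is generated by the coordinates, so an open set is recovered as the union of
    the countably many rational cubes that it contains. *)
Lemma open_measurable_rV n (U : set (E n)) : open U -> measurable U.
Proof.
move=> oU.
pose box (p : 'rV[rat]_n * rat) : set (E n) :=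
  [set x | forall i,
    x ord0 i \in `]ratr (p.1 ord0 i) - ratr p.2, ratr (p.1 ord0 i) + ratr p.2[].
have mbox p : measurable (box p).
  rewrite (_ : box p = \bigcap_(i in [set: 'I_n]) ((fun x : E n => x ord0 i) @^-1`
      `]ratr (p.1 ord0 i) - ratr p.2, ratr (p.1 ord0 i) + ratr p.2[%classic)); last first.
    by apply/seteqP; split => x /= xA i; [move=> _|]; exact: xA.
  apply: fin_bigcap_measurable => // i _.
  by rewrite -[X in measurable X]setTI; apply: measurable_coord => //; exact: measurable_itv.
have -> : U = \bigcup_p (if `[< box p `<=` U >] then box p else set0).
  apply/seteqP; split=> [x Ux|x [p _]]; last first.
    by case: asboolP => [pU|//]; exact: pU.
  have /nbhs_ballP[e /= e0 xeU] := oU x Ux.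
  have e2 : 0 < e / 2 by rewrite divr_gt0.
  have [r] := rat_in_itvoo e2; rewrite in_itv /= => /andP[r0 re].
  have /choice[c cP] : forall i, exists q : rat, `|x ord0 i - ratr q| < ratr r.
    move=> i; have [|q] := @rat_in_itvoo R (x ord0 i - ratr r) (x ord0 i + ratr r).
      lra.
    rewrite in_itv /= => /andP[q1 q2]; exists q; rewrite ltr_norml; apply/andP; lra.
  exists (\row_i c i, r) => //; case: asboolP => [_|[]].
    move=> i /=; have := cP i; rewrite mxE in_itv /= ltr_norml => /andP[? ?].
    apply/andP; lra.
  move=> y /= yP; apply: xeU; rewrite -ball_normE /=; apply: norm_lt_coord => // i.
  have := yP i; have := cP i; rewrite !mxE in_itv /= !ltr_norml.
  move=> /andP[? ?] /andP[? ?]; apply/andP; lra.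
by apply: countable_bigcupT_measurable => // p; case: asboolP.
Qed.

Lemma continuous_measurable_rV n (f : E n -> R) : continuous f ->
  measurable_fun setT (f : E n -> measurableTypeR R).
Proof.
move=> /continuousP cf; apply: (measurability _ (RGenOpens.measurableE R)).
move=> _ [_ [a [b ->] <-]]; rewrite setTI; apply: open_measurable_rV.
exact/cf/interval_open.
Qed.

Definition bounded_support n (f : E n -> R) :=
  exists M : R, forall x, M < `|x| -> f x = 0.

Lemma closed_ball_measurable n (M : R) : measurable [set x : E n | `|x| <= M].
Proof.
rewrite -[X in measurable X]setCK; apply: measurableC; apply: open_measurable_rV.
have -> : ~` [set x : E n | `|x| <= M] = (fun x => `|x|) @^-1` [set t : R | M < t].
  by apply/seteqP; split=> x /=; rewrite ltNge => /negP.
apply: open_comp; last exact: open_gt.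
by move=> x _; exact: norm_continuous.
Qed.

Lemma lebesgue_rV_closed_ball n (M : R) : 0 <= M ->
  mu n [set x : E n | `|x| <= M] = ((2 * M) ^+ n)%:E.
Proof.
move=> M0.
have -> : [set x : E n | `|x| <= M] =
    [set x | forall i : 'I_n, [set` `[- M, M]] (x ord0 i)].
  apply/seteqP; split=> x /=.
    by move=> xM i /=; rewrite in_itv /= -ler_norml (le_trans _ xM)// coord_le_norm.
  by move=> xM; apply: norm_le_coord => // i; have := xM i; rewrite in_itv /= -ler_norml.
have /= -> := @lebesgue_rV_box R n (fun=> [set` `[- M, M]]) (fun=> measurable_itv _).
under eq_bigr do rewrite lebesgue_measure_itv /= lte_fin.
(* The length of an interval is given by cases on a strict inequality between its ends, so the
   degenerate cube is treated apart; for [n = 0] both sides are 1. *)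
have [->|M1] := eqVneq M 0.
  rewrite oppr0 ltxx mulr0; case: (n) => [|k]; first by rewrite big_ord0.
  by rewrite big_ord_recl mul0e exprS mul0r.
have M2 : 0 < M by rewrite lt_def M1.
rewrite (_ : - M < M); last lra.
rewrite -EFinB opprK (_ : M + M = 2 * M); last lra.
by rewrite -(big_morph _ EFinM erefl) prodr_const card_ord.
Qed.

Lemma continuous_integrable n (f : E n -> R) : continuous f -> bounded_support f ->
  (mu n).-integrable setT (EFin \o f).
Proof.
move=> cf [M fM].
pose M' := Num.max M 0; have M0 : 0 <= M' by rewrite le_max lexx orbT.
have [C C0 fC] := continuous_bounded_on_ball M' cf.
have : (mu n).-integrable [set x : E n | `|x| <= M'] (EFin \o f).
  apply: measurable_bounded_integrable.
  - exact: closed_ball_measurable.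
  - exact: (eq_ind_r (fun t => t < +oo)%E (ltry _) (lebesgue_rV_closed_ball n M0)).
  - by apply: measurable_funTS; exact: continuous_measurable_rV.
  - by exists C; split => [|y Cy x /= xM]; [exact: num_real|rewrite (le_trans (fC _ xM))// ltW].
rewrite integrable_mkcond; last exact: closed_ball_measurable.
congr (_.-integrable _ _); apply/funext => x; rewrite patchE.
case: ifPn => //; rewrite notin_setE /= => /negP; rewrite -ltNge => Mx.
by rewrite fM// (le_lt_trans _ Mx)// le_max lexx.
Qed.

(** Both orders are recorded because [integral_derive0] needs coordinate 0 innermost when it
    differentiates in that coordinate, and outermost otherwise. *)
Lemma lebesgue_rV_Fubini n (f : E n.+1 -> R) :
  continuous f -> bounded_support f ->
  (\int[mu n.+1]_x (f x)%:E =
    \int[lebesgue_measure]_a \int[mu n]_x (f (rV_cons (a, x)))%:E)%E /\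
  (\int[mu n.+1]_x (f x)%:E =
    \int[mu n]_x \int[lebesgue_measure]_a (f (rV_cons (a, x)))%:E)%E.
Proof.
move=> cf sf.
have mf := continuous_measurable_rV cf.
have /integrableP[_ intf] := continuous_integrable cf sf.
pose m := (@lebesgue_measure R \x mu n)%E.
have mc := @measurable_rV_cons R n.
have intf' : m.-integrable setT (EFin \o f \o @rV_cons R n).
  apply/integrableP; split.
    by apply/measurable_EFinP; exact: measurableT_comp.
  move: intf; rewrite [X in (X < _)%E -> _](_ : _ = \int[pushforward m (@rV_cons R n)]_x `|(EFin \o f) x|)%E//.
  rewrite ge0_integral_pushforward//=.
  by do 2 apply: measurableT_comp => //; exact/measurable_EFinP.
have E1 : (\int[mu n.+1]_x (f x)%:E = \int[m]_x ((EFin \o f \o @rV_cons R n) x))%E.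
  rewrite [LHS](_ : _ = \int[pushforward m (@rV_cons R n)]_x ((EFin \o f) x))%E//.
  by rewrite integral_pushforward//; exact/measurable_EFinP.
by split; rewrite E1 ?(integral12_prod_meas1 intf') // -(integral21_prod_meas1 intf').
Qed.

End lebesgue_rV_integration.

(** * Directional derivatives and the symmetry of mixed derivatives *)

Section directional_derivatives.
Context {R : realType}.

(** Both sides are limits of one and the same difference quotient. One-variable results such as the
    mean value theorem and the chain rule become available along lines. *)
Lemma is_derive_lineP (V W : normedModType R) (f : V -> W) (x h : V) (t : R) (l : W) :
  is_derive (x + t *: h) h f l <-> is_derive t 1 (fun s : R => f (x + s *: h)) l.
Proof.
have E : (fun s : R => s^-1 *: ((f \o shift (x + t *: h)) (s *: h) - f (x + t *: h))) =
   (fun s : R => s^-1 *: (((fun s : R => f (x + s *: h)) \o shift t) (s *: (1 : R)) -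
     f (x + t *: h))).
  apply/funext => s /=; congr (_ *: (f _ - _)).
  by rewrite /shift /= -[s *: 1]/(s * 1) mulr1 scalerDl addrCA.
split=> -[d1 d2]; split.
- by move: d1; rewrite /derivable E.
- by rewrite -d2 /derive E.
- by move: d1; rewrite /derivable E.
- by rewrite -d2 /derive E.
Qed.

Lemma MVT_line (V : normedModType R) (f df : V -> R) (x h : V) (s : R) : 0 <= s ->
  (forall t, 0 <= t <= s -> is_derive (x + t *: h) h f (df (x + t *: h))) ->
  exists2 t, 0 <= t <= s & f (x + s *: h) - f x = s * df (x + t *: h).
Proof.
move=> s0 H.
have [t||t] := @MVT_segment R (fun s => f (x + s *: h)) (fun s => df (x + s *: h)) 0 s s0.
- rewrite in_itv /= => /andP[t0 t1].
  by apply: (is_derive_lineP f x h t (df _)).1; apply: H; apply/andP; split; exact: ltW.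
- apply: derivable_within_continuous => t; rewrite in_itv /= => t01.
  by have [] := (is_derive_lineP f x h t (df _)).1 (H _ t01).
- by rewrite in_itv /= scale0r addr0 subr0 mulrC => t01 ->; exists t.
Qed.

Lemma is_derive_translate (V W : normedModType R) (f : V -> W) (c x h : V) (l : W) :
  is_derive (x + c) h f l -> is_derive x h (fun y => f (y + c)) l.
Proof.
have E : (fun s : R => s^-1 *: ((f \o shift (x + c)) (s *: h) - f (x + c))) =
   (fun s : R => s^-1 *: (((fun y => f (y + c)) \o shift x) (s *: h) - f (x + c))).
  by apply/funext => s /=; rewrite /shift /= addrA.
by move=> -[d1 d2]; split; [move: d1; rewrite /derivable E|rewrite -d2 /derive E].
Qed.

(** The second difference of [f] over the parallelogram with sides [s *: h] and [s *: k] is computed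
    in two ways; two applications of the mean value theorem turn each into [s ^+ 2] times a mixed
    derivative at a point near [y]. The hypotheses are local, because the function of interest later
    is a potential only outside a ball. *)
Lemma schwarz_derive (V : normedModType R) (f a b ak bh : V -> R) (y h k : V) (r : R) :
  0 < r ->
  (forall x, `|x - y| < r -> is_derive x h f (a x)) ->
  (forall x, `|x - y| < r -> is_derive x k f (b x)) ->
  (forall x, `|x - y| < r -> is_derive x k a (ak x)) ->
  (forall x, `|x - y| < r -> is_derive x h b (bh x)) ->
  {for y, continuous ak} -> {for y, continuous bh} -> ak y = bh y.
Proof.
move=> r0 fa fb aak bbh cak cbh; apply/eqP/negP => /negP ne.
pose e := `|ak y - bh y| / 2.
have e0 : 0 < e by rewrite divr_gt0// normr_gt0 subr_eq0.
have /cvgrPdist_lt/(_ _ e0)/nbhs_normP[d1 /= d10 dP1] := cak.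
have /cvgrPdist_lt/(_ _ e0)/nbhs_normP[d2 /= d20 dP2] := cbh.
pose d := Num.min r (Num.min d1 d2).
have d0 : 0 < d by rewrite !lt_min r0 d10.
(* Small enough for the whole parallelogram to stay within [d] of [y]; the [+ 1] covers
   [h = k = 0]. *)
pose s := d / (2 * (`|h| + `|k| + 1)).
have hk : 0 < `|h| + `|k| + 1 by rewrite ltr_wpDl// addr_ge0.
have s0 : 0 < s by rewrite divr_gt0// mulr_gt0.
have sd : s * (`|h| + `|k|) < d.
  rewrite /s mulrAC ltr_pdivrMr ?mulr_gt0//.
  have : 0 <= d * (`|h| + `|k|) by rewrite mulr_ge0 ?(ltW d0)// addr_ge0.
  nra.
have close t u : 0 <= t <= s -> 0 <= u <= s -> `|(y + t *: h + u *: k) - y| < d.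
  move=> /andP[t0 ts] /andP[u0 us].
  rewrite addrAC [y + _ - y]addrAC subrr add0r (le_lt_trans (ler_normD _ _))// !normrZ !ger0_norm//.
  apply: le_lt_trans sd; rewrite mulrDr lerD// ler_wpM2r//.
have rd x : `|x - y| < d -> [/\ `|x - y| < r, `|x - y| < d1 & `|x - y| < d2].
  by rewrite !lt_min => /and3P[].
have ss : 0 <= s <= s by rewrite lexx ltW.
have s00 : 0 <= (0 : R) <= s by rewrite lexx ltW.
have [t1 t1s E1] : exists2 t, 0 <= t <= s &
    (f (y + s *: h + s *: k) - f (y + s *: h)) - (f (y + s *: k) - f y) =
    s * (a (y + t *: h + s *: k) - a (y + t *: h)).
  have [t ts|t ts E] := @MVT_line _ (fun x => f (x + s *: k) - f x)
    (fun x => a (x + s *: k) - a x) y h s (ltW s0).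
    apply: is_deriveB.
      by apply: is_derive_translate; apply: fa; have [] := rd _ (close _ _ ts ss).
    by apply: fa; have [] := rd _ (close _ _ ts s00); rewrite scale0r addr0.
  by exists t => //; rewrite -E.
have [u1 u1s E1'] : exists2 u, 0 <= u <= s &
    a (y + t1 *: h + s *: k) - a (y + t1 *: h) = s * ak (y + t1 *: h + u *: k).
  apply: MVT_line (ltW s0) _ => u us.
  by apply: aak; have [] := rd _ (close _ _ t1s us).
have [u2 u2s E2] : exists2 u, 0 <= u <= s &
    (f (y + s *: k + s *: h) - f (y + s *: k)) - (f (y + s *: h) - f y) =
    s * (b (y + u *: k + s *: h) - b (y + u *: k)).
  have [u us|u us E] := @MVT_line _ (fun x => f (x + s *: h) - f x)
    (fun x => b (x + s *: h) - b x) y k s (ltW s0).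
    apply: is_deriveB.
      apply: is_derive_translate; apply: fb.
      by have [] := rd _ (close _ _ ss us); rewrite [y + u *: k + _]addrAC.
    by apply: fb; have [] := rd _ (close _ _ s00 us); rewrite scale0r addr0.
  by exists u => //; rewrite -E.
have [t2 t2s E2'] : exists2 t, 0 <= t <= s &
    b (y + u2 *: k + s *: h) - b (y + u2 *: k) = s * bh (y + u2 *: k + t *: h).
  apply: MVT_line (ltW s0) _ => t ts.
  by apply: bbh; have [] := rd _ (close _ _ ts u2s); rewrite [y + u2 *: k + _]addrAC.
have EE : ak (y + t1 *: h + u1 *: k) = bh (y + t2 *: h + u2 *: k).
  apply: (mulfI (lt0r_neq0 s0)); rewrite -E1'.
  apply: (mulfI (lt0r_neq0 s0)); rewrite -E1 [y + t2 *: h + _]addrAC -E2' -E2.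
  rewrite [y + s *: k + s *: h]addrAC; ring.
have [_ c1 _] := rd _ (close _ _ t1s u1s).
have [_ _ c2] := rd _ (close _ _ t2s u2s).
have {}c1 : `|ak y - ak (y + t1 *: h + u1 *: k)| < e by apply: dP1; rewrite /= distrC.
have {}c2 : `|bh y - bh (y + t2 *: h + u2 *: k)| < e by apply: dP2; rewrite /= distrC.
have : `|ak y - bh y| < e + e.
  have -> : ak y - bh y = (ak y - ak (y + t1 *: h + u1 *: k)) -
      (bh y - bh (y + t2 *: h + u2 *: k)) by rewrite EE; ring.
  by rewrite (le_lt_trans (ler_normB _ _))// ltrD.
by rewrite /e -splitr ltxx.
Qed.

Lemma is_derive_near0 (V : normedModType R) (f : V -> R) (x h : V) l :
  (\forall y \near x, f y = 0) -> is_derive x h f l -> l = 0.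
Proof.
move=> f0 [df <-].
have -> : 'D_h f x = 'D_h (cst (0 : R)) x.
  by apply: near_eq_derive; near=> y; rewrite /=; near: y.
by rewrite derive_cst.
Unshelve. all: end_near. Qed.

End directional_derivatives.

(** * Integrals of derivatives of functions with bounded support *)

Section integration_by_parts.
Context {R : realType}.
Local Notation E n := 'rV[R]_n.
Local Notation mu n := (@lebesgue_rV R n).

Lemma bounded_support_is_derive n (g dg : E n -> R) h : bounded_support g ->
  (forall x, is_derive x h g (dg x)) -> bounded_support dg.
Proof.
move=> [M gM] dgP; exists M => x Mx; apply: is_derive_near0 (dgP x).
have : \forall y \near x, M < `|y|.
  exact: (cvgr_gt _ (@norm_continuous _ _ x) _ Mx).
by apply: filterS => y; exact: gM.
Qed.



Lemma rV_cons_line0 n (a t : R) (x : E n) :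
  rV_cons (a, x) + t *: delta_mx ord0 ord0 = rV_cons (a + t, x).
Proof.
apply/rowP => i; rewrite line_coord.
have [j|] := unliftP ord0 i => ->; first by rewrite !rV_consS /= mulr0 addr0.
by rewrite !rV_cons0 eqxx mulr1.
Qed.

Lemma rV_cons_lineS n (a t : R) (x : E n) k :
  rV_cons (a, x) + t *: delta_mx ord0 (lift ord0 k) =
  rV_cons (a, x + t *: delta_mx ord0 k).
Proof.
apply/rowP => i; rewrite line_coord.
have [j|] := unliftP ord0 i => ->.
  by rewrite !rV_consS /= line_coord (inj_eq lift_inj).
by rewrite !rV_cons0 /= mulr0 addr0.
Qed.

Lemma norm_rV_cons_ge n (a : R) (x : E n) :
  `|a| <= `|rV_cons (a, x)| /\ `|x| <= `|rV_cons (a, x)|.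
Proof.
split; first by have := coord_le_norm (rV_cons (a, x)) ord0; rewrite rV_cons0.
apply: norm_le_coord => // i.
by have := coord_le_norm (rV_cons (a, x)) (lift ord0 i); rewrite rV_consS.
Qed.

Lemma continuous_rV_cons1 n (x : E n) : continuous (fun a : R => rV_cons (a, x) : E n.+1).
Proof.
have -> : (fun a : R => rV_cons (a, x) : E n.+1) =
    (fun a => rV_cons (0, x) + a *: delta_mx ord0 ord0).
  by apply/funext => a; rewrite rV_cons_line0 add0r.
move=> a; apply: cvgD; first exact: cvg_cst.
by apply: cvgZl; exact: cvg_id.
Qed.

Lemma continuous_rV_cons2 n (a : R) : continuous (fun x : E n => rV_cons (a, x) : E n.+1).
Proof.
move=> x; apply/(@cvgrPdist_lt _ _ _ _ (nbhs_filter x)) => e e0.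
have H : \forall y \near x, `|x - y| < e by apply/nbhs_normP; exists e.
apply: filterS H => y xy.
apply: norm_lt_coord => // i; rewrite subr_coord.
have [j|] := unliftP ord0 i => ->; last by rewrite !rV_cons0 subrr normr0.
rewrite !rV_consS /=; have := coord_le_norm (x - y) j; rewrite subr_coord => /le_lt_trans.
exact.
Qed.

Lemma Rintegral_derive0 (g dg : R -> R) (M : R) : continuous dg ->
  (forall t : R, is_derive t 1 g (dg t)) -> (forall t : R, M < `|t| -> g t = 0) ->
  (\int[lebesgue_measure]_t (dg t)%:E = 0)%E.
Proof.
move=> cdg gP gM; pose M' := `|M| + 1.
have M0 : 0 < M' by rewrite ltr_wpDl.
have MM (t : R) : M' <= `|t| -> M < `|t|.
  by apply: lt_le_trans; rewrite /M'; have := ler_norm M; lra.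
have cg : continuous g.
  by move=> t; apply/differentiable_continuous/derivable1_diffP; have [] := gP t.
have dg0 (t : R) : M < `|t| -> dg t = 0.
  move=> Mt; apply: is_derive_near0 (gP t).
  have H : \forall y \near t, M < `|y|.
    exact: (cvgr_gt _ (@norm_continuous _ R t) _ Mt).
  by move: H; apply: filterS => y; exact: gM.
rewrite (_ : (fun t => _) = (EFin \o dg) \_ [set` `[- M', M']]); last first.
  apply/funext => t; rewrite patchE; case: ifPn => //.
  rewrite notin_setE /= in_itv /= -ler_norml => /negP; rewrite -ltNge => Mt.
  by rewrite dg0// MM// ltW.
rewrite -integral_mkcond (continuous_FTC2 (F := g)).
- by rewrite !gM ?subee// MM// ?normrN gtr0_norm.
- lra.
- by apply: continuous_subspaceT.
- split=> [t _||]; first by have [] := gP t.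
  + exact/cvg_at_right_filter/cg.
  + exact/cvg_at_left_filter/cg.
- by move=> t _; rewrite derive1E; have [_ ->] := gP t.
Qed.

(** Induction on the dimension. If [k] is the first coordinate, Fubini leaves an inner integral
    along lines, which vanishes by the fundamental theorem of calculus; otherwise the inner integral
    is over a slice of lower dimension. *)
Lemma integral_derive0 n (k : 'I_n) (g dg : E n -> R) :
  continuous g -> continuous dg -> bounded_support g ->
  (forall x, is_derive x (delta_mx ord0 k) g (dg x)) ->
  (\int[mu n]_x (dg x)%:E = 0)%E.
Proof.
elim: n k g dg => [[]//|n IH] k g dg cg cdg sg gP.
have sdg := bounded_support_is_derive sg gP.
have [M gM] := sg.
have [F1 F2] := lebesgue_rV_Fubini cdg sdg.
have [j|] := unliftP ord0 k => kE; last first.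
  rewrite F2; apply: integral0_eq => x _.
  apply: (@Rintegral_derive0 (fun a => g (rV_cons (a, x)))
    (fun a => dg (rV_cons (a, x))) M).
  - by move=> a; apply: continuous_comp; [exact: continuous_rV_cons1|exact: cdg].
  - move=> t; have := gP (rV_cons (t, x)); rewrite kE.
    have -> : rV_cons (t, x) = rV_cons (0, x) + t *: delta_mx ord0 ord0.
      by rewrite rV_cons_line0 add0r.
    move=> /is_derive_lineP.
    by under eq_fun do rewrite rV_cons_line0 add0r.
  - by move=> t Mt; rewrite gM// (lt_le_trans Mt)//; have [] := norm_rV_cons_ge t x.
rewrite F1; apply: integral0_eq => a _.
apply: (IH j (fun x => g (rV_cons (a, x))) (fun x => dg (rV_cons (a, x)))).
- by move=> x; apply: continuous_comp; [exact: continuous_rV_cons2|exact: cg].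
- by move=> x; apply: continuous_comp; [exact: continuous_rV_cons2|exact: cdg].
- exists M => x Mx; rewrite gM// (lt_le_trans Mx)//.
  by have [] := norm_rV_cons_ge a x.
- move=> x; have := gP (rV_cons (a, x)).
  have -> : rV_cons (a, x) = rV_cons (a, x) + 0 *: delta_mx ord0 k.
    by rewrite scale0r addr0.
  move=> /is_derive_lineP; rewrite kE.
  under eq_fun do rewrite rV_cons_lineS.
  rewrite scale0r addr0 => H.
  have -> : x = x + 0 *: delta_mx ord0 j by rewrite scale0r addr0.
  by apply/is_derive_lineP; rewrite scale0r addr0.
Qed.

End integration_by_parts.

(** * Smooth bumps *)

Section flat_functions.
Context {R : realType}.
Implicit Types (p q : {poly R}) (x u : R).

(* The derivative of a flat function is again flat, so that smoothness reduces to
   an induction over the polynomial [p]. *)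
Definition flat p x : R := if 0 < x then p.[x^-1] * expR (- x^-1) else 0.

Lemma horner_bound q : exists A : R, exists d : nat,
  0 <= A /\ forall u, 1 <= u -> `|q.[u]| <= A * u ^+ d.
Proof.
elim/poly_ind: q => [|q c [A [d [A0 qA]]]].
  by exists 0, 0%N; split=> // u _; rewrite horner0 normr0 mul0r.
exists (A + `|c|), d.+1; split=> [|u u1]; first by rewrite addr_ge0.
rewrite hornerMXaddC (le_trans (ler_normD _ _))// normrM mulrDl lerD//.
  by rewrite (@ger0_norm _ u) ?(le_trans ler01)// exprSr mulrA ler_wpM2r ?qA// (le_trans ler01).
by rewrite ler_peMr// exprn_ege1.
Qed.

(** With [u = x^-1], the bound [(u / (d + 1)) ^ (d + 1) <= exp u] beats a polynomial of degree [d]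
    with one power of [u] to spare; that power is the factor [x]. *)
Lemma flat_le q : exists2 C : R, 0 <= C & forall x, 0 < x -> x <= 1 -> `|flat q x| <= C * x.
Proof.
have [A [d [A0 qA]]] := horner_bound q.
exists (A * d.+1%:R ^+ d.+1) => [|x x0 x1]; first by rewrite mulr_ge0// exprn_ge0.
have u1 : 1 <= x^-1 by rewrite invf_ge1.
rewrite /flat x0 normrM (@ger0_norm _ (expR _)) ?expR_ge0//.
rewrite (le_trans (ler_wpM2r (expR_ge0 _) (qA _ u1)))// -!mulrA ler_wpM2l//.
have u0 : 0 < x^-1 by rewrite invr_gt0.
rewrite expRN ler_pdivrMr ?expR_gt0//.
have : (x^-1 / d.+1%:R) ^+ d.+1 <= expR (x^-1).
  rewrite [X in expR X](_ : _ = d.+1%:R * (x^-1 / d.+1%:R)); last first.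
    by rewrite mulrCA divff ?mulr1// pnatr_eq0.
  rewrite expRM_natl lerXn2r ?nnegrE ?expR_ge0 ?divr_ge0 ?(ltW u0)//.
  by rewrite (le_trans _ (expR_ge1Dx _))// lerDr.
rewrite expr_div_n ler_pdivrMr ?exprn_gt0// => H.
have -> : x^-1 ^+ d = x^-1 ^+ d.+1 * x by rewrite exprSr mulfVK ?gt_eqF.
by rewrite (le_trans (ler_wpM2r (ltW x0) H))// le_eqVlt; apply/orP; left; apply/eqP; ring.
Qed.

(** Differentiating [p(1 / x) exp(- 1 / x)] produces [(p - p') (1 / x)] times [x ^ -2], whence the
    new polynomial. At 0 the difference quotient is the flat function of [p * 'X], so [flat_le]
    makes it tend to 0. *)
Lemma is_derive_flat p x : is_derive x 1 (flat p) (flat ((p - p^`()) * 'X^2) x).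
Proof.
have [x0|x0|->] := ltgtP x 0.
- rewrite [X in is_derive _ _ _ X]/flat ltNge (ltW x0) /=.
  apply: (@near_eq_is_derive _ _ _ (cst (0 : R)) _ x 1 0).
  have H : \forall y \near x, y < 0 by exact: lt_nbhsl.
  by move: H; apply: filterS => y y0; rewrite /flat ltNge (ltW y0).
- pose g := (fun y : R => p.[y^-1] * expR (- y^-1)).
  have H : \forall y \near x, g y = flat p y.
    have H : \forall y \near x, 0 < y by exact: lt_nbhsr.
    by move: H; apply: filterS => y y0; rewrite /flat y0.
  apply: near_eq_is_derive H _.
  have x0' : x != 0 by rewrite gt_eqF.
  have dV : is_derive x 1 (fun y : R => y^-1) (- x ^- 2).
    split; first exact: derivableV.
    by rewrite deriveV// derive_id scaler1.
  have dp : is_derive (x^-1) 1 (horner p) (p^`().[x^-1]).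
    by split; [exact: derivable_horner|rewrite -derive1E -derivE].
  have d1 : is_derive x 1 (fun y : R => p.[y^-1]) (p^`().[x^-1] * (- x ^- 2)).
    exact: is_derive1_comp.
  have d2 : is_derive x 1 (fun y : R => expR (- y^-1)) (expR (- x^-1) * - (- x ^- 2)).
    exact: is_derive1_comp.
  apply: is_derive_eq (is_deriveM d1 d2) _.
  rewrite /flat x0 /GRing.scale /= hornerM hornerXn hornerD hornerN exprVn.
  by field.
- have [C C0 qC] := flat_le (p * 'X).
  rewrite /flat ltxx.
  have H : h^-1 *: (((flat p) \o shift 0) (h *: (1 : R)) - flat p 0) @[h --> 0^'] --> (0 : R).
    apply/cvgrPdist_le => e e0; near=> h.
    have h0 : h != 0 by near: h; exact: nbhs_dnbhs_neq.
    rewrite /= /shift /= addr0 -[h *: 1]/(h * 1) mulr1 {2}/flat ltxx subr0 sub0r normrN.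
    have [hp|hn] := ltP 0 h; last by rewrite /flat ltNge hn /= scaler0 normr0 ltW.
    rewrite -[_ *: _]/(_ * _).
    have -> : h^-1 * flat p h = flat (p * 'X) h.
      by rewrite /flat hp hornerMX; ring.
    have h1 : `|h| < Num.min 1 (e / (C + 1)).
      near: h; apply: dnbhs0_lt; rewrite lt_min ltr01 divr_gt0// ltr_wpDl//.
    move: h1; rewrite gtr0_norm// lt_min => /andP[h1 h2].
    rewrite (le_trans (qC _ hp (ltW h1)))//.
    move: h2; rewrite ltr_pdivlMr ?ltr_wpDl// => h2; nra.
  by split; [apply/cvg_ex; exists 0|exact: cvg_lim].
Unshelve. all: end_near. Qed.

End flat_functions.

Section smooth_functions.
Context {R : realType} {n : nat}.
Local Notation E := 'rV[R]_n.
Implicit Types (f g : E -> R^o) (x h : E).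

Lemma is_derive_differentiable f x h : differentiable f x ->
  is_derive x h f (\sum_i h ord0 i * partial i f x).
Proof.
move=> df; split; first exact: diff_derivable.
rewrite deriveE// [X in 'd f x X](row_sum_delta h) linear_sum.
by apply: eq_bigr => i _; rewrite linearZ /= /partial deriveE.
Qed.

Lemma Ck_onW k f : Ck_on k.+1 setT f -> Ck_on k setT f.
Proof.
elim: k f => [f [df _] x _|k IH f [df pf]].
  exact/differentiable_continuous/df.
by split=> // i; exact: IH.
Qed.

Lemma partialD f g i x : differentiable f x -> differentiable g x ->
  partial i (fun y => f y + g y : R^o) x = partial i f x + partial i g x.
Proof. by move=> df dg; rewrite /partial deriveD//; exact: diff_derivable. Qed.

Lemma partialM f g i x : differentiable f x -> differentiable g x ->
  partial i (fun y => f y * g y : R^o) x = f x * partial i g x + g x * partial i f x.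
Proof. by move=> df dg; rewrite /partial deriveM//; exact: diff_derivable. Qed.

Lemma Ck_onD k f g : Ck_on k setT f -> Ck_on k setT g ->
  Ck_on k setT (fun x => f x + g x : R^o).
Proof.
elim: k f g => [f g cf cg x _|k IH f g [df pf] [dg pg]].
  exact: (cvgD (cf x I) (cg x I)).
split=> [x _|i]; first by apply: differentiableD; [exact: df|exact: dg].
have -> : partial i (fun x => f x + g x : R^o) = (fun x => partial i f x + partial i g x : R^o).
  by apply/funext => x; rewrite partialD//; [exact: df|exact: dg].
exact: (IH _ _ (pf i) (pg i)).
Qed.

Lemma Ck_onM k f g : Ck_on k setT f -> Ck_on k setT g ->
  Ck_on k setT (fun x => f x * g x : R^o).
Proof.
elim: k f g => [f g cf cg x _|k IH f g Cf Cg].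
  exact: (cvgM (cf x I) (cg x I)).
have [[df pf] [dg pg]] := (Cf, Cg).
split=> [x _|i]; first by apply: differentiableM; [exact: df|exact: dg].
have -> : partial i (fun x => f x * g x : R^o) =
    (fun x => f x * partial i g x + g x * partial i f x : R^o).
  by apply/funext => x; rewrite partialM//; [exact: df|exact: dg].
exact: (Ck_onD (IH _ _ (Ck_onW Cf) (pg i)) (IH _ _ (Ck_onW Cg) (pf i))).
Qed.

Lemma Ck_on_cst k (c : R) : Ck_on k setT (cst c : E -> R^o).
Proof.
elim: k c => [c x _|k IH c].
  exact: (differentiable_continuous (differentiable_cst (c : R^o) x)).
split=> [x _|i]; first exact: differentiable_cst.
have -> : partial i (cst c : E -> R^o) = cst 0.
  by apply/funext => x; rewrite /partial derive_cst.
exact: IH.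
Qed.

Lemma is_derive_affine (f : E -> R) (y : E) (s : R) x h l :
  is_derive (y + s *: x) (s *: h) f l -> is_derive x h (fun z => f (y + s *: z)) l.
Proof.
rewrite -[y + s *: x]addr0 -[X in _ + X](scale0r (s *: h)) => /is_derive_lineP.
rewrite -[x in is_derive x h]addr0 -[X in is_derive (_ + X)](scale0r h) => H.
apply/is_derive_lineP; move: H; congr (is_derive _ _ _ _).
by apply/funext => t; rewrite scalerDr addrA !scalerA [t * s]mulrC.
Qed.

Lemma differentiable_affine f (y : E) (s : R) x i : differentiable f (y + s *: x) ->
  differentiable (fun z => f (y + s *: z)) x /\
  partial i (fun z => f (y + s *: z)) x = s * partial i f (y + s *: x).
Proof.
move=> df.
have da : differentiable (fun z => y + s *: z) x by [].
have dc : differentiable (fun z => f (y + s *: z)) x by exact: differentiable_comp.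
split=> //; rewrite /partial.
have H : is_derive (y + s *: x) (s *: delta_mx ord0 i) f (s * 'D_(delta_mx ord0 i) f (y + s *: x)).
  split; first exact: diff_derivable.
  by rewrite (deriveE _ df) (deriveE _ df) linearZ.
by have [_ ->] := is_derive_affine H.
Qed.

Lemma Ck_on_affine k f (y : E) (s : R) : Ck_on k setT f ->
  Ck_on k setT (fun x => f (y + s *: x)).
Proof.
elim: k f => [f cf x _|k IH f [df pf]].
  apply: (@continuous_comp _ _ _ (fun x => y + s *: x)); last exact: cf.
  exact: differentiable_continuous.
split=> [x _|i]; first by apply: (@differentiable_comp _ _ _ _ (fun z => y + s *: z)); last exact: df.
have -> : partial i (fun x => f (y + s *: x)) = (fun x => cst s x * partial i f (y + s *: x) : R^o).
  by apply/funext => x; have [_ ->] := differentiable_affine i (df (y + s *: x) I).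
exact: (Ck_onM (Ck_on_cst k s) (IH (partial i f) (pf i))).
Qed.

Lemma flat_coord_partial p (c a : R) (j i : 'I_n) x :
  differentiable (fun x => flat p (c + a * x ord0 j) : R^o) x /\
  partial i (fun x => flat p (c + a * x ord0 j) : R^o) x =
  (a * (i == j)%:R) * flat ((p - p^`()) * 'X^2) (c + a * x ord0 j).
Proof.
have dl : differentiable (fun x : E => c + a * x ord0 j : R) x.
  have dj : differentiable (fun x : E => x ord0 j : R^o) x by exact: differentiable_coord.
  by apply: differentiableD => //; apply: differentiableM.
split.
  apply: (differentiable_comp dl); apply/derivable1_diffP.
  by have [] := is_derive_flat p (c + a * x ord0 j).
have : is_derive (x + 0 *: delta_mx ord0 i) (delta_mx ord0 i)
    (fun x : E => flat p (c + a * x ord0 j)) ((a * (i == j)%:R) *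
      flat ((p - p^`()) * 'X^2) (c + a * x ord0 j)).
  apply/is_derive_lineP.
  under eq_fun do rewrite line_coord.
  have d1 : is_derive (0 : R) 1 (fun t : R => c + a * (x ord0 j + t * (j == i)%:R)) (a * (i == j)%:R).
    have -> : (fun t : R => c + a * (x ord0 j + t * (j == i)%:R)) =
        cst (c + a * x ord0 j) + (a * (j == i)%:R) *: id.
      by apply/funext => t /=; rewrite !fctE /= /GRing.scale /= mulrDr addrA (mulrC t) mulrA.
    apply: (is_derive_eq (is_deriveD (is_derive_cst _ _ _) (is_deriveZ _ (is_derive_id _ _)))).
    by rewrite add0r /GRing.scale /= mulr1 eq_sym.
  have d2 := is_derive_flat p (c + a * (x ord0 j + 0 * (j == i)%:R)).
  rewrite mulrC; have := @is_derive1_comp _ (flat p) (fun t : R => c + a * (x ord0 j + t * (j == i)%:R)) 0 _ _ d2 d1.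
  by rewrite mul0r addr0.
by rewrite scale0r addr0 => -[].
Qed.


Lemma Ck_on_flat k p (c a : R) (j : 'I_n) :
  Ck_on k setT (fun x => flat p (c + a * x ord0 j) : R^o).
Proof.
elim: k p => [p x _|k IH p].
  apply: differentiable_continuous.
  by have [] := flat_coord_partial p c a j j x.
split=> [x _|i]; first by have [] := flat_coord_partial p c a j j x.
have -> : partial i (fun x => flat p (c + a * x ord0 j) : R^o) =
  (fun x => cst (a * (i == j)%:R) x * flat ((p - p^`()) * 'X^2) (c + a * x ord0 j) : R^o).
  by apply/funext => x; have [_ ->] := flat_coord_partial p c a j i x.
exact: (Ck_onM (Ck_on_cst k _) (IH _)).
Qed.

Lemma Ck_on_prod k (I : Type) (s : seq I) (F : I -> E -> R^o) :
  (forall i, Ck_on k setT (F i)) -> Ck_on k setT (fun x => \prod_(i <- s) F i x : R^o).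
Proof.
move=> HF; elim: s => [|i s IH].
  by under eq_fun do rewrite big_nil; exact: Ck_on_cst.
by under eq_fun do rewrite big_cons; exact: (Ck_onM (HF i) IH).
Qed.

End smooth_functions.

(** * Convolution *)

Section convolution.
Context {R : realType} {n : nat}.
Local Notation E := 'rV[R]_n.
Local Notation mu := (@lebesgue_rV R n).
Implicit Types (f : E -> R) (k : E -> R).

Lemma compact_measurable_rV (K : set E) : compact K -> measurable K.
Proof.
move=> cK; rewrite -[K]setCK; apply: measurableC; apply: open_measurable_rV.
by apply: closed_openC; apply: compact_closed => //; exact: norm_hausdorff.
Qed.

Lemma continuous_locally_integrable f : continuous f -> locally_integrable_rV f.
Proof.
move=> cf; split=> [|K cK]; first exact: continuous_measurable_rV.
have [M [_ KM]] := compact_bounded cK.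
have [C C0 fC] := continuous_bounded_on_ball (`|M| + 1) cf.
have mK := compact_measurable_rV cK.
have fK x : K x -> `|f x| <= C.
  move=> Kx; apply: fC; apply: KM Kx.
  by rewrite (le_lt_trans (ler_norm M))// ltrDl.
apply: (@le_lt_trans _ _ (\int[mu]_(x in K) C%:E)%E).
  apply: ge0_le_integral => //=.
  do 2 apply: measurableT_comp => //.
  exact: (measurable_funTS (continuous_measurable_rV cf)).
rewrite integral_cst//.
have KB : K `<=` [set x : E | `|x| <= `|M| + 1].
  move=> x Kx /=; apply: KM Kx.
  by rewrite (le_lt_trans (ler_norm M))// ltrDl.
have : (mu K < +oo)%E.
  apply: (@le_lt_trans _ _ (mu [set x : E | `|x| <= `|M| + 1])).
    by apply: le_measure; rewrite ?inE//; exact: closed_ball_measurable.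
  have M1 : 0 <= `|M| + 1 by rewrite addr_ge0.
  exact: (eq_ind_r (fun t => t < +oo)%E (ltry _) (lebesgue_rV_closed_ball n M1)).
by move=> h; rewrite lte_mul_pinfty// lee_fin ltW.
Qed.

Lemma bounded_continuous k : continuous k -> bounded_support k ->
  exists2 C, 0 < C & forall x, `|k x| <= C.
Proof.
move=> ck [M kM]; have [C C0 kC] := continuous_bounded_on_ball M ck.
exists C => // x; have [xM|Mx] := leP `|x| M; first exact: kC.
by rewrite kM// normr0 ltW.
Qed.

Lemma locally_integrable_cutoff f (M : R) : locally_integrable_rV f ->
  mu.-integrable setT (EFin \o (fun z => `|f z| * (`|z| <= M)%R%:R)).
Proof.
move=> [mf intf].
have mB := @closed_ball_measurable R n M.
have : mu.-integrable [set x : E | `|x| <= M] (EFin \o f).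
  apply/integrableP; split; last exact: intf (@closed_ball_compact R n M).
  by apply/measurable_EFinP; apply: measurable_funTS.
move=> /integrable_norm; rewrite integrable_mkcond//.
congr (_.-integrable _ _); apply/funext => z; rewrite patchE /=.
case: ifPn; first by rewrite inE /= => ->; rewrite mulr1.
by rewrite notin_setE /= => /negP/negbTE ->; rewrite mulr0.
Qed.

Lemma measurable_shift k y : continuous k ->
  measurable_fun setT (fun z : E => k (y - z) : measurableTypeR R).
Proof.
move=> ck; apply: continuous_measurable_rV => z.
apply: continuous_comp; last exact: ck.
have : differentiable (fun z : E => y - z) z by [].
exact: differentiable_continuous.
Qed.

Lemma conv_integrable f k y : locally_integrable_rV f -> continuous k ->
  bounded_support k -> mu.-integrable setT (EFin \o (fun z => f z * k (y - z))).
Proof.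
move=> lf ck sk; have [C C0 kC] := bounded_continuous ck sk.
have [M kM] := sk.
have /(integrableZl measurableT C) := locally_integrable_cutoff (`|y| + M) lf.
apply: le_integrable => //.
  apply/measurable_EFinP; apply: measurable_funM; first by case: lf.
  exact: measurable_shift.
move=> z _ /=; rewrite lee_fin normrM.
have [zM|Mz] := leP `|z| (`|y| + M).
  by rewrite mulr1 [X in _ <= X]ger0_norm ?mulr_ge0 ?(ltW C0)// mulrC ler_wpM2r.
rewrite kM ?normr0 ?mulr0//.
have := ler_normB y (y - z); rewrite opprB addrCA subrr addr0 => h.
by rewrite -(ltrD2l `|y|) (lt_le_trans Mz).
Qed.

Definition conv f k y : R := \int[mu]_z (f z * k (y - z)).

Lemma is_derive_conv f k dk h y : locally_integrable_rV f ->
  continuous k -> continuous dk -> bounded_support k ->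
  (forall x, is_derive x h k (dk x)) -> is_derive y h (conv f k) (conv f dk y).
Proof.
move=> lf ck cdk sk kP.
have sdk := bounded_support_is_derive sk kP.
have [C C0 dkC] := bounded_continuous cdk sdk.
have [M dkM] := sdk.
pose F (t : R) z := f z * k (y + t *: h - z).
have dF (t : R) z : is_derive t 1 (F ^~ z) (f z * dk (y + t *: h - z)).
  have H : is_derive (y - z + t *: h) h k (dk (y - z + t *: h)) by [].
  move/is_derive_lineP : H => H.
  have -> : F ^~ z = f z *: (fun s => k (y - z + s *: h)).
    by apply/funext => s; rewrite /F addrAC.
  by rewrite addrAC; exact: is_deriveZ.
pose G z := C * (`|f z| * (`|z| <= `|y| + `|h| + M)%R%:R).
have I0 : `](-1), 1[%classic (0 : R) by rewrite /= in_itv /= ltrN10 ltr01.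
have intF (t : R) : `](-1), 1[%classic t -> mu.-integrable setT (EFin \o F t).
  by move=> _; exact: conv_integrable.
have derF (t : R) z : `](-1), 1[%classic t -> setT z -> derivable (F ^~ z) t 1.
  by move=> _ _; have [] := dF t z.
have G0 z : 0 <= G z by rewrite mulr_ge0 ?(ltW C0)// mulr_ge0.
have intG : mu.-integrable setT (EFin \o G).
  exact: (integrableZl measurableT C (locally_integrable_cutoff (`|y| + `|h| + M) lf)).
have FG (t : R) z : `](-1), 1[%classic t -> setT z -> `|partial1of2 F t z| <= G z.
  rewrite /= in_itv /= => t1 _; rewrite partial1of2E; have [_ ->] := dF t z.
  rewrite normrM /G mulrCA ler_wpM2l//.
  have [zM|Mz] := leP `|z| (`|y| + `|h| + M); first by rewrite mulr1.
  rewrite dkM ?normr0 ?mulr0//.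
  have := ler_normB (y + t *: h) (y + t *: h - z); rewrite opprB addrCA subrr addr0.
  have := ler_normD y (t *: h); rewrite normrZ.
  have : `|t| * `|h| <= `|h|.
    by rewrite ler_piMl// ltW// ltr_norml.
  by move: Mz; lra.
have H1 := @derivable_under_integral _ _ _ mu F setT measurableT 0 (-1) 1 I0 intF derF G G0 intG FG.
have H2 := @differentiation_under_integral _ _ _ mu F setT measurableT 0 (-1) 1 I0 intF derF G G0 intG FG.
have H3 : is_derive (0 : R) 1 (fun t : R => conv f k (y + t *: h)) (conv f dk y).
  split; first exact: H1.
  rewrite -derive1E; apply: etrans H2 _; apply: eq_Rintegral => z _.
  by rewrite partial1of2E; have [_ ->] := dF 0 z; rewrite scale0r addr0.
rewrite -[y in is_derive y]addr0 -[X in is_derive (_ + X)](scale0r h).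
exact/is_derive_lineP.
Qed.

End convolution.

(** * Smooth kernels with bounded support *)

Section kernels.
Context {R : realType} {n : nat}.
Local Notation E := 'rV[R]_n.
Local Notation mu := (@lebesgue_rV R n).
Local Notation "''e_' i" := (delta_mx ord0 i : E) (at level 8, i at level 2).

(** Test functions, with the support condition phrased by a sup-norm radius, which is stable under
    the operations below; [kernel_test] returns to [test_function]. *)
Definition kernel (k : E -> R^o) :=
  (forall m, Ck_on m setT k) /\ bounded_support (k : E -> R).

Implicit Types (k : E -> R^o) (x y h : E).

Lemma kernel_differentiable k x : kernel k -> differentiable k x.
Proof. by move=> [/(_ 1%N)[dk _] _]; exact: dk. Qed.

Lemma kernel_continuous k : kernel k -> continuous (k : E -> R).
Proof. by move=> kk x; exact/differentiable_continuous/kernel_differentiable. Qed.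

Lemma kernel_derive k x h : kernel k ->
  is_derive x h (k : E -> R) (\sum_i h ord0 i * partial i k x).
Proof. by move=> kk; exact/is_derive_differentiable/kernel_differentiable. Qed.

Lemma kernel_is_derive k x i : kernel k -> is_derive x 'e_i (k : E -> R) (partial i k x).
Proof. by move=> kk; split=> //; exact/diff_derivable/kernel_differentiable. Qed.

Lemma kernel_partial k i : kernel k -> kernel (partial i k).
Proof.
move=> kk; split; first by move=> m; have [_] := kk.1 m.+1; apply.
exact: bounded_support_is_derive kk.2 (fun x => kernel_is_derive x i kk).
Qed.

Lemma kernel_partialC k i j : kernel k ->
  partial i (partial j k) = partial j (partial i k).
Proof.
move=> kk; apply/funext => x.
have ki := kernel_partial i kk; have kj := kernel_partial j kk.
apply: (@schwarz_derive R _ k (partial j k) (partial i k) _ _ x 'e_j 'e_i 1) => //.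
- by move=> z _; exact: kernel_is_derive.
- by move=> z _; exact: kernel_is_derive.
- by move=> z _; exact: (kernel_is_derive z i kj).
- by move=> z _; exact: (kernel_is_derive z j ki).
- exact: (kernel_continuous (kernel_partial i kj)).
- exact: (kernel_continuous (kernel_partial j ki)).
Qed.

Lemma kernel_affine k y (s : R) : s != 0 -> kernel k -> kernel (fun z => k (y + s *: z)).
Proof.
move=> s0 [ck [M kM]]; split; first by move=> m; exact: Ck_on_affine.
exists ((M + `|y|) / `|s|) => x; rewrite ltr_pdivrMr ?normr_gt0// => Mx.
apply: kM; have := ler_normB (y + s *: x) y.
by rewrite [y + _]addrC addrK normrZ; move: Mx; lra.
Qed.

Lemma kernelZ k (c : R) : kernel k -> kernel (fun z => c * k z : R^o).
Proof.
move=> [ck [M kM]]; split; first by move=> m; exact: (Ck_onM (Ck_on_cst m c) (ck m)).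
by exists M => x Mx; rewrite kM// mulr0.
Qed.

Lemma partialZ k (c : R) i : kernel k -> partial i (fun z => c * k z : R^o) = fun z => c * partial i k z.
Proof.
move=> kk; apply/funext => x; have H := kernel_is_derive x i kk.
have [_ H'] : is_derive x 'e_i (c *: (k : E -> R)) (c *: partial i k x) by exact: is_deriveZ.
exact: H'.
Qed.

Lemma kernel_test k : kernel k -> test_function (k : E -> R).
Proof.
move=> [ck [M kM]]; split=> //; apply: bounded_closed_compact; last exact: closed_closure.
exists M; split=> [|N MN x xcl]; first exact: num_real.
have cB : closed [set z : E | `|z| <= M].
  by apply: compact_closed; [exact: norm_hausdorff|exact: closed_ball_compact].
have kB : [set z | k z != 0] `<=` [set z : E | `|z| <= M].
  by move=> z /= kz; rewrite leNgt; apply: contra kz => /kM ->.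
have : closure [set z : E | `|z| <= M] x by exact: closureS xcl.
by move/closure_id : cB => <- /= /le_trans; apply; exact: ltW.
Qed.

Lemma kernel_reflect k y : kernel k -> kernel (fun z => k (y - z)) /\
  forall i, partial i (fun z => k (y - z)) = fun z => - partial i k (y - z).
Proof.
move=> kk.
have E1 : (fun z => k (y - z)) = fun z => k (y + (-1) *: z).
  by apply/funext => z; rewrite scaleN1r.
rewrite E1; split; first by apply: kernel_affine => //; rewrite oppr_eq0 oner_eq0.
move=> i; apply/funext => z.
have [_ ->] := differentiable_affine i (kernel_differentiable (y + -1 *: z) kk).
by rewrite mulN1r scaleN1r.
Qed.

End kernels.

Lemma Rintegral_sum d (T : measurableType d) (R : realType)
    (mu : {measure set T -> \bar R}) (I : Type) (s : seq I) (f : I -> T -> R) :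
  (forall i, mu.-integrable setT (EFin \o f i)) ->
  mu.-integrable setT (EFin \o (fun x => \sum_(i <- s) f i x)) /\
  \int[mu]_x (\sum_(i <- s) f i x) = \sum_(i <- s) \int[mu]_x f i x.
Proof.
move=> fi; elim: s => [|i s [IH1 IH2]].
  under [X in EFin \o X]eq_fun do rewrite big_nil.
  split; first exact: integrable0.
  under eq_Rintegral do rewrite big_nil.
  by rewrite big_nil Rintegral_cst// mul0r.
under [X in EFin \o X]eq_fun do rewrite big_cons.
split; first exact: (integrableD measurableT (fi i) IH1).
under eq_Rintegral do rewrite big_cons.
by rewrite RintegralD// IH2 big_cons.
Qed.

Section ball_integrals.
Context {R : realType} {n : nat}.
Local Notation E := 'rV[R]_n.
Local Notation mu := (@lebesgue_rV R n).

Lemma lebesgue_rV_ball (y : E) (M : R) : 0 <= M ->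
  measurable [set z : E | `|y - z| <= M] /\
  mu [set z : E | `|y - z| <= M] = ((2 * M) ^+ n)%:E.
Proof.
move=> M0; split.
  rewrite -[X in measurable X]setCK; apply: measurableC; apply: open_measurable_rV.
  have -> : ~` [set z : E | `|y - z| <= M] = (fun z => `|y - z|) @^-1` [set t : R | M < t].
    by apply/seteqP; split=> x /=; rewrite ltNge => /negP.
  apply: open_comp; last exact: open_gt.
  move=> x _; apply: continuous_comp; last exact: norm_continuous.
  have : differentiable (fun z : E => y - z) x by [].
  exact: differentiable_continuous.
have -> : [set z : E | `|y - z| <= M] =
    [set z | forall i : 'I_n, [set` `[y ord0 i - M, y ord0 i + M]] (z ord0 i)].
  apply/seteqP; split=> z /=.
    move=> xM i /=; have := le_trans (coord_le_norm (y - z) i) xM.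
    by rewrite subr_coord ler_norml in_itv /= => /andP[? ?]; apply/andP; split; lra.
  move=> xM; apply: norm_le_coord => // i; have := xM i.
  by rewrite in_itv /= subr_coord ler_norml => /andP[? ?]; apply/andP; split; lra.
have /= -> := @lebesgue_rV_box R n (fun i => [set` `[y ord0 i - M, y ord0 i + M]])
  (fun=> measurable_itv _).
have E1 (i : 'I_n) : lebesgue_measure [set` `[y ord0 i - M, y ord0 i + M]] = (2 * M)%:E.
  rewrite lebesgue_measure_itv /= lte_fin.
  case: ltP => h; first by rewrite -EFinB; congr (_%:E); lra.
  by congr (_%:E); lra.
rewrite (eq_bigr (fun=> (2 * M)%:E)); last by move=> i _; exact: E1.
by rewrite -(big_morph _ EFinM erefl) prodr_const card_ord.
Qed.

Lemma integral_ball (y : E) (M B : R) : 0 <= M ->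
  mu.-integrable setT (EFin \o (fun z => B * (`|y - z| <= M)%R%:R)) /\
  \int[mu]_z (B * (`|y - z| <= M)%R%:R) = B * (2 * M) ^+ n.
Proof.
move=> M0; have [mD muD] := lebesgue_rV_ball y M0.
set D := [set z : E | `|y - z| <= M].
have E1 : (fun z : E => B * (`|y - z| <= M)%R%:R) = (fun=> B) \_ D.
  apply/funext => z; rewrite patchE; case: ifPn; first by rewrite inE /D /= => ->; rewrite mulr1.
  by rewrite notin_setE /D /= => /negP/negbTE ->; rewrite mulr0.
rewrite E1; split; last first.
  have -> : (2 * M) ^+ n = fine (mu D) by rewrite (_ : mu D = ((2 * M) ^+ n)%:E).
  by rewrite -Rintegral_cst// [RHS]Rintegral_mkcond.
have : mu.-integrable D (EFin \o cst B).
  apply: measurable_bounded_integrable => //.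
    exact: (eq_ind_r (fun t => t < +oo)%E (ltry _) muD).
  by exists `|B|; split=> [|t Bt x _ /=]; [exact: num_real|exact: ltW].
rewrite integrable_mkcond//; congr (_.-integrable _ _).
by apply/funext => z; rewrite /= !patchE /=; case: ifP.
Qed.

Lemma Rintegral_le_ball (g : E -> R) (y : E) (M B : R) : 0 <= M ->
  mu.-integrable setT (EFin \o g) -> (forall z, `|y - z| <= M -> g z <= B) ->
  (forall z, M < `|y - z| -> g z <= 0) -> \int[mu]_z g z <= B * (2 * M) ^+ n.
Proof.
move=> M0 ig gB g0; have [i1 <-] := integral_ball y B M0.
apply: le_Rintegral => // z _; have [zM|Mz] := leP `|y - z| M.
  by rewrite mulr1 gB.
by rewrite mulr0 g0.
Qed.

Lemma Rintegral_ge_ball (g : E -> R) (y : E) (M B : R) : 0 <= M ->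
  mu.-integrable setT (EFin \o g) -> (forall z, `|y - z| <= M -> B <= g z) ->
  (forall z, 0 <= g z) -> B * (2 * M) ^+ n <= \int[mu]_z g z.
Proof.
move=> M0 ig gB g0; have [i1 <-] := integral_ball y B M0.
apply: le_Rintegral => // z _; have [zM|Mz] := leP `|y - z| M.
  by rewrite mulr1 gB.
by rewrite mulr0 g0.
Qed.

End ball_integrals.

Section convolution_rules.
Context {R : realType} {n : nat}.
Local Notation E := 'rV[R]_n.
Local Notation mu := (@lebesgue_rV R n).
Local Notation "''e_' i" := (delta_mx ord0 i : E) (at level 8, i at level 2).
Implicit Types (f df : E -> R) (k : E -> R^o) (y : E).

Lemma conv_integrable_kernel f k y : locally_integrable_rV f -> kernel k ->
  mu.-integrable setT (EFin \o (fun z => f z * k (y - z))).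
Proof.
by move=> lf kk; apply: conv_integrable => //; [exact: kernel_continuous|case: kk].
Qed.

(** Integration by parts. The reflection in [k (y - z)] supplies a sign, so the derivative passes
    between the kernel and [f] without one. *)
Lemma conv_partial f df k i y : continuous f -> continuous df ->
  (forall x, is_derive x 'e_i f (df x)) -> kernel k ->
  conv f (partial i k) y = conv df k y.
Proof.
move=> cf cdf fP kk.
have [kk' kE] := kernel_reflect y kk.
pose g (z : E) : R := f z * k (y - z).
pose dg (z : E) : R := f z * (- partial i k (y - z)) + k (y - z) * df z.
have cg : continuous g.
  exact: (continuous_mul cf (kernel_continuous kk')).
have cdg : continuous dg.
  have := kernel_continuous (kernel_partial i kk'); rewrite kE => ck.
  exact: (continuous_add (continuous_mul cf ck) (continuous_mul (kernel_continuous kk') cdf)).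
have sg : bounded_support g.
  by have [M kM] := kk'.2; exists M => x Mx; rewrite /g kM ?mulr0.
have gP x : is_derive x 'e_i g (dg x).
  by have H1 := kernel_is_derive x i kk'; rewrite kE in H1; exact: is_deriveM.
have H := integral_derive0 cg cdg sg gP.
have i1 := conv_integrable_kernel y (continuous_locally_integrable cf) (kernel_partial i kk).
have i2 := conv_integrable_kernel y (continuous_locally_integrable cdf) kk.
have H0 : \int[mu]_z (df z * k (y - z) - f z * partial i k (y - z)) = 0.
  have -> : (fun z => df z * k (y - z) - f z * partial i k (y - z)) = dg.
    by apply/funext => z; rewrite /dg mulrN addrC [df z * _]mulrC.
  by rewrite /Rintegral H.
by move: H0; rewrite RintegralB// => /eqP; rewrite subr_eq0 => /eqP.
Qed.

Lemma conv_sum (I : Type) (s : seq I) f (k : I -> E -> R^o) (c : I -> R) y :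
  locally_integrable_rV f -> (forall i, kernel (k i)) ->
  conv f (fun x => \sum_(i <- s) c i * k i x) y = \sum_(i <- s) c i * conv f (k i) y.
Proof.
move=> lf kk; rewrite /conv.
have ii i := conv_integrable_kernel y lf (kk i).
have ii' i : mu.-integrable setT (EFin \o (fun z => c i * (f z * k i (y - z)))).
  exact: (integrableZl measurableT (c i) (ii i)).
under eq_Rintegral do rewrite mulr_sumr.
under eq_Rintegral do under eq_bigr do rewrite mulrCA.
have [_ ->] := Rintegral_sum s ii'.
by apply: eq_bigr => i _; rewrite RintegralZl.
Qed.

End convolution_rules.

(** * Construction of mollifiers *)

Section mollifier.
Context {R : realType} {n : nat}.
Local Notation E := 'rV[R]_n.
Local Notation mu := (@lebesgue_rV R n).

(** A product over the coordinates, because its support is then exactly controlled in the sup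
    norm. *)
Definition bump (x : E) : R^o :=
  \prod_(i < n) (flat 1 (1 + 1 * x ord0 i) * flat 1 (1 + (-1) * x ord0 i)).

Lemma flat_ge0 (x : R) : 0 <= flat 1 x.
Proof. by rewrite /flat; case: ifP => // _; rewrite hornerC mul1r expR_ge0. Qed.

Lemma flat1_ge (x : R) : 2^-1 <= x -> expR (- 2) <= flat 1 x.
Proof.
move=> x2; have x0 : 0 < x by apply: lt_le_trans x2; rewrite invr_gt0.
rewrite /flat x0 hornerC mul1r ler_expR lerN2.
by rewrite -[leRHS]invrK lef_pV2 ?posrE ?invr_gt0.
Qed.

Lemma bump_ge0 x : 0 <= bump x.
Proof. by apply: prodr_ge0 => i _; rewrite mulr_ge0// flat_ge0. Qed.

Lemma bump_eq0 x : 1 <= `|x| -> bump x = 0.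
Proof.
move=> x1; have [i xi] : exists i, 1 <= `|x ord0 i|.
  apply: contrapT => /forallNP H; move: x1; apply/negP; rewrite -ltNge.
  by apply: norm_lt_coord => // i; rewrite ltNge; exact/negP.
apply/eqP; rewrite /bump prodf_seq_eq0; apply/hasP; exists i; first by rewrite mem_index_enum.
rewrite /= mulf_eq0 /flat; move: xi; rewrite ler_normr => /orP[] xi.
  by apply/orP; right; rewrite (_ : 0 < _ = false) //; apply/negbTE; rewrite -leNgt; lra.
by apply/orP; left; rewrite (_ : 0 < _ = false) //; apply/negbTE; rewrite -leNgt; lra.
Qed.

Lemma bump_lower : exists2 c : R, 0 < c & forall x, `|x| <= 2^-1 -> c <= bump x.
Proof.
exists (\prod_(i < n) (expR (- 2) * expR (- 2))).
  by apply: prodr_gt0 => i _; rewrite mulr_gt0// expR_gt0.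
move=> x x2; apply: ler_prod => i _; rewrite mulr_ge0 ?expR_ge0//=.
have := le_trans (coord_le_norm x i) x2; rewrite ler_norml => /andP[h1 h2].
by apply: ler_pM; rewrite ?expR_ge0//; apply: flat1_ge; lra.
Qed.

Lemma kernel_bump : kernel bump.
Proof.
split; last by exists 1 => x /ltW /bump_eq0.
move=> m; apply: Ck_on_prod => i.
exact: (Ck_onM (Ck_on_flat m 1 1 1 i) (Ck_on_flat m 1 1 (-1) i)).
Qed.

Lemma conv_cst1 (k : E -> R) (y : E) : conv (cst 1) k y = \int[mu]_z k (y - z).
Proof. by apply: eq_Rintegral => z _; rewrite /cst mul1r. Qed.

(** Translation invariance of the integral of [k], deduced from integration by parts: as a function
    of the base point its derivative is an integral of derivatives of [k], hence 0. *)
Lemma conv_cst1_const (k : E -> R^o) (y : E) : kernel k -> conv (cst 1) k y = conv (cst 1) k 0.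
Proof.
move=> kk.
have l1 : locally_integrable_rV (cst 1 : E -> R).
  by apply: continuous_locally_integrable; exact: cst_continuous.
have H z : is_derive z y (conv (cst 1) k) 0.
  have ck := kernel_continuous kk.
  pose dk x : R := \sum_i y ord0 i * partial i k x.
  have cdk : continuous dk.
    apply: continuous_sum => i; apply: continuous_mul; first exact: cst_continuous.
    exact: (kernel_continuous (kernel_partial i kk)).
  have := is_derive_conv z l1 ck cdk kk.2 (fun x => kernel_derive x y kk).
  rewrite (conv_sum _ _ _ l1) => [|i]; last exact: kernel_partial.
  rewrite big1// => i _; rewrite (@conv_partial _ _ _ (cst 0))//.
  - rewrite /conv; under eq_Rintegral do rewrite /cst mul0r.
    by rewrite Rintegral_cst// !mul0r mulr0.
  - exact: cst_continuous.
  - exact: cst_continuous.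
have [t _] := @MVT_line R _ (conv (cst 1) k) (fun=> 0) 0 y 1 ler01 (fun t _ => H _).
by rewrite scale1r add0r mulr0 => /eqP; rewrite subr_eq0 => /eqP.
Qed.

(** [C] is to be shared by all scales [e]: the last field bounds the L^1 norm of the gradient by
    [C / e], the only growth that the commutator estimate can absorb. *)
Record mollifier (C e : R) (k : E -> R^o) : Prop := Mollifier {
  mollifier_kernel : kernel k ;
  mollifier_ge0 : forall x, 0 <= (k x : R) ;
  mollifier_supp : forall x, e <= `|x| -> (k x : R) = 0 ;
  mollifier_int : forall y, conv (cst 1) k y = 1 ;
  mollifier_partial : forall i y,
    e * conv (cst 1) (fun x => `|partial i k x|) y <= C }.

(** The rescaled bump is divided by its integral [Z]. No change of variables is made: [Z] is at
    least [c * e ^+ n] by the values on a ball of radius [e / 2], the gradient integral is at most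
    [A' / (Z * e)] times the volume [(2 * e) ^+ n], and the powers of [e] cancel. *)
Lemma exists_mollifier : exists2 C, 0 < C & forall e, 0 < e -> exists k, mollifier C e k.
Proof.
have [c c0 bc] := bump_lower.
have /choice[A AP] : forall i, exists A, 0 < A /\ forall x, `|partial i bump x| <= A.
  move=> i; have ki := kernel_partial i kernel_bump.
  by have [A A0 HA] := bounded_continuous (kernel_continuous ki) ki.2; exists A.
pose A' := \sum_i A i + 1.
have A'0 : 0 < A' by rewrite ltr_wpDl// sumr_ge0// => i _; have [/ltW] := AP i.
have AA' i x : `|partial i bump x| <= A'.
  have [_ /(_ x) h] := AP i; apply: (le_trans h).
  rewrite /A' (bigD1 i)//= -addrA lerDl addr_ge0// sumr_ge0// => j _.
  by have [/ltW] := AP j.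
exists (A' * 2 ^+ n / c) => [|e e0]; first by rewrite divr_gt0// mulr_gt0// exprn_gt0.
have ei : e^-1 != 0 by rewrite invr_eq0 gt_eqF.
pose r (x : E) : R^o := bump (0 + e^-1 *: x).
have kr : kernel r by exact: kernel_affine ei kernel_bump.
have pr i x : partial i r x = e^-1 * partial i bump (e^-1 *: x).
  have [_ ->] := differentiable_affine i (kernel_differentiable (0 + e^-1 *: x) kernel_bump).
  by rewrite add0r.
have r0 x : e <= `|x| -> r x = 0.
  move=> ex; apply: bump_eq0; rewrite add0r normrZ ger0_norm ?invr_ge0 ?(ltW e0)//.
  by rewrite mulrC ler_pdivlMr// mul1r.
have l1 : locally_integrable_rV (cst 1 : E -> R).
  by apply: continuous_locally_integrable; exact: cst_continuous.
pose Z := conv (cst 1) r 0.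
have Zc : c * e ^+ n <= Z.
  rewrite /Z conv_cst1.
  have -> : e = 2 * (e / 2) by rewrite mulrCA divff ?mulr1// pnatr_eq0.
  apply: (@Rintegral_ge_ball _ _ _ 0).
  - by rewrite divr_ge0// ltW.
  - have := conv_integrable_kernel 0 l1 kr.
    by congr (_.-integrable _ _); apply/funext => z /=; rewrite mul1r.
  - move=> z ze; apply: bc; rewrite add0r normrZ ger0_norm ?invr_ge0 ?(ltW e0)//.
    by rewrite mulrC ler_pdivrMr// mulrC.
  - by move=> z; exact: bump_ge0.
have Z0 : 0 < Z by apply: lt_le_trans Zc; rewrite mulr_gt0// exprn_gt0.
exists (fun x => Z^-1 * r x); split.
- exact: kernelZ.
- by move=> x; rewrite mulr_ge0 ?invr_ge0 ?(ltW Z0)// bump_ge0.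
- by move=> x /r0 ->; rewrite mulr0.
- move=> y; rewrite conv_cst1 RintegralZl//; last first.
    have := conv_integrable_kernel y l1 kr.
    by congr (_.-integrable _ _); apply/funext => z /=; rewrite mul1r.
  by rewrite -conv_cst1 conv_cst1_const// mulVf// gt_eqF.
- move=> i y; rewrite conv_cst1.
  have -> : partial i (fun x => Z^-1 * r x : R^o) = (fun x => Z^-1 * partial i r x) by exact: partialZ.
  have ki := kernel_partial i (kernelZ Z^-1 kr).
  have H : \int[mu]_z `|Z^-1 * partial i r (y - z)| <= (Z^-1 * e^-1 * A') * (2 * e) ^+ n.
    apply: (@Rintegral_le_ball _ _ _ y).
    - exact: ltW.
    - have := integrable_norm (conv_integrable_kernel y l1 ki).
      congr (_.-integrable _ _); apply/funext => z /=.
      by rewrite mul1r partialZ.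
    - move=> z _; rewrite pr !normrM.
      have Zi : 0 <= Z^-1 by rewrite invr_ge0 ltW.
      have ei0 : 0 <= e^-1 by rewrite invr_ge0 ltW.
      by rewrite (ger0_norm Zi) (ger0_norm ei0) -mulrA ler_wpM2l// ler_wpM2l.
    - move=> z ez; rewrite (_ : partial i r (y - z) = 0) ?mulr0 ?normr0//.
      apply: is_derive_near0 (kernel_is_derive (y - z) i kr).
      have : \forall x \near y - z, e < `|x|.
        exact: (cvgr_gt _ (@norm_continuous _ _ (y - z)) _ ez).
      by apply: filterS => x /ltW; exact: r0.
  apply: (le_trans (ler_wpM2l (ltW e0) H)).
  rewrite exprMn ler_pdivlMr//.
  have -> : e * (Z^-1 * e^-1 * A' * (2 ^+ n * e ^+ n)) * c =
    (A' * 2 ^+ n) * (c * e ^+ n / Z).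
    by field; rewrite !gt_eqF.
  rewrite ler_piMr ?mulr_ge0 ?exprn_ge0 ?(ltW A'0)//.
  by rewrite ler_pdivrMr// mul1r.
Qed.

End mollifier.

(** * Continuously differentiable functions *)

Section C1_functions.
Context {R : realType} {n : nat}.
Local Notation E := 'rV[R]_n.
Local Notation mu := (@lebesgue_rV R n).
Local Notation "''e_' i" := (delta_mx ord0 i : E) (at level 8, i at level 2).
Implicit Types (f g : E -> R) (df dg : 'I_n -> E -> R).

(** Derivatives in all directions, linear in the direction: a Gateaux rather than Frechet gradient,
    which is what the mean value theorem on segments requires. *)
Definition has_gradient f df :=
  forall x h : E, is_derive x h f (\sum_i h ord0 i * df i x).

Definition C1 f df := has_gradient f df /\ forall i, continuous (df i).

Lemma has_gradient_partial f df i x : has_gradient f df -> is_derive x 'e_i f (df i x).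
Proof.
move=> /(_ x 'e_i); rewrite (bigD1 i)//= !mxE !eqxx mul1r big1 ?addr0// => j ji.
by rewrite !mxE eqxx (negbTE ji) mul0r.
Qed.

Lemma norm_gradient_le (h : E) (d : 'I_n -> R) (B : R) : 0 <= B ->
  (forall i, `|d i| <= B) -> `|\sum_i h ord0 i * d i| <= n%:R * B * `|h|.
Proof.
move=> B0 dB; rewrite (le_trans (ler_norm_sum _ _ _))//.
apply: (@le_trans _ _ (\sum_(i < n) `|h| * B)).
  by apply: ler_sum => i _; rewrite normrM ler_pM// coord_le_norm.
by rewrite sumr_const card_ord -[leLHS]mulr_natl [`|h| * B]mulrC mulrA.
Qed.

Lemma gradient_MVT f df (x h : E) : has_gradient f df ->
  exists2 t : R, 0 <= t <= 1 & f (x + h) - f x = \sum_i h ord0 i * df i (x + t *: h).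
Proof.
move=> fP.
have [t t01] := @MVT_line R _ f (fun y => \sum_i h ord0 i * df i y) x h 1 ler01
  (fun t _ => fP _ h).
by rewrite scale1r mul1r => H; exists t.
Qed.

(** Directional derivatives alone do not give continuity; a locally bounded gradient does, by the
    mean value theorem. Stated for bounded rather than continuous gradients so that it applies to
    convolutions before their derivatives are known to be continuous. *)
Lemma gradient_continuous f df : has_gradient f df ->
  (forall M : R, exists B : R, forall i x, `|x| <= M -> `|df i x| <= B) -> continuous f.
Proof.
move=> fP dfB x; apply/(@cvgrPdist_lt _ _ _ _ (nbhs_filter x)) => e e0.
have [B0 HB] := dfB (`|x| + 1); pose B := `|B0| + 1.
have B1 : 0 < B by rewrite ltr_wpDl.
pose d := Num.min 1 (e / (n%:R * B + 1)).
have nB : 0 <= n%:R * B by rewrite mulr_ge0// ltW.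
have d0 : 0 < d by rewrite lt_min ltr01 divr_gt0// ltr_wpDl.
have H : \forall y \near x, `|x - y| < d by apply/nbhs_normP; exists d.
apply: filterS H => y; rewrite distrC => xy.
have [t /andP[t0 t1]] := gradient_MVT x (y - x) fP.
rewrite [x + (y - x)]addrC subrK distrC => ->.
have H i : `|df i (x + t *: (y - x))| <= B.
  rewrite (le_trans (HB i _ _))//; last by rewrite (le_trans (ler_norm _))// lerDl.
  rewrite (le_trans (ler_normD _ _))// lerD2l normrZ ger0_norm//.
  by rewrite mulr_ile1//; move: xy; rewrite /d lt_min => /andP[h1 _]; exact: ltW.
rewrite (le_lt_trans (norm_gradient_le _ (ltW B1) H))//.
move: xy; rewrite /d lt_min => /andP[_]; rewrite ltr_pdivlMr ?ltr_wpDl//.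
have := normr_ge0 (y - x); nra.
Qed.

Lemma C1_continuous f df : C1 f df -> continuous f.
Proof.
move=> [fP cdf]; apply: (gradient_continuous fP) => M.
have /choice[B BP] : forall i, exists B : R, 0 < B /\ forall x, `|x| <= M -> `|df i x| <= B.
  by move=> i; have [B B0 HB] := continuous_bounded_on_ball M (cdf i); exists B.
exists (\sum_i B i) => i x xM; have [_ /(_ x xM) h] := BP i; apply: (le_trans h).
rewrite (bigD1 i)//= lerDl sumr_ge0// => j _.
by have [/ltW] := BP j.
Qed.

Lemma C1_cst (c : R) : C1 (fun _ => c) (fun _ _ => 0).
Proof.
split=> [x h|i]; last exact: cst_continuous.
by rewrite big1 => [|i _]; [exact: is_derive_cst|rewrite mulr0].
Qed.

Lemma C1_add f df g dg : C1 f df -> C1 g dg ->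
  C1 (fun x => f x + g x) (fun i x => df i x + dg i x).
Proof.
move=> [fP cf] [gP cg]; split=> [x h|i]; last exact: continuous_add.
under eq_bigr do rewrite mulrDr.
by rewrite big_split /=; exact: is_deriveD.
Qed.

Lemma C1_mul f df g dg : C1 f df -> C1 g dg ->
  C1 (fun x => f x * g x) (fun i x => f x * dg i x + g x * df i x).
Proof.
move=> Cf Cg; have [[fP cf] [gP cg]] := (Cf, Cg); split=> [x h|i].
  under eq_bigr do rewrite mulrDr ![h ord0 _ * (_ * _)]mulrCA.
  by rewrite big_split /= -!mulr_sumr; exact: is_deriveM.
by apply: continuous_add; apply: continuous_mul => //; [exact: C1_continuous Cf|exact: C1_continuous Cg].
Qed.

Lemma C1_scale f df (c : R) : C1 f df -> C1 (fun x => c * f x) (fun i x => c * df i x).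
Proof.
move=> Cf; have := C1_mul (C1_cst c) Cf; congr C1; apply/funext => i; apply/funext => x.
by rewrite mulr0 addr0.
Qed.

Lemma C1_opp f df : C1 f df -> C1 (fun x => - f x) (fun i x => - df i x).
Proof.
move=> /(C1_scale (-1)); congr C1.
  by apply/funext => x; rewrite mulN1r.
by apply/funext => i; apply/funext => x; rewrite mulN1r.
Qed.

Lemma C1_sub f df g dg : C1 f df -> C1 g dg ->
  C1 (fun x => f x - g x) (fun i x => df i x - dg i x).
Proof. by move=> Cf /C1_opp; exact: C1_add. Qed.

Lemma C1_coord (i : 'I_n) : C1 (fun x => x ord0 i) (fun j _ => (i == j)%:R).
Proof.
split=> [x h|j]; last exact: cst_continuous.
rewrite (bigD1 i)//= eqxx mulr1 big1 ?addr0 => [|j ji]; last first.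
  by rewrite eq_sym (negbTE ji) mulr0.
split; first exact/diff_derivable/differentiable_coord.
have := derive_mx (@derivable_id R E x h); rewrite derive_id => /matrixP/(_ ord0 i).
by rewrite mxE => <-.
Qed.

Lemma C1_sum (I : Type) (s : seq I) (f : I -> E -> R) (df : I -> 'I_n -> E -> R) :
  (forall k, C1 (f k) (df k)) ->
  C1 (fun x => \sum_(k <- s) f k x) (fun i x => \sum_(k <- s) df k i x).
Proof.
move=> fP; elim: s => [|k s IH].
  have := C1_cst 0; congr C1; first by apply/funext => x; rewrite big_nil.
  by apply/funext => i; apply/funext => x; rewrite big_nil.
have := C1_add (fP k) IH; congr C1; first by apply/funext => x; rewrite big_cons.
by apply/funext => i; apply/funext => x; rewrite big_cons.
Qed.

Lemma C1_comp (p dp : R -> R) f df : (forall x, is_derive (f x) 1 p (dp (f x))) ->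
  (forall x, {for f x, continuous dp}) -> C1 f df ->
  C1 (fun x => p (f x)) (fun i x => dp (f x) * df i x).
Proof.
move=> pP cdp Cf; have [fP cdf] := Cf; split=> [x h|i]; last first.
  apply: continuous_mul; last exact: cdf.
  by move=> x; apply: continuous_comp; [exact: (C1_continuous Cf)|exact: cdp].
under eq_bigr do rewrite mulrCA.
rewrite -mulr_sumr.
have H := fP x h; rewrite -[x in is_derive x h]addr0 -[X in is_derive (_ + X)](scale0r h) in H *.
apply/is_derive_lineP; move/is_derive_lineP: H => H.
have H1 := pP (x + 0 *: h); rewrite scale0r addr0 in H1.
apply: (@is_derive1_comp _ p (fun s => f (x + s *: h)) 0 _ _ _ H).
by rewrite scale0r addr0.
Qed.

Lemma conv_locally_bounded f (k : E -> R) (M : R) : locally_integrable_rV f ->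
  continuous k -> bounded_support k ->
  exists B : R, forall y, `|y| <= M -> `|conv f k y| <= B.
Proof.
move=> lf ck sk; have [C C0 kC] := bounded_continuous ck sk; have [K kK] := sk.
exists (\int[mu]_z (C * (`|f z| * (`|z| <= M + K)%R%:R))) => y yM.
have i1 := conv_integrable y lf ck sk.
have i2 := integrableZl measurableT C (locally_integrable_cutoff (M + K) lf).
rewrite (le_trans (le_normr_Rintegral _ i1))//; apply: le_Rintegral => //.
  exact: integrable_norm.
move=> z _; rewrite normrM mulrCA ler_wpM2l//.
have [zM|Mz] := leP `|z| (M + K); first by rewrite mulr1.
rewrite kK ?normr0 ?mulr0//.
have := ler_normB y (y - z); rewrite opprB addrCA subrr addr0; lra.
Qed.

(** Continuity of the derivatives is a bootstrap: each is again a convolution with a kernel, whose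
    own gradient is locally bounded. *)
Lemma conv_C1 f (k : E -> R^o) : locally_integrable_rV f -> kernel k ->
  C1 (conv f k) (fun i => conv f (partial i k)).
Proof.
move=> lf kk.
have G (k' : E -> R^o) : kernel k' -> has_gradient (conv f k') (fun i => conv f (partial i k')).
  move=> kk' x h; rewrite -(conv_sum _ _ _ lf); last by move=> i; exact: kernel_partial.
  apply: is_derive_conv => //.
  - exact: kernel_continuous.
  - apply: continuous_sum => i; apply: continuous_mul; first exact: cst_continuous.
    exact: (kernel_continuous (kernel_partial i kk')).
  - exact: kk'.2.
  - by move=> y; exact: kernel_derive.
split=> [|i]; first exact: G.
have ki := kernel_partial i kk.
apply: (gradient_continuous (G _ ki)) => M.
have /choice[B BP] j : exists B : R, forall y, `|y| <= M -> `|conv f (partial j (partial i k)) y| <= B.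
  have kij := kernel_partial j ki.
  exact: (conv_locally_bounded M lf (kernel_continuous kij) kij.2).
exists (\sum_j `|B j|) => j x xM; rewrite (le_trans (BP j x xM))//.
by rewrite (bigD1 j)//= (le_trans (ler_norm _))// lerDl sumr_ge0.
Qed.

End C1_functions.

(** * Mollification *)

Section mollification.
Context {R : realType} {n : nat}.
Local Notation E := 'rV[R]_n.
Local Notation mu := (@lebesgue_rV R n).
Implicit Types (f g w : E -> R) (dw : 'I_n -> E -> R) (k : E -> R^o) (y : E).

Lemma conv_bound (F k : E -> R) y (B e : R) : continuous F -> continuous k ->
  bounded_support k -> (forall x, e < `|x| -> k x = 0) ->
  (forall z, `|y - z| <= e -> `|F z| <= B) ->
  `|conv F k y| <= B * conv (cst 1) (fun x => `|k x|) y.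
Proof.
move=> cF ck sk k0 FB.
have i1 := conv_integrable y (continuous_locally_integrable cF) ck sk.
have l1 : locally_integrable_rV (cst 1 : E -> R).
  by apply: continuous_locally_integrable; exact: cst_continuous.
have i2 : mu.-integrable setT (EFin \o (fun z => `|k (y - z)|)).
  have := integrable_norm (conv_integrable y l1 ck sk).
  by congr (_.-integrable _ _); apply/funext => z /=; rewrite mul1r.
rewrite conv_cst1 -RintegralZl// (le_trans (le_normr_Rintegral _ i1))//.
apply: le_Rintegral => //.
- exact: integrable_norm.
- exact: (integrableZl measurableT B i2).
- move=> z _; rewrite normrM; have [zM|Mz] := leP `|y - z| e.
    by rewrite ler_wpM2r// FB.
  by rewrite k0// normr0 !mulr0.
Qed.

Lemma conv_sub f g k y : continuous f -> continuous g -> kernel k ->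
  conv (fun z => f z - g z) k y = conv f k y - conv g k y.
Proof.
move=> cf cg kk; rewrite /conv -RintegralB//.
- by apply: eq_Rintegral => z _; rewrite mulrBl.
- exact: (conv_integrable_kernel y (continuous_locally_integrable cf) kk).
- exact: (conv_integrable_kernel y (continuous_locally_integrable cg) kk).
Qed.

Lemma conv_add f g k y : continuous f -> continuous g -> kernel k ->
  conv (fun z => f z + g z) k y = conv f k y + conv g k y.
Proof.
move=> cf cg kk; rewrite /conv -RintegralD//.
- by apply: eq_Rintegral => z _; rewrite mulrDl.
- exact: (conv_integrable_kernel y (continuous_locally_integrable cf) kk).
- exact: (conv_integrable_kernel y (continuous_locally_integrable cg) kk).
Qed.

Lemma conv_scale f (c : R) k y : continuous f -> kernel k ->
  conv (fun z => c * f z) k y = c * conv f k y.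
Proof.
move=> cf kk; rewrite /conv -RintegralZl//.
- by apply: eq_Rintegral => z _; rewrite mulrA.
- exact: (conv_integrable_kernel y (continuous_locally_integrable cf) kk).
Qed.

Lemma conv_suml (I : Type) (s : seq I) (f : I -> E -> R) k y :
  (forall i, continuous (f i)) -> kernel k ->
  conv (fun z => \sum_(i <- s) f i z) k y = \sum_(i <- s) conv (f i) k y.
Proof.
move=> cf kk; rewrite /conv.
under eq_Rintegral do rewrite mulr_suml.
by have [_ ->] := Rintegral_sum s
  (fun i => conv_integrable_kernel y (continuous_locally_integrable (cf i)) kk).
Qed.

Lemma mollifier_norm C e k y : mollifier C e k -> conv (cst 1) (fun x => `|k x|) y = 1.
Proof.
move=> mk; rewrite -[RHS](mollifier_int mk y); apply: eq_Rintegral => z _.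
by rewrite /cst ger0_norm//; exact: (mollifier_ge0 mk).
Qed.

Lemma mollifier_partial_supp C e k i x : mollifier C e k -> e < `|x| -> partial i k x = 0.
Proof.
move=> mk ex; apply: is_derive_near0 (kernel_is_derive x i (mollifier_kernel mk)).
have : \forall z \near x, e < `|z| by exact: (cvgr_gt _ (@norm_continuous _ _ x) _ ex).
by apply: filterS => z /ltW; exact: (mollifier_supp mk).
Qed.

Lemma mollifier_cst C e k y (c : R) : mollifier C e k -> conv (fun=> c) k y = c.
Proof.
move=> mk; have := conv_scale c y (@cst_continuous _ _ (1 : R)) (mollifier_kernel mk).
by rewrite (mollifier_int mk) mulr1 => H; rewrite -[RHS]H; congr conv; apply/funext => z; rewrite /cst mulr1.
Qed.

Lemma mollifier_bound C e k f y (B : R) : mollifier C e k -> continuous f ->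
  (forall z, `|y - z| <= e -> `|f z| <= B) -> `|conv f k y| <= B.
Proof.
move=> mk cf fB; have kk := mollifier_kernel mk.
have := conv_bound cf (kernel_continuous kk) kk.2
  (fun x ex => mollifier_supp mk (ltW ex)) fB.
by rewrite (mollifier_norm _ mk) mulr1.
Qed.

(** The threshold [e0] serves all mollifiers of smaller scale, so that a single one can be chosen
    for finitely many functions at once. *)
Lemma conv_approx C f (M d : R) : continuous f -> 0 < d ->
  exists2 e0 : R, 0 < e0 & forall e k, e < e0 -> mollifier C e k ->
    forall y, `|y| <= M -> `|conv f k y - f y| <= d.
Proof.
move=> cf d0; have [e0 e00 H] := continuous_unif M cf d0.
exists e0 => // e k ee0 mk y yM; have kk := mollifier_kernel mk.
rewrite -(mollifier_cst y (f y) mk) -conv_sub//; last exact: cst_continuous.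
apply: (mollifier_bound mk).
  by apply: continuous_sub => //; exact: cst_continuous.
by move=> z yz; rewrite distrC ltW// H// (le_lt_trans yz).
Qed.

(* Friedrichs' commutator estimate: [partial j k] pairs the linear part of [w] at [y] with
   the constant [g y] to give [dw j y * g y], and the remainders are small because
   the L^1 norm of [partial j k] is at most [C / e] on a support of size [e]. *)
Lemma commutator C w dw g j (M d : R) : 0 < C -> C1 w dw -> continuous g -> 0 < d ->
  exists2 e0 : R, 0 < e0 & forall e k, 0 < e -> e < e0 -> mollifier C e k ->
    forall y, `|y| <= M ->
    `|conv (fun z => w z * g z) (partial j k) y - w y * conv g (partial j k) y
      - dw j y * g y| <= d.
Proof.
move=> C0 Cw cg d0; have [wP cdw] := Cw; have cw := C1_continuous Cw.
(* Each of the [n] coordinates will contribute at most [d' * e], against an L^1 norm of at most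
   [C / e]; the [+ 1] keeps the denominator positive even for [n = 0]. *)
pose d' := d / (n%:R * C + 1).
have nC : 0 <= n%:R * C by rewrite mulr_ge0// ltW.
have nC1 : 0 < n%:R * C + 1 by rewrite ltr_wpDl.
have d'0 : 0 < d' by rewrite divr_gt0.
have [G G0 gG] := continuous_bounded_on_ball (M + 1) cg.
have /choice[W WP] i : exists W : R, 0 < W /\ forall x, `|x| <= M + 1 -> `|dw i x| <= W.
  by have [W W0 HW] := continuous_bounded_on_ball (M + 1) (cdw i); exists W.
have /choice[r rP] i : exists r : R, 0 < r /\
    forall x y, `|x| <= M -> `|x - y| < r -> `|dw i x - dw i y| < d' / (2 * G).
  have e0 : 0 < d' / (2 * G) by rewrite divr_gt0// mulr_gt0.
  by have [r r0 Hr] := continuous_unif M (cdw i) e0; exists r.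
have /choice[s sP] i : exists s : R, 0 < s /\
    forall x y, `|x| <= M -> `|x - y| < s -> `|g x - g y| < d' / (2 * W i).
  have [Wi _] := WP i.
  have e0 : 0 < d' / (2 * W i) by rewrite divr_gt0// mulr_gt0.
  by have [s s0 Hs] := continuous_unif M cg e0; exists s.
pose e0 := \big[Num.min/1]_i (Num.min (r i) (s i)).
exists e0.
  rewrite /e0; elim/big_ind: _ => // [x y x0 y0|i _]; first by rewrite lt_min x0.
  by have [ri _] := rP i; have [si _] := sP i; rewrite lt_min ri.
move=> e k e_gt0 ee0 mk y yM.
have e1 : e < 1 by rewrite (lt_le_trans ee0)// bigmin_le_id.
have er i : e < r i by rewrite (lt_le_trans ee0)// /e0 (le_trans (bigmin_le _ i _))// ge_min lexx.
have es i : e < s i by rewrite (lt_le_trans ee0)// /e0 (le_trans (bigmin_le _ i _))// ge_min lexx orbT.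
have kk := mollifier_kernel mk; have kj := kernel_partial j kk.
have cwg : continuous (fun z => w z * g z) by exact: continuous_mul.
pose L (z : E) : R := \sum_i dw i y * (z ord0 i - y ord0 i).
have CL : C1 L (fun l _ => \sum_i dw i y * (i == l)%:R).
  have := C1_sum (index_enum 'I_n) (fun i => C1_scale (dw i y) (C1_sub (C1_coord i) (C1_cst (y ord0 i)))).
  by congr C1; apply/funext => l; apply/funext => x; apply: eq_bigr => i _; rewrite subr0.
have -> : dw j y * g y = conv (fun z => L z * g y) (partial j k) y.
  have cLg : C1 (fun z => g y * L z) (fun l _ => g y * dw l y).
    have := C1_scale (g y) CL; congr C1; apply/funext => l; apply/funext => x; congr (_ * _).
    by rewrite (bigD1 l)//= eqxx mulr1 big1 ?addr0// => i il; rewrite (negbTE il) mulr0.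
  have := conv_partial y (C1_continuous cLg) (cLg.2 j) (fun x => has_gradient_partial j x cLg.1) kk.
  rewrite (mollifier_cst _ _ mk) mulrC => <-.
  by congr conv; apply/funext => z; rewrite mulrC.
rewrite -conv_scale// -conv_sub//; last by apply: continuous_mul => //; exact: cst_continuous.
rewrite -conv_sub//; last 2 first.
- by apply: continuous_sub => //; apply: continuous_mul => //; exact: cst_continuous.
- by apply: continuous_mul; [exact: C1_continuous CL|exact: cst_continuous].
set F := (F in conv F).
have cF : continuous F.
  apply: continuous_sub; first by apply: continuous_sub => //; apply: continuous_mul => //; exact: cst_continuous.
  by apply: continuous_mul; [exact: C1_continuous CL|exact: cst_continuous].
have FB z : `|y - z| <= e -> `|F z| <= n%:R * d' * e.
  move=> yz.
  have [t /andP[t0 t1]] := gradient_MVT y (z - y) wP.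
  rewrite [y + (z - y)]addrC subrK => wzy.
  (* The mean value theorem expresses [w z - w y] exactly, so the remainder is [z - y] paired with a
     difference that tends to 0: [dw] moves from an intermediate point to [y], and [g] from [z] to
     [y]. *)
  have -> : F z = \sum_i (z - y) ord0 i * (dw i (y + t *: (z - y)) * g z - dw i y * g y).
    have -> : F z = (w z - w y) * g z - L z * g y by rewrite /F; ring.
    rewrite wzy /L !mulr_suml -sumrB; apply: eq_bigr => i _.
    by rewrite subr_coord; ring.
  have ynear : `|y - (y + t *: (z - y))| <= e.
    rewrite opprD addrA subrr sub0r normrN normrZ ger0_norm// distrC.
    by apply: le_trans yz; rewrite ler_piMl.
  have zM : `|z| <= M + 1.
    have := ler_normB y (y - z); rewrite opprB addrCA subrr addr0; lra.
  have HB i : `|dw i (y + t *: (z - y)) * g z - dw i y * g y| <= d'.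
    have [Wi WB] := WP i.
    have [_ /(_ y (y + t *: (z - y)) yM (le_lt_trans ynear (er i))) h1] := rP i.
    have [_ /(_ y z yM (le_lt_trans yz (es i))) h2] := sP i.
    have -> : dw i (y + t *: (z - y)) * g z - dw i y * g y =
      - ((dw i y - dw i (y + t *: (z - y))) * g z) - dw i y * (g y - g z) by ring.
    rewrite (le_trans (ler_normB _ _))// normrN !normrM [leRHS]splitr lerD//.
      apply: (@le_trans _ _ (d' / (2 * G) * G)).
        by rewrite ler_pM ?gG// ltW.
      by rewrite le_eqVlt; apply/orP; left; apply/eqP; field; rewrite gt_eqF.
    apply: (@le_trans _ _ (W i * (d' / (2 * W i)))).
      by rewrite ler_pM// ?(ltW h2)// WB//; lra.
    by rewrite le_eqVlt; apply/orP; left; apply/eqP; field; rewrite gt_eqF.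
  apply: (le_trans (norm_gradient_le (z - y) (ltW d'0) HB)).
  by rewrite distrC ler_wpM2l// mulr_ge0// ltW.
rewrite (le_trans (conv_bound cF (kernel_continuous kj) kj.2 (fun x => mollifier_partial_supp j mk) FB))//.
have H := mollifier_partial mk j y.
apply: (@le_trans _ _ (n%:R * d' * C)).
  by rewrite -[leLHS]mulrA ler_wpM2l// mulr_ge0// ltW.
have -> : n%:R * d' * C = d * (n%:R * C) / (n%:R * C + 1).
  by rewrite /d'; field; rewrite gt_eqF.
by rewrite ler_pdivrMr// ler_wpM2l ?(ltW d0)//; lra.
Qed.

End mollification.

(** * From the weak to the classical equations *)

Section weak_formulation.
Context {R : realType} {n : nat}.
Local Notation E := 'rV[R]_n.

Lemma Ck_on_C1 (v : E -> E) i : Ck_on 1 setT v ->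
  C1 (fun y => v y ord0 i : R) (fun j => partial j ((fun y => v y ord0 i) : E -> R^o)).
Proof.
move=> [dv cv].
have dvi x : differentiable (fun y => v y ord0 i : R^o) x.
  apply: (@differentiable_comp _ _ _ _ v (fun M : E => M ord0 i : R^o)); first exact: dv.
  exact: differentiable_coord.
split=> [x h|j x]; first exact: is_derive_differentiable.
have E1 : partial j ((fun y => v y ord0 i) : E -> R^o) = fun y => partial j v y ord0 i.
  apply/funext => y; rewrite /partial derive_mx ?mxE//.
  by apply: diff_derivable; exact: dv.
rewrite E1; exact: (continuous_comp (cv j x I) (@coord_continuous R 1 n ord0 i (partial j v x))).
Qed.

Lemma distr_of_reflect (f : E -> R) (k : E -> R^o) y :
  distr_of f (fun z => k (y - z)) = conv f k y.
Proof. by []. Qed.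

(** The minus sign of the distributional derivative cancels the one due to reflecting the kernel. *)
Lemma distr_partial_reflect (f : E -> R) (k : E -> R^o) i y : locally_integrable_rV f -> kernel k ->
  distr_partial i (distr_of f) (fun z => k (y - z)) = conv f (partial i k) y.
Proof.
move=> lf kk; have [_ kE] := kernel_reflect y kk.
rewrite /distr_partial /distr_of kE /conv.
under eq_Rintegral do rewrite mulrN -mulN1r.
rewrite RintegralZl//; first by rewrite mulN1r opprK.
exact: (conv_integrable_kernel y lf (kernel_partial i kk)).
Qed.

(** Testing with reflected mollifiers centred at [y] shows that the mollified divergence vanishes at
    [y]; it is also close to the divergence itself. *)
Lemma weak_divergence_free (u : 'I_n -> E -> R) (du : 'I_n -> 'I_n -> E -> R) :
  (forall i, C1 (u i) (du i)) ->
  (forall phi, test_function phi -> \sum_i distr_partial i (distr_of (u i)) phi = 0) ->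
  forall y, \sum_i du i i y = 0.
Proof.
move=> Cu H y.
have [C C0 mC] := @exists_mollifier R n.
have cdiv : continuous (fun y => \sum_i du i i y) by apply: continuous_sum => i; exact: (Cu i).2.
apply/eqP; rewrite -normr_le0; apply/ler_addgt0Pr => d d0; rewrite add0r.
have [e0 e00 He] := conv_approx C `|y| cdiv d0.
have [k mk] := mC (e0 / 2) (divr_gt0 e00 (ltr0n _ 2)).
have kk := mollifier_kernel mk.
have := He _ k _ mk y (lexx _).
rewrite conv_suml//; last by move=> i; exact: (Cu i).2.
rewrite (eq_bigr (fun i => distr_partial i (distr_of (u i)) (fun z => k (y - z)))).
  rewrite H; last by apply: kernel_test; have [] := kernel_reflect y kk.
  by rewrite sub0r normrN; apply; lra.
move=> i _; rewrite distr_partial_reflect//; last first.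
  exact: (continuous_locally_integrable (C1_continuous (Cu i))).
by rewrite -(conv_partial y (C1_continuous (Cu i)) ((Cu i).2 i) (fun x => has_gradient_partial i x (Cu i).1)).
Qed.

Lemma has_gradient_sub (f g : E -> R) df dg : has_gradient f df -> has_gradient g dg ->
  has_gradient (fun x => f x - g x) (fun i x => df i x - dg i x).
Proof.
move=> fP gP x h; under eq_bigr do rewrite mulrBr.
by rewrite sumrB; exact: is_deriveB.
Qed.

(* [Q] is the limit of the mollifications of [q], normalised to vanish at [0]. *)
Lemma weak_gradient_potential (q : E -> R) (F : 'I_n -> E -> R) :
  locally_integrable_rV q -> (forall i, continuous (F i)) ->
  (forall i (k : E -> R^o) y, kernel k -> conv (F i) k y = conv q (partial i k) y) ->
  exists Q, C1 Q F.
Proof.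
move=> lq cF qF.
have [C C0 mC] := @exists_mollifier R n.
have /choice[k kP] : forall m : nat, exists k, @mollifier R n C (m.+1%:R^-1) k.
  by move=> m; apply: mC; rewrite invr_gt0 ltr0n.
pose Qm m y := conv q (k m) y - conv q (k m) 0.
have kk m := mollifier_kernel (kP m).
have gQ m : has_gradient (Qm m) (fun i => conv (F i) (k m)).
  move=> x h.
  under eq_bigr do rewrite (qF _ _ _ (kk m)) -[X in _ * X]subr0.
  exact: (C1_sub (conv_C1 lq (kk m)) (C1_cst _)).1.
(* The gradients of [Qm m] converge locally uniformly to [F]. With the common value 0 at the origin,
   the mean value theorem turns this into pointwise convergence of [Qm], although the mollifications
   of [q] themselves need not converge at a given point. *)
have unif (M d : R) : 0 < d -> exists m0 : nat, forall m, (m0 <= m)%N ->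
    forall i y, `|y| <= M -> `|conv (F i) (k m) y - F i y| <= d.
  move=> d0.
  have /choice[e eP] i : exists e : R, 0 < e /\ forall e' k, e' < e -> mollifier C e' k ->
      forall y, `|y| <= M -> `|conv (F i) k y - F i y| <= d.
    by have [e e0 He] := conv_approx C M (cF i) d0; exists e.
  pose e0 := \big[Num.min/1]_i e i.
  have e00 : 0 < e0.
    rewrite /e0; elim/big_ind: _ => // [x y x0 y0|i _]; first by rewrite lt_min x0.
    by have [] := eP i.
  have [m0 _ Hm0] : \forall m \near \oo, m.+1%:R^-1 < e0.
    by apply: (cvgr_lt 0 _ _); [exact: cvg_harmonic|].
  exists m0 => m m0m i y yM; have [_ He] := eP i.
  apply: (He _ _ _ (kP m) y yM); apply: (lt_le_trans (Hm0 m m0m)).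
  exact: bigmin_le.
have cQ y : cvgn (Qm ^~ y).
  apply/cauchy_cvgP; apply: cauchy_exP => d d0.
  have ny : 0 <= n%:R * `|y| by rewrite mulr_ge0.
  have [|m0 Hm0] := unif `|y| (d / (2 * (n%:R * `|y|) + 1)).
    by rewrite divr_gt0// ltr_wpDl// mulr_ge0.
  exists (Qm m0 y); exists m0 => // m m0m; rewrite -ball_normE /=.
  have [t /andP[t0 t1]] := gradient_MVT 0 y (has_gradient_sub (gQ m0) (gQ m)).
  rewrite add0r.
  have Q0 l : Qm l 0 = 0 by rewrite /Qm subrr.
  rewrite !Q0 subr0 subr0 => ->.
  have ty : `|0 + t *: y| <= `|y| by rewrite add0r normrZ ger0_norm// ler_piMl.
  have HB i : `|conv (F i) (k m0) (0 + t *: y) - conv (F i) (k m) (0 + t *: y)| <=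
      2 * (d / (2 * (n%:R * `|y|) + 1)).
    rewrite -(subrKA (F i (0 + t *: y))) (le_trans (ler_normD _ _))//.
    rewrite [leRHS]mulr_natl mulr2n lerD//; first exact: Hm0.
    by rewrite distrC; exact: Hm0.
  have B0 : 0 <= 2 * (d / (2 * (n%:R * `|y|) + 1)).
    by rewrite mulr_ge0// divr_ge0 ?(ltW d0)// addr_ge0// mulr_ge0.
  apply: (le_lt_trans (norm_gradient_le _ B0 HB)).
  have -> : n%:R * (2 * (d / (2 * (n%:R * `|y|) + 1))) * `|y| =
      d * (2 * (n%:R * `|y|)) / (2 * (n%:R * `|y|) + 1).
    by field; rewrite gt_eqF// ltr_wpDl// mulr_ge0.
  by rewrite ltr_pdivrMr ?ltr_wpDl ?mulr_ge0// ltr_pM2l//; lra.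
pose Q y := limn (Qm ^~ y).
(* First-order expansion of [Q] at [x]: it holds for [Qm m] with a radius independent of [m], hence
   for the limit. *)
have near_eps (x : E) (d : R) : 0 < d -> exists2 r : R, 0 < r &
    forall z, `|z - x| < r ->
    `|Q z - Q x - \sum_i (z - x) ord0 i * F i x| <= n%:R * d * `|z - x|.
  move=> d0; have d2 : 0 < d / 2 by rewrite divr_gt0.
  have /choice[e eP] i : exists e : R, 0 < e /\ forall z, `|x - z| < e -> `|F i x - F i z| < d / 2.
    by have [e e0 He] := continuous_unif `|x| (cF i) d2; exists e; split=> // z; exact: He.
  pose r := \big[Num.min/1]_i e i.
  have r0 : 0 < r.
    rewrite /r; elim/big_ind: _ => // [a b a0 b0|i _]; first by rewrite lt_min a0.
    by have [] := eP i.
  have r1 : r <= 1 by exact: bigmin_le_id.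
  exists r => // z zx.
  have [m0 Hm0] := unif (`|x| + 1) _ d2.
  have Hm m : (m0 <= m)%N ->
      `|Qm m z - Qm m x - \sum_i (z - x) ord0 i * F i x| <= n%:R * d * `|z - x|.
    move=> m0m; have [t /andP[t0 t1]] := gradient_MVT x (z - x) (gQ m).
    rewrite [x + (z - x)]addrC subrK => ->.
    rewrite -sumrB; under eq_bigr do rewrite -mulrBr.
    have tz : `|t *: (z - x)| <= `|z - x| by rewrite normrZ ger0_norm// ler_piMl.
    apply: norm_gradient_le => [|i]; first exact: ltW.
    have h1 : `|conv (F i) (k m) (x + t *: (z - x)) - F i (x + t *: (z - x))| <= d / 2.
      apply: Hm0 => //; rewrite (le_trans (ler_normD _ _))// lerD2l.
      by rewrite (le_trans tz)// (le_trans (ltW zx)).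
    have h2 : `|F i x - F i (x + t *: (z - x))| < d / 2.
      have [_] := eP i; apply; rewrite opprD addrA subrr sub0r normrN.
      by rewrite (le_lt_trans tz)// (lt_le_trans zx)//; exact: bigmin_le.
    rewrite -(subrKA (F i (x + t *: (z - x)))) (le_trans (ler_normD _ _))//.
    by rewrite [leRHS]splitr lerD// distrC ltW.
  have cv : (fun m => `|Qm m z - Qm m x - \sum_i (z - x) ord0 i * F i x|) @ \oo -->
      `|Q z - Q x - \sum_i (z - x) ord0 i * F i x|.
    by apply: cvg_norm; apply: cvgB; [apply: cvgB; exact: cQ|exact: cvg_cst].
  have cvg' := cvgP _ cv; rewrite -(cvg_lim _ cv)//.
  by apply: limr_le => //; exists m0.
exists Q; split=> // x h.
suff H : t^-1 *: ((Q \o shift x) (t *: h) - Q x) @[t --> 0^'] --> \sum_i h ord0 i * F i x.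
  by split; [exact: (cvgP _ H)|exact: cvg_lim].
apply/cvgrPdist_le => e e0.
have nh : 0 <= n%:R * `|h| by rewrite mulr_ge0.
have nh1 : 0 < n%:R * `|h| + 1 by rewrite ltr_wpDl.
have [|r r0 Hr] := near_eps x (e / (n%:R * `|h| + 1)); first by rewrite divr_gt0.
near=> t.
have t0 : t != 0 by near: t; exact: nbhs_dnbhs_neq.
have tr : `|t| < r / (`|h| + 1).
  by near: t; apply: dnbhs0_lt; rewrite divr_gt0// ltr_wpDl.
have th : `|t *: h + x - x| < r.
  rewrite addrK normrZ; move: tr; rewrite ltr_pdivlMr ?ltr_wpDl//.
  have := normr_ge0 t; nra.
have := Hr _ th; rewrite addrK /shift /=.
rewrite distrC => H.
have -> : \sum_i h ord0 i * F i x - t^-1 *: (Q (t *: h + x) - Q x) =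
    t^-1 * (\sum_i (t *: h) ord0 i * F i x - (Q (t *: h + x) - Q x)).
  rewrite mulrBr mulr_sumr; congr (_ - _); apply: eq_bigr => i _.
  by rewrite mxE !mulrA mulVf// mul1r.
rewrite normrM normfV ler_pdivrMl ?normr_gt0//; apply: (le_trans H).
rewrite normrZ mulrCA ler_wpM2l//.
have -> : n%:R * (e / (n%:R * `|h| + 1)) * `|h| = e * (n%:R * `|h|) / (n%:R * `|h| + 1).
  by field; rewrite gt_eqF.
by rewrite ler_pdivrMr// ler_wpM2l ?(ltW e0)//; lra.
Unshelve. all: end_near. Qed.

End weak_formulation.

(** * Classical profiles and the transport of their vorticity *)

Section profile.
Context {R : realType} {n : nat}.
Local Notation E := 'rV[R]_n.

(* [du i j] is the [j]-th derivative of [u i]; [Q] has the same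
   distributional gradient as the pressure. *)
Record classical_profile (a : R) (u : 'I_n -> E -> R) (du : 'I_n -> 'I_n -> E -> R)
    (Q : E -> R) : Prop := ClassicalProfile {
  profile_C1 : forall i, C1 (u i) (du i) ;
  profile_div : forall y, \sum_i du i i y = 0 ;
  profile_eq : C1 Q (fun i y => \sum_j ((1 + a)^-1 * y ord0 j - u j y) * du i j y +
    a / (1 + a) * u i y) }.

Lemma self_similar_classical (a : R) (v : E -> E) (q : E -> R) :
  Ck_on 1 setT v -> self_similar_profile a v q ->
  exists Q, classical_profile a (fun i y => v y ord0 i)
    (fun i j => partial j ((fun y => v y ord0 i) : E -> R^o)) Q.
Proof.
move=> cv [lq div eqn].
pose u i y : R := v y ord0 i.
pose du i j : E -> R := partial j ((fun y => v y ord0 i) : E -> R^o).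
have Cu i : C1 (u i) (du i) by exact: Ck_on_C1.
have cu i : continuous (u i) := C1_continuous (Cu i).
have cdu i j : continuous (du i j) := (Cu i).2 j.
have cA i : continuous (advection v v i).
  by apply: continuous_sum => j; apply: continuous_mul; [exact: cu|exact: cdu].
have cy i : continuous (fun y : E => y ord0 i) := C1_continuous (C1_coord i).
have cL i : continuous (fun y => 1 / (1 + a) * advection id v i y + a / (1 + a) * v y ord0 i).
  apply: continuous_add; apply: continuous_mul; try exact: cst_continuous.
    by apply: continuous_sum => j; apply: continuous_mul; [exact: cy|exact: cdu].
  exact: cu.
pose F i (y : E) : R := \sum_j ((1 + a)^-1 * y ord0 j - u j y) * du i j y + a / (1 + a) * u i y.
have FE i : F i = fun y => (1 / (1 + a) * advection id v i y + a / (1 + a) * v y ord0 i)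
    - advection v v i y.
  apply/funext => y; rewrite /F /advection addrAC; congr (_ + _).
  rewrite mulr_sumr -sumrB; apply: eq_bigr => j _.
  by rewrite div1r /u /du; ring.
have cF i : continuous (F i) by rewrite FE; exact: continuous_sub.
have [|Q CQ] := weak_gradient_potential lq cF.
  move=> i k y kk; have tk := kernel_test (kernel_reflect y kk).1.
  have := eqn i _ tk; rewrite distr_partial_reflect// !distr_of_reflect => H.
  by rewrite FE conv_sub// H addrAC subrr add0r.
exists Q; split=> //.
by apply: weak_divergence_free Cu _ => phi; exact: div.
Qed.

(** As an antisymmetric matrix, which makes sense in every dimension: the [i]-th derivative of [u j]
    minus the [j]-th derivative of [u i]. *)
Definition vort (du : 'I_n -> 'I_n -> E -> R) i j y : R := du j i y - du i j y.

(** Bookkeeping for [vort_transport]: the [P] are mollified products, [A] the factors mollified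
    alone and [B] the limit terms, so that [P - w A - B] are commutator remainders. The first
    hypothesis is the closedness of the vorticity, the second that the curl of a gradient
    vanishes. *)
Lemma transport_algebra (w B1 B2 : 'I_n -> R) (o : R) (P1 P2 A1 A2 Z : 'I_n -> R) (ka m : R) :
  (forall l, A1 l - A2 l = Z l) -> \sum_l P1 l - \sum_l P2 l + ka * m = 0 ->
  \sum_l w l * Z l - (- \sum_l (B1 l - B2 l) - ka * o) =
  - \sum_l ((P1 l - w l * A1 l - B1 l) - (P2 l - w l * A2 l - B2 l)) - ka * (m - o).
Proof.
move=> rot H0; apply/eqP; rewrite -subr_eq0; apply/eqP; rewrite -[RHS]H0.
have -> : \sum_l w l * Z l = \sum_l w l * A1 l - \sum_l w l * A2 l.
  by rewrite -sumrB; apply: eq_bigr => l _; rewrite -rot mulrBr.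
by rewrite !sumrB; ring.
Qed.

(* The vorticity is merely continuous, hence its transport equation
   [w . grad vort = ...] only holds after mollification. *)
Lemma vort_transport C a u du Q (M d : R) : 0 < C -> 0 < d ->
  classical_profile a u du Q ->
  let w l (y : E) := (1 + a)^-1 * y ord0 l - u l y in
  let dw l j (y : E) := (1 + a)^-1 * (l == j)%:R - du l j y in
  exists2 e0 : R, 0 < e0 & forall e k, 0 < e -> e < e0 -> mollifier C e k ->
    forall i j y, `|y| <= M ->
    `|\sum_l w l y * conv (vort du j i) (partial l k) y -
      (- \sum_l (dw l j y * vort du l i y - dw l i y * vort du l j y)
      - (a - 1) / (1 + a) * vort du j i y)| <= d.
Proof.
move=> C0 d0 [Cu div CQ] w dw.
pose c : R := (1 + a)^-1; pose ka := (a - 1) / (1 + a).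
have cu i := C1_continuous (Cu i).
have cdu i j : continuous (du i j) := (Cu i).2 j.
have cvort i j : continuous (vort du i j) by exact: continuous_sub.
have Cw l : C1 (w l) (dw l) by exact: C1_sub (C1_scale _ (C1_coord l)) (Cu l).
(* Lamb's form of the advection: subtracting the gradient of [w . u + |u|^2 / 2] replaces
   [w . grad u] by [w] contracted with the vorticity, and changes the coefficient of [u] from
   [a / (1 + a)] to [ka]. *)
pose G (y : E) : R := \sum_l (w l y * u l y + 2^-1 * (u l y * u l y)).
have CG := C1_sum (index_enum 'I_n) (fun l => C1_add (C1_mul (Cw l) (Cu l)) (C1_scale 2^-1 (C1_mul (Cu l) (Cu l)))).
pose H i (y : E) : R := \sum_l w l y * vort du l i y + ka * u i y.
have CH : C1 (fun y => Q y - G y) H.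
  have := C1_sub CQ CG; congr C1; apply/funext => i; apply/funext => y.
  rewrite /H addrAC; rewrite -sumrB.
  have -> : ka * u i y = a / (1 + a) * u i y - c * u i y.
    by rewrite /ka /c; ring.
  rewrite addrCA addrC; congr (_ + _).
  have -> : c * u i y = \sum_l c * (l == i)%:R * u l y.
    rewrite (bigD1 i)//= eqxx mulr1 big1 ?addr0// => l li.
    by rewrite (negbTE li) mulr0 mul0r.
  rewrite -sumrB; apply: eq_bigr => l _.
  by rewrite /w /dw /vort /c; move: ((l == i)%:R : R) ((1 + a)^-1) => b t; field.
have cH i : continuous (H i) := CH.2 i.
(* Two commutator remainders for each of the [n] indices, and one mollification error weighted by
   [ka]. *)
pose N := n%:R * 2 + `|ka| + 1 : R.
have N0 : 0 < N by rewrite ltr_wpDl// addr_ge0// mulr_ge0.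
have dN : 0 < d / N by rewrite divr_gt0.
have Nd : n%:R * 2 * (d / N) + `|ka| * (d / N) <= d.
  by rewrite -mulrDl mulrCA ler_piMr ?(ltW d0)// ler_pdivrMr// mul1r /N lerDl.
have /choice[r rP] (p : 'I_n * 'I_n * 'I_n) : exists r : R, 0 < r /\
    forall e k, 0 < e -> e < r -> mollifier C e k -> forall y, `|y| <= M ->
    `|conv (fun z => w p.1.1 z * vort du p.1.1 p.1.2 z) (partial p.2 k) y -
      w p.1.1 y * conv (vort du p.1.1 p.1.2) (partial p.2 k) y -
      dw p.1.1 p.2 y * vort du p.1.1 p.1.2 y| <= d / N.
  by have [r r0 Hr] := commutator p.2 M C0 (Cw p.1.1) (cvort p.1.1 p.1.2) dN; exists r.
have /choice[s sP] (p : 'I_n * 'I_n) : exists s : R, 0 < s /\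
    forall e k, e < s -> mollifier C e k -> forall y, `|y| <= M ->
    `|conv (vort du p.1 p.2) k y - vort du p.1 p.2 y| <= d / N.
  by have [s s0 Hs] := conv_approx C M (cvort p.1 p.2) dN; exists s.
pose e0 := Num.min (\big[Num.min/1]_p r p) (\big[Num.min/1]_p s p).
have e00 : 0 < e0.
  rewrite lt_min; apply/andP; split.
    elim/big_ind: _ => // [x y x0 y0|p _]; first by rewrite lt_min x0.
    by have [] := rP p.
  elim/big_ind: _ => // [x y x0 y0|p _]; first by rewrite lt_min x0.
  by have [] := sP p.
exists e0 => // e k e_gt0; rewrite lt_min => /andP[er es] mk i j y yM.
have kk := mollifier_kernel mk.
have hr l i' j' := (rP (l, i', j')).2 e k e_gt0 (lt_le_trans er (bigmin_le _ _ _)) mk y yM.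
have hs i' j' := (sP (i', j')).2 e k (lt_le_trans es (bigmin_le _ _ _)) mk y yM.
rewrite /= in hr hs.
(* [H] is a gradient, so both sides are mollified second derivatives of its potential; they agree
   because the partial derivatives of [k] commute. *)
have curl : conv (H i) (partial j k) y = conv (H j) (partial i k) y.
  have pC l m : conv (H l) (partial m k) y = conv (fun y => Q y - G y) (partial l (partial m k)) y.
    by rewrite (conv_partial _ (C1_continuous CH) (cH l) (fun x => has_gradient_partial l x CH.1) (kernel_partial m kk)).
  by rewrite !pC kernel_partialC.
have expand l m : conv (H l) (partial m k) y =
    \sum_p conv (fun z => w p z * vort du p l z) (partial m k) y + ka * conv (du l m) k y.
  have kpk := kernel_partial m kk.
  have cwv p : continuous (fun z => w p z * vort du p l z).
    exact: (continuous_mul (C1_continuous (Cw p)) (cvort p l)).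
  have cku : continuous (fun z => ka * u l z).
    exact: (continuous_mul (@cst_continuous _ _ ka) (cu l)).
  rewrite -[H l]/(fun z => \sum_p w p z * vort du p l z + ka * u l z).
  rewrite (conv_add y (continuous_sum cwv) cku kpk) (conv_suml _ y cwv kpk).
  rewrite (conv_scale ka y (cu l) kpk).
  by rewrite (conv_partial y (cu l) (cdu l m) (fun x => has_gradient_partial m x (Cu l).1) kk).
have pp l m p : conv (du l m) (partial p k) y = conv (u l) (partial m (partial p k)) y.
  exact: esym (conv_partial y (cu l) (cdu l m) (fun x => has_gradient_partial m x (Cu l).1) (kernel_partial p kk)).
(* Closedness of the vorticity: the cyclic identity that reassembles [w] contracted with two
   derivatives of the vorticity into the single derivative [w . grad]. *)
have rot l : conv (vort du l i) (partial j k) y - conv (vort du l j) (partial i k) y =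
    conv (vort du j i) (partial l k) y.
  have cs p m j' : conv (vort du p m) (partial j' k) y =
      conv (du m p) (partial j' k) y - conv (du p m) (partial j' k) y.
    exact: (conv_sub y (cdu m p) (cdu p m) (kernel_partial j' kk)).
  rewrite !cs !pp.
  have e1 : partial l (partial j k) = partial j (partial l k) := kernel_partialC l j kk.
  have e2 : partial l (partial i k) = partial i (partial l k) := kernel_partialC l i kk.
  have e3 : partial i (partial j k) = partial j (partial i k) := kernel_partialC i j kk.
  by rewrite e1 e2 e3 opprB addrA subrK.
pose c1 l := conv (fun z => w l z * vort du l i z) (partial j k) y -
      w l y * conv (vort du l i) (partial j k) y - dw l j y * vort du l i y.
pose c2 l := conv (fun z => w l z * vort du l j z) (partial i k) y -
      w l y * conv (vort du l j) (partial i k) y - dw l i y * vort du l j y.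
have H0 : \sum_p conv (fun z => w p z * vort du p i z) (partial j k) y -
    \sum_p conv (fun z => w p z * vort du p j z) (partial i k) y +
    ka * conv (vort du j i) k y = 0.
  have -> : conv (vort du j i) k y = conv (du i j) k y - conv (du j i) k y.
    exact: (conv_sub y (cdu i j) (cdu j i) kk).
  have /eqP := curl; rewrite !expand -subr_eq0 => /eqP H1.
  by rewrite -[RHS]H1 mulrBr opprD addrACA.
rewrite (transport_algebra (fun l => w l y) (fun l => dw l j y * vort du l i y)
  (fun l => dw l i y * vort du l j y) (vort du j i y) rot H0).
have c1P l : `|c1 l| <= d / N by exact: hr.
have c2P l : `|c2 l| <= d / N by exact: hr.
apply: (le_trans (ler_normB _ _)); rewrite normrN normrM.
apply: (@le_trans _ _ (n%:R * 2 * (d / N) + `|ka| * (d / N))).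
  apply: lerD; last by rewrite ler_wpM2l.
  apply: (le_trans (ler_norm_sum _ _ _)).
  apply: (@le_trans _ _ (\sum_(l < n) (2 * (d / N)))).
    apply: ler_sum => l _; apply: (le_trans (ler_normB _ _)).
    by rewrite mulr_natl mulr2n; exact: (lerD (c1P l) (c2P l)).
  by rewrite sumr_const card_ord -[leLHS]mulr_natl mulrA.
exact: Nd.
Qed.

End profile.

(** * Rigidity of transport by an expanding field *)

Section bounded_convergence.
Context {R : realType} {n : nat}.
Local Notation E := 'rV[R]_n.
Local Notation mu := (@lebesgue_rV R n).

Lemma bounded_cvg (f_ : nat -> E -> R) (f : E -> R) (M B : R) : 0 <= M ->
  (forall m, continuous (f_ m)) -> (forall m x, `|f_ m x| <= B) ->
  (forall m x, M < `|x| -> f_ m x = 0) -> (forall x, f_ ^~ x @ \oo --> f x) ->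
  (fun m => \int[mu]_x f_ m x) @ \oo --> \int[mu]_x f x.
Proof.
move=> M0 cf fB fM ff.
have mf_ m : measurable_fun setT (EFin \o f_ m).
  by apply/measurable_EFinP; exact: continuous_measurable_rV.
have mf : measurable_fun setT (EFin \o f).
  apply/measurable_EFinP; apply: (measurable_fun_cvg (h := f_)).
    by move=> m; exact: continuous_measurable_rV.
  by move=> x _; exact: ff.
have ffE x : (EFin \o f_ m) x @[m --> \oo] --> (EFin \o f) x.
  by apply: cvg_EFin; [exact: nearW|exact: ff].
have [ig _] := integral_ball (0 : E) B M0.
have fg (x : E) m : (`|(EFin \o f_ m) x| <= (B * (`|0 - x| <= M)%R%:R)%:E)%E.
  rewrite /= lee_fin sub0r normrN; have [xM|Mx] := leP `|x| M; first by rewrite mulr1.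
  by rewrite fM// normr0 mulr0.
have [i1 _ H] := dominated_convergence measurableT mf_ mf
  (aeW _ (fun x _ => ffE x)) ig (aeW _ (fun x m _ => fg x m)).
apply: fine_cvg; rewrite fineK; first exact: H.
exact: integrable_fin_num.
Qed.

End bounded_convergence.

Section transport.
Context {R : realType} {n : nat} {I : finType}.
Local Notation E := 'rV[R]_n.
Local Notation mu := (@lebesgue_rV R n).

(** The function is [U / (U + s)], in a form that is easy to differentiate: a C1 approximation, as
    [s] tends to 0, of the indicator of [U != 0]. *)
Lemma C1_saturation (s : R) (U : E -> R) (dU : 'I_n -> E -> R) : 0 < s ->
  (forall y, 0 <= U y) -> C1 U dU ->
  C1 (fun y => 1 - s * (U y + s)^-1) (fun l y => s * (U y + s) ^- 2 * dU l y).
Proof.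
move=> s0 U0 CU.
have Us y : U y + s != 0 by rewrite gt_eqF// ltr_wpDl.
apply: (@C1_comp _ _ (fun t => 1 - s * (t + s)^-1) (fun t => s * (t + s) ^- 2)) => // y.
- have d1 : is_derive (U y) 1 (fun t : R => t + s) 1.
    by apply: (is_derive_eq (is_deriveD (is_derive_id _ _) (is_derive_cst _ _ _))); rewrite addr0.
  have d2 : is_derive (U y) 1 (fun t : R => (t + s)^-1) (- (U y + s) ^- 2).
    have [d1' e1] := d1; split; first exact: derivableV.
    by rewrite deriveV// e1 /GRing.scale /= mulr1.
  apply: (is_derive_eq (is_deriveB (is_derive_cst (1 : R) _ _) (is_deriveZ s d2))).
  by rewrite sub0r /GRing.scale /= mulrN opprK.
- have c1 : {for U y, continuous (fun t : R => t + s)}.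
    by apply: cvgD; [exact: cvg_id|exact: cvg_cst].
  have c2 : {for U y, continuous (fun t : R => (t + s) ^+ 2)}.
    exact: (cvgM c1 c1).
  apply: cvgM; first exact: cvg_cst.
  by apply: cvgV => //; rewrite expf_neq0.
Qed.

(** The integrand is the divergence of [w U / (U + s)]. As the saturation vanishes with [U], this
    field has bounded support although [w] grows at infinity. *)
Lemma integral_saturation (D s : R) (w : 'I_n -> E -> R) (dw : 'I_n -> 'I_n -> E -> R)
    (W : I -> E -> R) (dW : I -> 'I_n -> E -> R) : 0 < s ->
  (forall l, C1 (w l) (dw l)) -> (forall y, \sum_l dw l l y = D) ->
  (forall p, C1 (W p) (dW p)) -> (forall p, bounded_support (W p)) ->
  let U y := \sum_p W p y * W p y in
  continuous (fun y => D * (1 - s * (U y + s)^-1) +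
    s * (U y + s) ^- 2 * (\sum_p 2 * (W p y * \sum_l w l y * dW p l y))) /\
  \int[mu]_y (D * (1 - s * (U y + s)^-1) +
    s * (U y + s) ^- 2 * (\sum_p 2 * (W p y * \sum_l w l y * dW p l y))) = 0.
Proof.
move=> s0 Cw Dw CW sW U.
have U0 y : 0 <= U y by apply: sumr_ge0 => p _; rewrite -expr2 sqr_ge0.
have CU := C1_sum (index_enum I) (fun p => C1_mul (CW p) (CW p)).
have CfU := C1_saturation s0 U0 CU.
pose dU l y : R := \sum_p (W p y * dW p l y + W p y * dW p l y).
pose fU y : R := 1 - s * (U y + s)^-1.
pose g l y : R := w l y * fU y.
pose dg l y : R := w l y * (s * (U y + s) ^- 2 * dU l y) + fU y * dw l l y.
have Cg l := C1_mul (Cw l) CfU.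
have sg l : bounded_support (g l).
  have /choice[M MP] := sW.
  exists (\sum_p `|M p|) => y My; rewrite /g /fU.
  have -> : U y = 0.
    rewrite /U big1// => p _; rewrite MP ?mulr0//; apply: le_lt_trans My.
    by rewrite (bigD1 p)//= (le_trans (ler_norm _))// lerDl sumr_ge0.
  by rewrite add0r divff ?gt_eqF// subrr mulr0.
have cg l : continuous (g l) := C1_continuous (Cg l).
have cdg l : continuous (dg l) := (Cg l).2 l.
have gP l y : is_derive y (delta_mx ord0 l) (g l) (dg l y).
  exact: (has_gradient_partial l y (Cg l).1).
have sdg l := bounded_support_is_derive (sg l) (gP l).
have i0 l : \int[mu]_y dg l y = 0.
  by rewrite /Rintegral (integral_derive0 (cg l) (cdg l) (sg l) (gP l)).
have ii l := continuous_integrable (cdg l) (sdg l).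
have E1 : (fun y => D * (1 - s * (U y + s)^-1) +
    s * (U y + s) ^- 2 * (\sum_p 2 * (W p y * \sum_l w l y * dW p l y))) =
    (fun y => \sum_l dg l y).
  apply/funext => y; rewrite /dg big_split /= -[\sum_l fU y * _]mulr_sumr Dw [RHS]addrC [fU y * D]mulrC.
  congr (_ + _); rewrite mulr_sumr.
  under [RHS]eq_bigr do rewrite /dU mulrCA mulr_sumr.
  under [RHS]eq_bigr do rewrite mulr_sumr.
  rewrite exchange_big /=; apply: eq_bigr => p _.
  rewrite -mulr_sumr; congr (_ * _); rewrite !mulr_sumr; apply: eq_bigr => l _.
  by ring.
rewrite E1; split; first exact: continuous_sum.
by have [_ ->] := Rintegral_sum (index_enum 'I_n) ii; rewrite big1.
Qed.

Lemma cvg_harmonic_bound (a : nat -> R) (l : R) :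
  (forall m, `|a m - l| <= m.+1%:R^-1) -> a @ \oo --> l.
Proof.
move=> H; apply/cvgrPdist_le => e e0.
have : \forall m \near \oo, m.+1%:R^-1 < e.
  by apply: (cvgr_lt 0 _ _); [exact: cvg_harmonic|].
by apply: filterS => m me; rewrite distrC (le_trans (H m))// ltW.
Qed.

End transport.

Section transport_rigidity.
Context {R : realType} {n : nat} {I : finType}.
Local Notation E := 'rV[R]_n.
Local Notation mu := (@lebesgue_rV R n).

Lemma cvg_sum_seq (J : Type) (r : seq J) (F : J -> nat -> R) (l : J -> R) :
  (forall p, F p @ \oo --> l p) ->
  (fun m => \sum_(p <- r) F p m) @ \oo --> \sum_(p <- r) l p.
Proof.
move=> Fl; elim: r => [|p r IH].
  rewrite big_nil (_ : (fun m => _) = fun=> 0); first exact: cvg_cst.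
  by apply/funext => m; rewrite big_nil.
rewrite big_cons (_ : (fun m => _) = fun m => F p m + \sum_(p <- r) F p m).
  exact: (cvgD (Fl p) IH).
by apply/funext => m; rewrite big_cons.
Qed.

(* Integrating the divergence of [w U / (U + s)] with [U = |o|^2] and letting [s]
   tend to [0] gives [D * mu {o != 0} = 0]; [W] approximates [o] by [C1] functions
   whose transport [w . grad W] is close to [B]. *)
Lemma transported_zero (D K M : R) (w : 'I_n -> E -> R) (dw : 'I_n -> 'I_n -> E -> R)
    (o B : I -> E -> R) : 0 < D -> 0 <= K -> 0 <= M ->
  (forall l, C1 (w l) (dw l)) -> (forall y, \sum_l dw l l y = D) ->
  (forall p, continuous (o p)) -> (forall p, continuous (B p)) ->
  (forall p y, M < `|y| -> o p y = 0) ->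
  (forall p y, `|y| <= M -> `|o p y * B p y| <= K * \sum_q o q y * o q y) ->
  (forall d, 0 < d -> exists W dW, [/\ forall p, C1 (W p) (dW p),
    forall p y, `|y| <= M -> `|W p y - o p y| <= d,
    forall p y, `|y| <= M -> `|\sum_l w l y * dW p l y - B p y| <= d &
    forall p y, M < `|y| -> W p y = 0]) ->
  forall p y, o p y = 0.
Proof.
move=> D0 K0 M0 Cw Dw co cB oM oB approx p0 y0.
pose u y : R := \sum_p o p y * o p y.
have u0 y : 0 <= u y by apply: sumr_ge0 => p _; rewrite -expr2 sqr_ge0.
have cu : continuous u by apply: continuous_sum => p; exact: continuous_mul.
pose S y : R := \sum_p 2 * (o p y * B p y).
have cS : continuous S.
  by apply: continuous_sum => p; apply: continuous_mul; [exact: cst_continuous|exact: continuous_mul].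
have uM y : M < `|y| -> u y = 0 by move=> My; rewrite /u big1// => p _; rewrite oM ?mulr0.
have SM y : M < `|y| -> S y = 0 by move=> My; rewrite /S big1// => p _; rewrite oM ?mul0r ?mulr0.
pose T (s : R) y : R := D * (1 - s * (u y + s)^-1) + s * (u y + s) ^- 2 * S y.
have bnd (f : E -> R) : continuous f -> exists A : R, 0 < A /\ forall x, `|x| <= M -> `|f x| <= A.
  by move=> cf; have [A A0 HA] := continuous_bounded_on_ball M cf; exists A.
have /choice[A AP] p := bnd _ (co p).
have /choice[A' AP'] p := bnd _ (cB p).
have /choice[W WP] (m : nat) := approx _ (@harmonic_gt0 R m).
have /choice[dW WdW] := WP.
pose U m y := \sum_p W m p y * W m p y.
have U0 m y : 0 <= U m y by apply: sumr_ge0 => p _; rewrite -expr2 sqr_ge0.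
pose Tm (s : R) m y : R := D * (1 - s * (U m y + s)^-1) +
    s * (U m y + s) ^- 2 * (\sum_p 2 * (W m p y * \sum_l w l y * dW m p l y)).
(* The two limits are taken in order: first [W] tends to [o] with [s] fixed, then [s] tends to 0. *)
have ident s : 0 < s -> \int[mu]_y T s y = 0.
  move=> s0.
  have st m : continuous (Tm s m) /\ \int[mu]_y Tm s m y = 0.
    have [h1 _ _ h4] := WdW m.
    apply: integral_saturation => // p.
    by exists M => y; exact: h4.
  (* Uniform in the approximation: the saturation is at most 1, its derivative [s / (U + s) ^+ 2] at
     most [s^-1], and [W] and its transport are within 1 of [o] and [B]. *)
  pose Bd := D + s^-1 * \sum_p 2 * ((A p + 1) * (A' p + 1)).
  have h1m m : m.+1%:R^-1 <= (1 : R) by rewrite invf_le1 ?ler1n// ltr0n.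
  have H : (fun m => \int[mu]_y Tm s m y) @ \oo --> \int[mu]_y T s y.
    apply: (@bounded_cvg _ _ _ _ M Bd) => //.
    - by move=> m; exact: (st m).1.
    - move=> m y; have [yM|My] := leP `|y| M; last first.
        have [_ _ _ h4] := WdW m.
        have U00 : U m y = 0 by rewrite /U big1// => p _; rewrite h4 ?mulr0.
        rewrite /Tm U00 add0r divff ?gt_eqF// subrr mulr0 add0r big1 => [|p _]; last first.
          by rewrite h4// mul0r mulr0.
        rewrite mulr0 normr0 addr_ge0 ?(ltW D0)// mulr_ge0 ?invr_ge0 ?(ltW s0)//.
        apply: sumr_ge0 => p _; have [a0 _] := AP p; have [a'0 _] := AP' p.
        by rewrite mulr_ge0// mulr_ge0// addr_ge0// ltW.
      have [_ h2 h3 _] := WdW m.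
      have Us : 0 < U m y + s by rewrite ltr_wpDl.
      rewrite (le_trans (ler_normD _ _))// lerD//.
        rewrite normrM (gtr0_norm D0) ler_piMr ?(ltW D0)//.
        have -> : 1 - s * (U m y + s)^-1 = U m y / (U m y + s).
          by field; rewrite gt_eqF.
        rewrite ger0_norm; last by rewrite divr_ge0// ltW.
        by rewrite ler_pdivrMr// mul1r lerDl ltW.
      rewrite normrM ler_pM//.
        rewrite ger0_norm; last by rewrite mulr_ge0 ?(ltW s0)// invr_ge0 exprn_ge0// ltW.
        rewrite ler_pdivrMr ?exprn_gt0//.
        rewrite expr2 ler_pdivlMl//; apply: ler_pM; rewrite ?(ltW s0)//; by rewrite lerDr.
      rewrite (le_trans (ler_norm_sum _ _ _))//; apply: ler_sum => p _.
      rewrite normrM ger0_norm// ler_wpM2l// normrM ler_pM//.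
        have -> : W m p y = (W m p y - o p y) + o p y by rewrite subrK.
        rewrite (le_trans (ler_normD _ _))// addrC lerD//; first exact: (AP p).2.
        exact: (le_trans (h2 p y yM) (h1m m)).
      have -> : \sum_l w l y * dW m p l y = (\sum_l w l y * dW m p l y - B p y) + B p y by rewrite subrK.
      rewrite (le_trans (ler_normD _ _))// addrC lerD//; first exact: (AP' p).2.
      exact: (le_trans (h3 p y yM) (h1m m)).
    - move=> m y My; have [_ _ _ h4] := WdW m.
      have U00 : U m y = 0 by rewrite /U big1// => p _; rewrite h4 ?mulr0.
      rewrite /Tm U00 add0r divff ?gt_eqF// subrr mulr0 add0r big1 ?mulr0// => p _.
      by rewrite h4// mul0r mulr0.
    - move=> y; have [yM|My] := leP `|y| M; last first.
        have -> : T s y = 0 by rewrite /T uM// SM// add0r divff ?gt_eqF// subrr !mulr0 addr0.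
        rewrite (_ : Tm s ^~ y = fun=> 0); first exact: cvg_cst.
        apply/funext => m; have [_ _ _ h4] := WdW m.
        have U00 : U m y = 0 by rewrite /U big1// => p _; rewrite h4 ?mulr0.
        rewrite /Tm U00 add0r divff ?gt_eqF// subrr mulr0 add0r big1 ?mulr0// => p _.
        by rewrite h4// mul0r mulr0.
      have cW p : (fun m => W m p y) @ \oo --> o p y.
        by apply: cvg_harmonic_bound => m; have [_ h2 _ _] := WdW m; exact: h2.
      have cWW p : (fun m => \sum_l w l y * dW m p l y) @ \oo --> B p y.
        by apply: cvg_harmonic_bound => m; have [_ _ h3 _] := WdW m; exact: h3.
      have cU : (fun m => U m y) @ \oo --> u y.
        by apply: cvg_sum_seq => p; exact: cvgM (cW p) (cW p).
      have us : u y + s != 0 by rewrite gt_eqF// ltr_wpDl.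
      have cUs : (fun m => U m y + s) @ \oo --> u y + s.
        by apply: cvgD => //; exact: cvg_cst.
      apply: cvgD.
        apply: cvgM; first exact: cvg_cst.
        apply: cvgB; first exact: cvg_cst.
        by apply: cvgM; [exact: cvg_cst|exact: cvgV].
      apply: cvgM.
        apply: cvgM; first exact: cvg_cst.
        by apply: cvgV; [rewrite expf_neq0|exact: (cvgM cUs cUs)].
      by apply: cvg_sum_seq => p; apply: cvgM; [exact: cvg_cst|exact: cvgM].
  have H0 : (fun m => \int[mu]_y Tm s m y) = fun=> 0.
    by apply/funext => m; exact: (st m).2.
  rewrite H0 in H.
  by rewrite -(cvg_lim _ H)// (cvg_lim _ (cvg_cst (0 : R))).
apply/eqP/negPn/negP => o0.
pose K2 := \sum_(p in I) 2 * K.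
have K20 : 0 <= K2 by apply: sumr_ge0 => p _; rewrite mulr_ge0.
have SK y : `|S y| <= K2 * u y.
  have [yM|My] := leP `|y| M; last by rewrite SM// uM// normr0 mulr0.
  rewrite /S /K2 mulr_suml (le_trans (ler_norm_sum _ _ _))//; apply: ler_sum => p _.
  by rewrite normrM ger0_norm// -mulrA ler_wpM2l// oB.
pose h (m : nat) y : R := m.+1%:R^-1 * (u y + m.+1%:R^-1) ^- 2 * S y.
have s0 (m : nat) : 0 < (m.+1%:R^-1 : R) by rewrite invr_gt0 ltr0n.
have us m y : 0 < u y + m.+1%:R^-1 by rewrite ltr_wpDl.
(* Both fractions lie between 0 and 1, which gives domination by [K2]. Where [u] is positive the
   second tends to 0; where [u] vanishes the first is 0. *)
have hle m y : `|h m y| <= K2 * (u y / (u y + m.+1%:R^-1)) * (m.+1%:R^-1 / (u y + m.+1%:R^-1)).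
  rewrite /h normrM ger0_norm; last by rewrite mulr_ge0 ?invr_ge0 ?exprn_ge0// ltW.
  apply: (@le_trans _ _ (m.+1%:R^-1 * (u y + m.+1%:R^-1) ^- 2 * (K2 * u y))).
    by rewrite ler_wpM2l// mulr_ge0 ?invr_ge0 ?exprn_ge0// ltW.
  rewrite le_eqVlt; apply/orP; left; apply/eqP.
  by move: (m.+1%:R^-1) (us m y) => s us'; field; rewrite gt_eqF.
have ule1 m y : 0 <= u y / (u y + m.+1%:R^-1) <= 1.
  by rewrite divr_ge0 ?(ltW (us m y))//= ler_pdivrMr// mul1r lerDl ltW.
have sle1 m y : 0 <= m.+1%:R^-1 / (u y + m.+1%:R^-1) <= 1.
  by rewrite divr_ge0 ?(ltW (us m y)) ?(ltW (s0 m))//= ler_pdivrMr// mul1r lerDr.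
have ch m : continuous (h m).
  apply: continuous_mul => //; apply: continuous_mul; first exact: cst_continuous.
  have c2 : continuous (fun y => (u y + m.+1%:R^-1) * (u y + m.+1%:R^-1)).
    by apply: continuous_mul; apply: continuous_add => //; exact: cst_continuous.
  move=> y; have ne : (u y + m.+1%:R^-1) * (u y + m.+1%:R^-1) != 0.
    by rewrite mulf_neq0// gt_eqF.
  exact: (cvgV ne (c2 y)).
have hM m y : M < `|y| -> h m y = 0 by move=> My; rewrite /h SM// mulr0.
have H : (fun m => \int[mu]_y h m y) @ \oo --> \int[mu]_y (cst 0 y).
  apply: (@bounded_cvg _ _ _ _ M K2) => //.
  - move=> m y; rewrite (le_trans (hle m y))//.
    have /andP[h1 h2] := ule1 m y; have /andP[h3 h4] := sle1 m y.
    by rewrite -mulrA ler_piMr// mulr_ile1.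
  - move=> y; have [uy|uy] := eqVneq (u y) 0.
      have -> : h ^~ y = fun=> 0.
        apply/funext => m; have := hle m y; rewrite uy mul0r mulr0 mul0r normr_le0.
        by move/eqP.
      exact: cvg_cst.
    have uy0 : 0 < u y by rewrite lt_def uy u0.
    apply/cvgrPdist_le => e e0.
    have c0 : 0 < e / (K2 / u y + 1) by rewrite divr_gt0// ltr_wpDl// divr_ge0// ltW.
    have : \forall m \near \oo, m.+1%:R^-1 < e / (K2 / u y + 1).
      by apply: (cvgr_lt 0 _ _); [exact: cvg_harmonic|].
    apply: filterS => m me; rewrite sub0r normrN (le_trans (hle m y))//.
    apply: (@le_trans _ _ (K2 * 1 * (m.+1%:R^-1 / u y))).
      have /andP[h1 h2] := ule1 m y; have /andP[h3 h4] := sle1 m y.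
      apply: ler_pM => //; first exact: mulr_ge0.
        exact: ler_wpM2l.
      by rewrite ler_pM2l// lef_pV2 ?posrE// lerDl ltW.
    move: me; rewrite ltr_pdivlMr ?ltr_wpDl ?divr_ge0 ?(ltW uy0)// => me.
    have -> : K2 * 1 * (m.+1%:R^-1 / u y) = m.+1%:R^-1 * (K2 / u y) by rewrite mulr1 mulrCA mulrA.
    by apply: ltW; apply: le_lt_trans me; rewrite mulrDr mulr1 lerDl ltW.
pose eta := u y0 / 2.
have uy0 : 0 < u y0.
  rewrite lt_def u0 andbT /u psumr_eq0 => [|p _]; last by rewrite -expr2 sqr_ge0.
  by apply/allPn; exists p0; rewrite ?mem_index_enum//= mulf_neq0.
have eta0 : 0 < eta by rewrite divr_gt0.
have [r r0 Hr] := continuous_unif `|y0| cu eta0.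
have near_y0 z : `|y0 - z| <= r / 2 -> eta <= u z.
  move=> yz; have := Hr y0 z (lexx _); rewrite ltr_norml => /(_ _)/andP[|_].
    by rewrite (le_lt_trans yz)// ltr_pdivrMr// ltr_pMr// ltr1n.
  by rewrite /eta; lra.
(* At a point with [o] nonzero, [u] is at least [eta] on a small ball; there the expansion term is
   bounded below independently of [m], while the integral of [h m] that must balance it tends to
   0. *)
have lower m : D * (eta / (eta + 1)) * (2 * (r / 2)) ^+ n <= - \int[mu]_y h m y.
  pose f y := D * (1 - m.+1%:R^-1 * (u y + m.+1%:R^-1)^-1).
  have fE y : f y = D * (u y / (u y + m.+1%:R^-1)).
    by rewrite /f; congr (_ * _); move: (m.+1%:R^-1) (us m y) => s us'; field; rewrite gt_eqF.
  have cf : continuous f.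
    apply: continuous_mul; first exact: cst_continuous.
    apply: continuous_sub; first exact: cst_continuous.
    apply: continuous_mul; first exact: cst_continuous.
    move=> y; have ne : u y + m.+1%:R^-1 != 0 by rewrite gt_eqF.
    have c1 : continuous (fun y => u y + m.+1%:R^-1).
      by apply: continuous_add => //; exact: cst_continuous.
    exact: (cvgV ne (c1 y)).
  have fM y : M < `|y| -> f y = 0 by move=> My; rewrite fE uM// mul0r mulr0.
  have i1 := continuous_integrable cf (ex_intro _ M fM).
  have i2 := continuous_integrable (ch m) (ex_intro _ M (hM m)).
  have := ident _ (s0 m); rewrite /T RintegralD// => /eqP.
  rewrite addr_eq0 => /eqP <-.
  apply: Rintegral_ge_ball => //; first by rewrite divr_ge0// ltW.
    move=> z /near_y0 uz; rewrite -/(f z) fE ler_wpM2l ?(ltW D0)//.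
    rewrite ler_pdivrMr; last by rewrite ltr_wpDl// ltW.
    rewrite mulrAC ler_pdivlMr//.
    have h1 : m.+1%:R^-1 <= (1 : R) by rewrite invf_le1 ?ler1n// ltr0n.
    rewrite !mulrDr mulr1 [eta * u z]mulrC lerD2l.
    by rewrite (le_trans _ uz)// ler_piMr// ltW.
  by move=> z; rewrite -/(f z) fE mulr_ge0 ?(ltW D0)//; have /andP[] := ule1 m z.
have pos : 0 < D * (eta / (eta + 1)) * (2 * (r / 2)) ^+ n.
  apply: mulr_gt0; last by rewrite exprn_gt0// mulr_gt0// divr_gt0.
  by rewrite mulr_gt0// divr_gt0// addr_gt0.
rewrite Rintegral_cst// mul0r in H.
have /cvgrPdist_lt/(_ _ pos)[m _ /(_ m (leqnn m))] := H.
rewrite sub0r normrN => h1; have := lower m; have := ler_norm (- \int[mu]_y h m y).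
by rewrite normrN; move: h1; lra.
Qed.

End transport_rigidity.

(** * Vanishing of the vorticity and Liouville's theorem *)

Section vorticity.
Context {R : realType} {n : nat}.
Local Notation E := 'rV[R]_n.
Local Notation "''e_' i" := (delta_mx ord0 i : E) (at level 8, i at level 2).

Lemma vort_zero a u du Q (rho : R) : (0 < n)%N -> -1 < a -> 0 <= rho ->
  classical_profile a u du Q ->
  (forall i j (y : E), rho < `|y| -> vort du i j y = 0) ->
  forall i j (y : E), vort du i j y = 0.
Proof.
move=> n0 a1 rho0 cp vort0; have [Cu div _] := cp.
have [C C0 mC] := @exists_mollifier R n.
have cdu i j : continuous (du i j) := (Cu i).2 j.
have cvort i j : continuous (vort du i j) := continuous_sub (cdu j i) (cdu i j).
pose c : R := (1 + a)^-1; pose ka := (a - 1) / (1 + a).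
have c0 : 0 < c by rewrite invr_gt0; lra.
pose w l (y : E) : R := c * y ord0 l - u l y.
pose dw l j (y : E) : R := c * (l == j)%:R - du l j y.
have Cw l : C1 (w l) (dw l) by exact: C1_sub (C1_scale _ (C1_coord l)) (Cu l).
pose o (p : 'I_n * 'I_n) := vort du p.1 p.2.
pose B (p : 'I_n * 'I_n) y : R := - \sum_l (dw l p.1 y * vort du l p.2 y - dw l p.2 y * vort du l p.1 y)
      - ka * vort du p.1 p.2 y.
(* Leaves room for mollifiers of scale less than 1 around a vorticity that vanishes beyond [rho]. *)
pose M := rho + 1.
have M0 : 0 <= M by rewrite addr_ge0.
have Dw y : \sum_l dw l l y = n%:R * c.
  rewrite sumrB div subr0; under eq_bigr do rewrite eqxx mulr1.
  by rewrite sumr_const card_ord mulr_natl.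
have D0 : 0 < n%:R * c by rewrite mulr_gt0// ltr0n.
have co p : continuous (o p) by exact: cvort.
have cB p : continuous (B p).
  apply: continuous_sub; last by apply: continuous_mul; [exact: cst_continuous|exact: cvort].
  apply: continuous_opp; apply: continuous_sum => l; apply: continuous_sub;
    apply: continuous_mul; [exact: (Cw l).2|exact: cvort|exact: (Cw l).2|exact: cvort].
have oM p y : M < `|y| -> o p y = 0.
  by move=> My; apply: vort0; apply: lt_trans My; rewrite ltrDl.
have bnd (f : E -> R) : continuous f -> exists A : R, 0 < A /\ forall x, `|x| <= M -> `|f x| <= A.
  by move=> cf; have [A A0 HA] := continuous_bounded_on_ball M cf; exists A.
have /choice[A AP] (p : 'I_n * 'I_n) := bnd _ ((Cw p.1).2 p.2).
pose A0 := \sum_p A p.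
have A00 : 0 <= A0 by apply: sumr_ge0 => p _; have [/ltW] := AP p.
have AA l i y : `|y| <= M -> `|dw l i y| <= A0.
  move=> yM; have [_ /(_ y yM) h] := AP (l, i); apply: (le_trans h).
  rewrite /A0 (bigD1 (l, i))//= lerDl; apply: sumr_ge0 => p _.
  by have [/ltW] := AP p.
pose v y : R := \sum_q o q y * o q y.
have ov p q y : `|o p y * o q y| <= v y.
  have sq q' : o q' y * o q' y <= v y.
    rewrite /v (bigD1 q')//= lerDl; apply: sumr_ge0 => p' _.
    by rewrite -expr2 sqr_ge0.
  have := sq p; have := sq q; rewrite ler_norml.
  move: (o p y) (o q y) (v y) => x1 x2 s h1 h2.
  apply/andP; split; nra.
pose K := n%:R * (A0 + A0) + `|ka|.
have K0 : 0 <= K by rewrite addr_ge0// mulr_ge0// addr_ge0.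
have oB p y : `|y| <= M -> `|o p y * B p y| <= K * \sum_q o q y * o q y.
  move=> yM; have -> : \sum_q o q y * o q y = v y by [].
  rewrite /B mulrBr mulrN [X in - X - _]mulr_sumr.
  have -> : K * v y = n%:R * (A0 + A0) * v y + `|ka| * v y by rewrite /K mulrDl.
  apply: (le_trans (ler_normB _ _)); rewrite normrN; apply: lerD; last first.
    by rewrite mulrCA normrM ler_wpM2l//; exact: ov.
  apply: (le_trans (ler_norm_sum _ _ _)).
  apply: (@le_trans _ _ (\sum_(l < n) (A0 + A0) * v y)).
    have -> : (A0 + A0) * v y = A0 * v y + A0 * v y by rewrite mulrDl.
    apply: ler_sum => l _; rewrite mulrBr.
    apply: (le_trans (ler_normB _ _)); apply: lerD; rewrite mulrCA normrM.
      by apply: ler_pM => //; [exact: AA|exact: (ov p (l, p.2))].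
    by apply: ler_pM => //; [exact: AA|exact: (ov p (l, p.1))].
  by rewrite sumr_const card_ord -[leLHS]mulr_natl mulrA.
have approx d : 0 < d -> exists W dW, [/\ forall p, C1 (W p) (dW p),
    forall p y, `|y| <= M -> `|W p y - o p y| <= d,
    forall p y, `|y| <= M -> `|\sum_l w l y * dW p l y - B p y| <= d &
    forall p y, M < `|y| -> W p y = 0].
  move=> d0.
  have [e1 e10 He1] := vort_transport M C0 d0 cp.
  have /choice[e2 He2] (p : 'I_n * 'I_n) : exists e2 : R, 0 < e2 /\
      forall e k, e < e2 -> mollifier C e k -> forall y, `|y| <= M -> `|conv (o p) k y - o p y| <= d.
    by have [e2 e20 H] := conv_approx C M (co p) d0; exists e2.
  pose e3 := Num.min 1 (Num.min e1 (\big[Num.min/1]_p e2 p)).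
  have e30 : 0 < e3.
    rewrite !lt_min ltr01 e10 /=; elim/big_ind: _ => // [x y x0 y0|p _]; first by rewrite lt_min x0.
    by have [] := He2 p.
  pose e := e3 / 2.
  have e0 : 0 < e by rewrite divr_gt0.
  have ee : e < e3 by rewrite ltr_pdivrMr// ltr_pMr// ltr1n.
  move: ee; rewrite !lt_min => /and3P[ee1 ee2 ee3].
  have [k mk] := mC e e0; have kk := mollifier_kernel mk.
  exists (fun p => conv (o p) k), (fun p l => conv (o p) (partial l k)); split.
  - by move=> p; exact: (conv_C1 (continuous_locally_integrable (co p)) kk).
  - move=> p y yM; exact: ((He2 p).2 e k (lt_le_trans ee3 (bigmin_le _ _ _)) mk y yM).
  - move=> p y yM; exact: (He1 e k e0 ee2 mk p.2 p.1 y yM).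
  - move=> p y My; apply/eqP; rewrite -normr_le0; apply: (mollifier_bound mk (co p)) => z yz.
    rewrite /o vort0 ?normr0//; have := ler_normD (y - z) z; rewrite subrK.
    by move: My yz ee1; rewrite /M; lra.
move=> i j y.
exact: (transported_zero D0 K0 M0 Cw Dw co cB oM oB approx (i, j) y).
Qed.

(** If [g2] were positive, the difference quotient of [g1], which vanishes at the maximum, would
    make [g1] positive just to the right of 0, and [g] would increase there. A derivative of [g1] at
    0 alone suffices. *)
Lemma local_max_derive2 (g g1 : R -> R) (g2 r : R) : 0 < r ->
  (forall t : R, `|t| < r -> is_derive t 1 g (g1 t)) -> is_derive (0 : R) 1 g1 g2 ->
  (forall t, `|t| < r -> g t <= g 0) -> g2 <= 0.
Proof.
move=> r0 gP g1P gmax; rewrite leNgt; apply/negP => g20.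
have inr (t : R) : t \in `](- r), r[ -> `|t| < r by rewrite in_itv /= ltr_norml.
have z0 : `|0 : R| < r by rewrite normr0.
have d0 : is_derive (0 : R) 1 g 0.
  apply: (@derive1_at_max _ g (- r) r 0).
  - by lra.
  - by move=> t /inr /gP[].
  - by rewrite in_itv /=; apply/andP; lra.
  - by move=> t /inr; exact: gmax.
have g10 : g1 0 = 0.
  by have [_ <-] := gP _ z0; have [_ ->] := d0.
have [dg1 e1] := g1P.
have cv : h^-1 *: ((g1 \o shift 0) (h *: (1 : R)) - g1 0) @[h --> 0^'] --> g2.
  by rewrite -e1; exact: dg1.
have [d /= d00 dP] : \forall h \near 0^', 0 < h^-1 *: ((g1 \o shift 0) (h *: (1 : R)) - g1 0).
  exact: (cvgr_gt _ cv).
pose t := Num.min (r / 2) (d / 2).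
have t0 : 0 < t by rewrite lt_min !divr_gt0.
have tr : t < r by rewrite /t gt_min; apply/orP; left; lra.
have td : t < d by rewrite /t gt_min; apply/orP; right; lra.
have [s||s] := @MVT R g g1 0 t t0.
- rewrite in_itv /= => /andP[s0 st]; apply: gP.
  by rewrite gtr0_norm// (lt_trans st).
- apply: derivable_within_continuous => s; rewrite in_itv /= => /andP[s0 st].
  by have [] := gP s _; rewrite // ger0_norm// (le_lt_trans st).
rewrite in_itv /= => /andP[s0 st] E1.
have : 0 < s^-1 *: ((g1 \o shift 0) (s *: (1 : R)) - g1 0).
  apply: dP; last by rewrite gt_eqF.
  by rewrite /= sub0r normrN gtr0_norm// (lt_trans st).
rewrite g10 /= /shift /= addr0 subr0 -[s *: 1]/(s * 1) mulr1 -[_ *: _]/(_ * _).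
rewrite pmulr_rgt0 ?invr_gt0// => g1s.
have := gmax t; rewrite gtr0_norm// => /(_ tr).
by rewrite leNgt -subr_gt0 E1 mulr_gt0// subr0.
Qed.

(** Maximum principle on a large ball. Adding [d |y|^2] makes the Laplacian strictly positive, which
    forbids an interior maximum; a positive value of [U] together with its smallness at infinity
    forces one. *)
Lemma harmonic_le0 (U : E -> R) (dU : 'I_n -> E -> R) (ddU : 'I_n -> 'I_n -> E -> R) :
  (0 < n)%N -> C1 U dU -> (forall k, C1 (dU k) (ddU k)) ->
  (forall y, \sum_k ddU k k y = 0) ->
  (forall d : R, 0 < d -> exists r : R, forall y, r < `|y| -> U y <= d) ->
  forall y, U y <= 0.
Proof.
move=> n0 CU CdU lap dec y0; rewrite leNgt; apply/negP => Uy0.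
have [r rP] := dec _ (divr_gt0 Uy0 (ltr0n _ 2)).
pose r' := Num.max `|r| `|y0|.
have r'0 : 0 <= r' by rewrite le_max normr_ge0.
(* Exceeds the squared Euclidean norm on the ball of radius [r' + 1], so with [d * b = U y0 / 2] the
   perturbation cannot lift the outer values, at most [U y0 / 2], up to [U y0]. *)
pose b := n%:R * (r' + 1) ^+ 2 + 1.
have b0 : 0 < b by rewrite ltr_wpDl// mulr_ge0// exprn_ge0// addr_ge0.
pose d := U y0 / 2 / b.
have d0 : 0 < d by rewrite !divr_gt0.
pose G (y : E) : R := U y + d * \sum_k y ord0 k * y ord0 k.
have CG := C1_add CU (C1_scale d (C1_sum (index_enum 'I_n)
  (fun k => C1_mul (C1_coord k) (C1_coord k)))).
have sq0 (y : E) : 0 <= \sum_k y ord0 k * y ord0 k.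
  by apply: sumr_ge0 => k _; rewrite -expr2 sqr_ge0.
have [||c cB cmax] := @EVT_max_rV R n G [set y : E | `|y| <= r' + 1] _ (@closed_ball_compact R n _).
- by exists 0; rewrite /= normr0 addr_ge0.
- by apply: continuous_subspaceT; exact: C1_continuous CG.
have cle : `|c| <= r'.
  rewrite leNgt; apply/negP => rc.
  have Uc : U c <= U y0 / 2.
    by apply: rP; apply: le_lt_trans rc; rewrite /r' (le_trans (ler_norm r))// le_max lexx.
  have h1 : G y0 <= G c by apply: cmax; rewrite inE /= /r' (@le_trans _ _ r')// ?lerDl// le_max lexx orbT.
  have h2 : \sum_k c ord0 k * c ord0 k <= b - 1.
    rewrite /b addrK; apply: (@le_trans _ _ (\sum_(k < n) (r' + 1) ^+ 2)); last first.
      by rewrite sumr_const card_ord -[leLHS]mulr_natl.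
    apply: ler_sum => k _; rewrite -expr2 -real_normK ?num_real//.
    rewrite lerXn2r ?nnegrE// ?addr_ge0//.
    by move: cB; rewrite inE /=; apply: le_trans; exact: coord_le_norm.
  have h3 : d * b = U y0 / 2 by rewrite /d divfK// gt_eqF.
  move: h1; rewrite /G; have := sq0 y0; move: h2 h3 Uc d0 Uy0 b0.
  move: (\sum_k c ord0 k * c ord0 k) (\sum_k y0 ord0 k * y0 ord0 k) => s1 s2.
  nra.
have inball (k : 'I_n) (t : R) : `|t| < 1 -> `|c + t *: 'e_k| <= r' + 1.
  move=> t1; rewrite (le_trans (ler_normD _ _))// lerD// normrZ.
  have e1 : `|'e_k : E| <= 1.
    apply: norm_le_coord => // i; rewrite mxE eqxx /=.
    by case: (i == k); rewrite ?normr1// normr0.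
  by rewrite (le_trans (ler_wpM2l (normr_ge0 _) e1))// mulr1 ltW.
have key k : ddU k k c + 2 * d <= 0.
  pose g1 t : R := dU k (c + t *: 'e_k) + d * (2 * (c + t *: 'e_k) ord0 k).
  apply: (@local_max_derive2 (fun t => G (c + t *: 'e_k)) g1 _ 1 ltr01).
  - move=> t t1; apply: (is_derive_lineP G c 'e_k t (g1 t)).1.
    have := has_gradient_partial k (c + t *: 'e_k) CG.1.
    congr (is_derive _ _ _ _); rewrite /g1; congr (_ + _ * _).
    rewrite (bigD1 k)//= eqxx mulr1 big1 ?addr0 => [|i ik]; first by rewrite mulr_natl mulr2n.
    by rewrite (negbTE ik) !mulr0 addr0.
  - have H := has_gradient_partial k (c + 0 *: 'e_k)
      (C1_add (CdU k) (C1_scale d (C1_scale 2 (C1_coord k)))).1.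
    have := (is_derive_lineP (fun y => dU k y + d * (2 * y ord0 k)) c 'e_k 0 _).1 H.
    congr (is_derive _ _ _ _).
    by rewrite scale0r addr0 eqxx mulr1 mulrC.
  - move=> t t1; rewrite scale0r addr0; apply: cmax; rewrite inE /=; exact: inball.
have : \sum_k (ddU k k c + 2 * d) <= 0 by apply: sumr_le0 => k _; exact: key.
rewrite big_split /= lap add0r sumr_const card_ord -[leLHS]mulr_natl leNgt.
by rewrite mulr_gt0// ?ltr0n// mulr_gt0.
Qed.

Lemma irrotational_zero (u : 'I_n -> E -> R) (du : 'I_n -> 'I_n -> E -> R) :
  (0 < n)%N -> (forall i, C1 (u i) (du i)) -> (forall y, \sum_i du i i y = 0) ->
  (forall i j y, vort du i j y = 0) ->
  (forall d : R, 0 < d -> exists r : R, forall i j (y : E), r < `|y| -> `|du i j y| <= d) ->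
  forall i j y, du i j y = 0.
Proof.
move=> n0 Cu div rot dec.
have [C C0 mC] := @exists_mollifier R n.
have cu i : continuous (u i) := C1_continuous (Cu i).
have cdu i j : continuous (du i j) := (Cu i).2 j.
have sym i j : du i j = du j i.
  by apply/funext => y; apply/eqP; rewrite -subr_eq0; apply/eqP; exact: rot.
have lap k : kernel k -> forall i j y, \sum_l conv (du i j) (partial l (partial l k)) y = 0.
  move=> kk i j y.
  have pu i' j' k' : kernel k' -> conv (u i') (partial j' k') y = conv (du i' j') k' y.
    move=> kk'; exact: (conv_partial y (cu i') (cdu i' j') (fun x => has_gradient_partial j' x (Cu i').1) kk').
  (* The Laplacian of the [j]-th derivative of [u i] is the [(i, j)] derivative of the divergence:
     derivatives move one at a time through the kernel, and the symmetry of [du] exchanges the index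
     of the component with that of the derivative. *)
  have E1 l : conv (du i j) (partial l (partial l k)) y = conv (du l l) (partial i (partial j k)) y.
    have kl := kernel_partial l kk; have kll := kernel_partial l kl.
    have kj := kernel_partial j kk; have kjl := kernel_partial l kj.
    have kij := kernel_partial i kj.
    rewrite -(pu i j _ kll) (kernel_partialC j l kl) (kernel_partialC j l kk).
    rewrite (pu i l _ kjl) sym -(pu l i _ kjl) (kernel_partialC i l kj).
    exact: pu.
  under eq_bigr do rewrite E1.
  have kij := kernel_partial i (kernel_partial j kk).
  rewrite -(conv_suml _ y (fun l => cdu l l) kij) /conv.
  under eq_Rintegral do rewrite div mul0r.
  by rewrite Rintegral_cst// mul0r.
have conv0 e k i j y : e <= 1 -> mollifier C e k -> conv (du i j) k y = 0.
  move=> e1 mk; have kk := mollifier_kernel mk.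
  have lf := continuous_locally_integrable (cdu i j).
  have CU := conv_C1 lf kk; have CdU l := conv_C1 lf (kernel_partial l kk).
  have decU d : 0 < d -> exists r : R, forall y, r < `|y| -> `|conv (du i j) k y| <= d.
    move=> d0; have [r rP] := dec _ d0; exists (r + 1) => z rz.
    apply: (mollifier_bound mk (cdu i j)) => x zx; apply: rP.
    have := ler_normD (z - x) x; rewrite subrK; move: rz zx e1; lra.
  apply/eqP; rewrite eq_le; apply/andP; split.
    apply: (harmonic_le0 n0 CU CdU) => [z|d d0]; first exact: lap.
    have [r rP] := decU d d0; exists r => z rz.
    exact: (le_trans (ler_norm _) (rP z rz)).
  rewrite -oppr_le0.
  apply: (harmonic_le0 n0 (C1_opp CU) (fun l => C1_opp (CdU l))) => [z|d d0].
    by rewrite sumrN lap// oppr0.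
  have [r rP] := decU d d0; exists r => z rz.
  by apply: (le_trans (ler_norm _)); rewrite normrN; exact: rP.
move=> i j y; apply/eqP; rewrite -normr_le0; apply/ler_addgt0Pr => d d0; rewrite add0r.
have [e0 e00 He] := conv_approx C `|y| (cdu i j) d0.
pose e := Num.min (e0 / 2) 1.
have e1 : 0 < e by rewrite lt_min ltr01 andbT divr_gt0.
have ee0 : e < e0 by rewrite /e gt_min; apply/orP; left; lra.
have e2 : e <= 1 by rewrite /e ge_min lexx orbT.
have [k mk] := mC e e1.
have := He e k ee0 mk y (lexx _).
by rewrite (conv0 e k i j y e2 mk) sub0r normrN.
Qed.

End vorticity.

(** * Homogeneous far field *)

Section homogeneity.
Context {R : realType} {n : nat}.
Local Notation E := 'rV[R]_n.
Local Notation "''e_' i" := (delta_mx ord0 i : E) (at level 8, i at level 2).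

Lemma enormZ (s : R) (y : E) : 0 <= s -> enorm (s *: y) = s * enorm y.
Proof.
move=> s0; rewrite /enorm.
have -> : \sum_i (s *: y) ord0 i ^+ 2 = s ^+ 2 * \sum_i y ord0 i ^+ 2.
  by rewrite mulr_sumr; apply: eq_bigr => i _; rewrite mxE exprMn.
by rewrite sqrtrM ?sqr_ge0// sqrtr_sqr ger0_norm.
Qed.

Lemma norm_le_enorm (y : E) : `|y| <= enorm y.
Proof.
apply: norm_le_coord => [|i]; first exact: sqrtr_ge0.
rewrite -sqrtr_sqr ler_wsqrtr// (bigD1 i)//= lerDl.
by apply: sumr_ge0 => j _; exact: sqr_ge0.
Qed.

Definition homogeneous_outside (r s : R) (f : E -> R) :=
  forall (t : R) y, 0 < t -> r < `|y| -> r < `|t *: y| -> f (t *: y) = t `^ s * f y.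

(** The sup norm is at most the Euclidean one, so the Euclidean radius also serves as a sup-norm
    radius. *)
Lemma homogeneous_near_infinity_coord (b : R) (V v : E -> E) :
  homogeneous_near_infinity b V v ->
  exists2 r : R, 0 < r & forall i, homogeneous_outside r (- b) (fun y => v y ord0 i).
Proof.
move=> [r r0 vE]; exists r => // i t y t0 ry rty.
have ey : r < enorm y by apply: lt_le_trans (norm_le_enorm y).
have ety : r < enorm (t *: y) by apply: lt_le_trans (norm_le_enorm _).
have e0 : 0 < enorm y by apply: lt_trans ey.
rewrite !vE// !mxE enormZ ?(ltW t0)// scalerA.
have -> : (t * enorm y)^-1 * t = (enorm y)^-1 by rewrite invfM mulrAC mulVf ?mul1r// gt_eqF.
by rewrite (powRM _ (ltW t0) (ltW e0)) powRN invfM mulrA.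
Qed.

(** The conditions on [y] and [t *: y] are open, so the scaling relation holds near [y] and may be
    differentiated; the dilation contributes the factor [t]. *)
Lemma homogeneous_partial r s f df j : C1 f df -> homogeneous_outside r s f ->
  homogeneous_outside r (s - 1) (df j).
Proof.
move=> [fP _] hf t y t0 ry rty.
have d1 : is_derive y 'e_j (fun z => f (0 + t *: z)) (t * df j (t *: y)).
  apply: is_derive_affine; rewrite add0r.
  have := fP (t *: y) (t *: 'e_j); congr (is_derive _ _ _ _).
  rewrite (bigD1 j)//= !mxE !eqxx mulr1 big1 ?addr0// => i ij.
  by rewrite !mxE eqxx (negbTE ij) mulr0 mul0r.
have d2 : is_derive y 'e_j (fun z => t `^ s * f z) (t `^ s * df j y).
  exact: is_deriveZ (has_gradient_partial j y fP).
have nr : \forall z \near y, r < `|z|.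
  exact: (cvgr_gt _ (@norm_continuous _ _ y) _ ry).
have nrt : \forall z \near y, r < `|t *: z|.
  have c : `|t *: z| @[z --> y] --> `|t *: y|.
    have d : differentiable (fun z : E => t *: z) y by [].
    exact: (cvg_norm (differentiable_continuous d)).
  exact: (cvgr_gt _ c _ rty).
have d3 : is_derive y 'e_j (fun z => f (0 + t *: z)) (t `^ s * df j y).
  apply: near_eq_is_derive d2.
  by near=> z; rewrite add0r hf//; near: z.
have E1 : t * df j (t *: y) = t `^ s * df j y.
  by have [_ <-] := d1; have [_ ->] := d3.
apply: (mulfI (lt0r_neq0 t0)); rewrite E1 mulrA; congr (_ * _).
have H : (1 + (s - 1) == 0) ==> (t != 0) by apply/implyP => _; rewrite gt_eqF.
have := powRD H; rewrite powRr1 ?(ltW t0)// => <-; congr (_ `^ _); ring.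
Unshelve. all: end_near. Qed.

Lemma homogeneous_euler r s f df (y : E) : C1 f df -> homogeneous_outside r s f ->
  r < `|y| -> 0 <= r -> \sum_j y ord0 j * df j y = s * f y.
Proof.
move=> [fP _] hf ry r0.
have d1 : is_derive (0 : R) 1 (fun t : R => f (y + t *: y)) (\sum_j y ord0 j * df j y).
  have := (is_derive_lineP f y y 0 (\sum_j y ord0 j * df j y)).1.
  by rewrite scale0r addr0; apply; exact: fP.
have d2 : is_derive (0 : R) 1 (fun t : R => (1 + t) `^ s * f y) (s * f y).
  have d3 : is_derive (0 : R) 1 (fun t : R => 1 + t) 1.
    by apply: (is_derive_eq (is_deriveD (is_derive_cst _ _ _) (is_derive_id _ _))); rewrite add0r.
  have d4 : is_derive ((1 + 0 : R)) 1 (fun x : R => x `^ s) (s * (1 + 0) `^ (s - 1)).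
    by apply: is_derive1_powR; rewrite addr0.
  have d5 := @is_derive1_comp _ (fun x : R => x `^ s) (fun t : R => 1 + t) 0 _ _ d4 d3.
  have d6 := is_deriveZ (f y) d5.
  have -> : (fun t : R => (1 + t) `^ s * f y) = f y *: ((fun x : R => x `^ s) \o (fun t : R => 1 + t)).
    by apply/funext => t; rewrite /= mulrC.
  apply: (is_derive_eq d6).
  by rewrite addr0 powR1 !mulr1 /GRing.scale /= mulrC.
have nr : \forall t \near (0 : R), r < `|(1 + t) *: y|.
  have c : `|(1 + t) *: y| @[t --> (0 : R)] --> `|(1 + 0 : R) *: y|.
    have d : differentiable (fun t : R => (1 + t) *: y) 0.
      by apply: differentiableZl; apply: differentiableD.
    exact: (cvg_norm (differentiable_continuous d)).
  by apply: (cvgr_gt _ c); rewrite addr0 scale1r.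
have nt : \forall t \near (0 : R), 0 < 1 + t.
  near=> t; have : -1 < t by near: t; apply: lt_nbhsr; lra.
  lra.
have d3 : is_derive (0 : R) 1 (fun t : R => f (y + t *: y)) (s * f y).
  apply: near_eq_is_derive d2; near=> t.
  have -> : y + t *: y = (1 + t) *: y by rewrite scalerDl scale1r.
  by rewrite hf//; near: t.
by have [_ <-] := d1; have [_ ->] := d3.
Unshelve. all: end_near. Qed.

(** Each [y] is scaled back to the sup-norm sphere of radius [r + 1], where [f] is bounded; radius
    [r] would not do, as homogeneity is only available strictly outside it. *)
Lemma homogeneous_bound r s f : 0 <= r -> continuous f -> homogeneous_outside r s f ->
  exists2 A : R, 0 < A & forall y, r + 1 <= `|y| -> `|f y| <= A * `|y| `^ s.
Proof.
move=> r0 cf hf; have r1 : 0 < r + 1 by rewrite ltr_wpDl.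
have [A A0 fA] := continuous_bounded_on_ball (r + 1) cf.
exists (A * ((r + 1)^-1) `^ s) => [|y ry]; first by rewrite mulr_gt0// powR_gt0// invr_gt0.
have y0 : 0 < `|y| by apply: lt_le_trans ry.
pose t := `|y| / (r + 1).
have t0 : 0 < t by rewrite divr_gt0.
pose z := t^-1 *: y.
have nz : `|z| = r + 1.
  by rewrite normrZ gtr0_norm ?invr_gt0// /t invfM invrK mulrAC mulVf ?mul1r// gt_eqF.
have yz : y = t *: z by rewrite scalerA divff ?scale1r// gt_eqF.
rewrite {1}yz hf//; last 2 first.
- by rewrite nz ltrDl.
- by rewrite -yz (lt_le_trans _ ry)// ltrDl.
rewrite normrM ger0_norm ?powR_ge0// mulrC /t powRM ?invr_ge0 ?(ltW r1)//.
rewrite [`|y| `^ s * _]mulrC mulrA ler_wpM2r ?powR_ge0// ler_wpM2r ?powR_ge0//.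
by apply: fA; rewrite nz.
Qed.

End homogeneity.

(** * Irrotationality near infinity and constancy of the profile *)

Section far_field.
Context {R : realType} {n : nat}.
Local Notation E := 'rV[R]_n.
Local Notation "''e_' i" := (delta_mx ord0 i : E) (at level 8, i at level 2).

Lemma C1_dilation (t : R) (f : E -> R) df : C1 f df ->
  C1 (fun y : E => f (t *: y)) (fun i y => t * df i (t *: y)).
Proof.
move=> [fP cdf].
have ct (g : E -> R) : continuous g -> continuous (fun y : E => g (t *: y)).
  move=> cg y; apply: (@continuous_comp _ _ _ (fun z : E => t *: z)); last exact: cg.
  have d : differentiable (fun z : E => t *: z) y by [].
  exact: (differentiable_continuous d).
split=> [y h|i]; last by apply: continuous_mul; [exact: cst_continuous|exact: ct].
have := @is_derive_affine R n f 0 t y h (\sum_i h ord0 i * (t * df i (t *: y))).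
have -> : (fun z => f (0 + t *: z)) = fun z => f (t *: z).
  by apply/funext => z; rewrite add0r.
rewrite add0r.
apply; have := fP (t *: y) (t *: h); congr (is_derive _ _ _ _).
by apply: eq_bigr => i _; rewrite mxE mulrCA mulrA.
Qed.

Lemma powR_decay (A s d : R) : 0 < A -> s < 0 -> 0 < d ->
  exists2 r : R, 0 < r & forall x, r < x -> A * x `^ s <= d.
Proof.
move=> A0 s0 d0; have Ad : 0 < A / d by rewrite divr_gt0.
exists ((A / d) `^ (- s)^-1) => [|x rx]; first exact: powR_gt0.
have x0 : 0 < x by apply: le_lt_trans rx; exact: powR_ge0.
have H : A / d <= x `^ (- s).
  have <- : (A / d) `^ (- s)^-1 `^ (- s) = A / d.
    by rewrite -powRrM mulVf ?powRr1 ?(ltW Ad)// oppr_eq0 lt_eqF.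
  by apply: ge0_ler_powR; rewrite ?nnegrE ?powR_ge0 ?(ltW x0) ?(ltW rx)//; lra.
rewrite -[s]opprK powRN ler_pdivrMr ?powR_gt0//.
by move: H; rewrite ler_pdivrMr// mulrC.
Qed.

Context (a b r : R) (u : 'I_n -> E -> R) (du : 'I_n -> 'I_n -> E -> R) (Q : E -> R)
  (cp : classical_profile a u du Q) (r0 : 0 < r) (a1 : -1 < a)
  (hu : forall i, homogeneous_outside r (- b) (u i)).

Let F i (y : E) : R := \sum_j ((1 + a)^-1 * y ord0 j - u j y) * du i j y + a / (1 + a) * u i y.
Let N i (y : E) : R := \sum_j u j y * du i j y.

(** Euler's identity turns [y . grad u] into [- b u], so the linear part collapses to a multiple of
    [u]. *)
Lemma far_force i (y : E) : r < `|y| -> F i y = (a - b) / (1 + a) * u i y - N i y.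
Proof.
move=> ry; rewrite /F.
have H := homogeneous_euler (profile_C1 cp i) (hu i) ry (ltW r0).
have -> : \sum_j ((1 + a)^-1 * y ord0 j - u j y) * du i j y =
    (1 + a)^-1 * \sum_j y ord0 j * du i j y - N i y.
  by rewrite mulr_sumr -sumrB; apply: eq_bigr => j _; rewrite mulrBl mulrA.
by rewrite H; ring.
Qed.

Lemma far_advection i (t : R) (y : E) : 0 < t -> r < `|y| -> r < `|t *: y| ->
  N i (t *: y) = t `^ (- b) * t `^ (- b - 1) * N i y.
Proof.
move=> t0 ry rty; rewrite /N mulr_sumr; apply: eq_bigr => j _.
rewrite hu// (homogeneous_partial j (profile_C1 cp i) (hu i) t0 ry rty).
by rewrite mulrACA.
Qed.

(* [u i] and [N i] have degrees [- b] and [- 2 b - 1], which differ as [b > -1]: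
   comparing [Q] with its dilation by [2] cancels [N] and exhibits a multiple of [u]
   as a gradient near infinity. *)
Lemma far_vort_zero : a != b -> -1 < b -> forall i j (y : E), r < `|y| -> vort du i j y = 0.
Proof.
move=> ab b1.
pose L : R := 2 `^ (- b); pose m : R := 2 `^ (- b - 1).
have L0 : 0 < L by exact: powR_gt0.
have m0 : 0 < m by exact: powR_gt0.
have m1 : m < 1.
  have h : (1 : R) `^ (b + 1) < 2 `^ (b + 1).
    by apply: gt0_ltr_powR; rewrite ?nnegrE ?ltr1n//; lra.
  by rewrite powR1 in h; rewrite /m -opprD powRN invf_lt1// (lt_trans ltr01 h).
(* [L * m] is the factor by which the advection scales under dilation by 2, and [2^-1] undoes the
   factor from differentiating the dilation: the advections cancel in the gradient, and [u] remains
   with the coefficient [ka]. *)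
pose P (y : E) : R := (L * m)^-1 * (2^-1 * Q (2 *: y)) - Q y.
have CQ : C1 Q F := profile_eq cp.
have CP := C1_sub (C1_scale (L * m)^-1 (C1_scale 2^-1 (C1_dilation 2 CQ))) CQ.
pose ka := (a - b) / (1 + a) * (m^-1 - 1).
have a10 : 0 < 1 + a by rewrite -ltrBlDl sub0r.
have ka0 : ka != 0.
  apply: mulf_neq0; last by rewrite subr_eq0 invr_eq1 lt_eqF.
  by apply: mulf_neq0; rewrite ?subr_eq0// invr_eq0 gt_eqF.
have dP i y : r < `|y| -> is_derive y 'e_i P (ka * u i y).
  move=> ry; have := has_gradient_partial i y CP.1.
  have r2y : r < `|2 *: y|.
    rewrite normrZ gtr0_norm//; have := normr_ge0 y; lra.
  congr (is_derive _ _ _ _).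
  rewrite -/(F i _) -/(F i y) !far_force// far_advection// hu// -/L -/m /ka.
  rewrite [2^-1 * _]mulrA mulVf ?pnatr_eq0// mul1r.
  move: (u i y) (N i y) ((a - b) / (1 + a)) => x1 x2 x3.
  by field; rewrite !gt_eqF.
move=> i j y ry.
have rr : 0 < `|y| - r by rewrite subr_gt0.
have out x : `|x - y| < `|y| - r -> r < `|x|.
  by have := ler_normB x (x - y); rewrite opprB addrCA subrr addr0; lra.
have Cu l := profile_C1 cp l.
have du' l k x : is_derive x 'e_k (fun z => ka * u l z) (ka * du l k x).
  exact: (has_gradient_partial k x (C1_scale ka (Cu l)).1).
have H : ka * du i j y = ka * du j i y.
  apply: (@schwarz_derive R _ P (fun z => ka * u i z) (fun z => ka * u j z)
    (fun z => ka * du i j z) (fun z => ka * du j i z) y 'e_i 'e_j _ rr).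
  - by move=> x /out; exact: dP.
  - by move=> x /out; exact: dP.
  - exact: (C1_scale ka (Cu i)).2.
  - exact: (C1_scale ka (Cu j)).2.
by apply/eqP; rewrite /vort subr_eq0 eq_sym; apply/eqP; exact: (mulfI ka0).
Qed.

Lemma profile_constant : (0 < n)%N -> -1 < b ->
  (forall i j (y : E), r < `|y| -> vort du i j y = 0) -> forall i y, u i y = u i 0.
Proof.
move=> n0 b1 farv.
have v0 := vort_zero n0 a1 (ltW r0) cp farv.
have Cu l := profile_C1 cp l.
have dec d : 0 < d -> exists s : R, forall i j (y : E), s < `|y| -> `|du i j y| <= d.
  move=> d0.
  have /choice[s sP] (p : 'I_n * 'I_n) : exists s : R,
      forall y : E, s < `|y| -> `|du p.1 p.2 y| <= d.
    have hd := homogeneous_partial p.2 (Cu p.1) (hu p.1).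
    have [A A0 HA] := homogeneous_bound (ltW r0) ((Cu p.1).2 p.2) hd.
    have [|s s0 Hs] := @powR_decay A (- b - 1) d A0 _ d0; first by lra.
    exists (Num.max s (r + 1)) => y; rewrite gt_max => /andP[sy ry].
    exact: (le_trans (HA y (ltW ry)) (Hs _ sy)).
  exists (\sum_p `|s p|) => i j y sy; apply: (sP (i, j)); apply: le_lt_trans sy.
  by rewrite (bigD1 (i, j))//= (le_trans (ler_norm _))// lerDl sumr_ge0.
have du0 := irrotational_zero n0 Cu (profile_div cp) v0 dec.
move=> i y; have [t _] := gradient_MVT 0 y (Cu i).1.
rewrite add0r big1 => [/eqP|j _]; first by rewrite subr_eq0 => /eqP.
by rewrite du0 mulr0.
Qed.

Lemma constant_homogeneous i : (0 < n)%N -> b != 0 -> (forall y, u i y = u i 0) -> u i 0 = 0.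
Proof.
move=> n0 b0 uc.
pose y : E := (r + 1) *: 'e_(Ordinal n0).
have ny : r < `|y|.
  apply: lt_le_trans (coord_le_norm y (Ordinal n0)).
  by rewrite !mxE !eqxx mulr1 ger0_norm ?addr_ge0 ?(ltW r0)// ltrDl.
have := hu i (ltr0Sn _ 1) ny; rewrite !uc => H.
have : u i 0 = 2 `^ (- b) * u i 0.
  apply: H; rewrite normrZ gtr0_norm//; have := normr_ge0 y; lra.
move=> /eqP; rewrite -subr_eq0 -{1}[u i 0]mul1r -mulrBl mulf_eq0 => /orP[|/eqP//].
rewrite subr_eq0 => /eqP H2; exfalso.
have : ln (2 `^ (- b)) = (0 : R) by rewrite -H2 ln1.
rewrite ln_powR => /eqP; rewrite mulf_eq0 oppr_eq0 (negbTE b0) /=.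
by rewrite gt_eqF// ln_gt0// ltr1n.
Qed.

End far_field.

(** * The critical exponent *)

Section cutoff.
Context {R : realType}.
Implicit Types s t : R.

(** The truncated square, a C1 building block whose derivative is a continuous maximum. *)
Definition sqpos t : R := Num.max t 0 ^+ 2.

Lemma is_derive_sqpos t : is_derive t 1 sqpos (2 * Num.max t 0).
Proof.
have [t0|t0|->] := ltgtP t 0.
- rewrite mulr0.
  apply: (@near_eq_is_derive _ _ _ (cst (0 : R))).
  have H : \forall x \near t, x < 0 by exact: lt_nbhsl.
  by move: H; apply: filterS => x x0; rewrite /sqpos max_r ?ltW// expr0n.
- apply: (@near_eq_is_derive _ _ _ (fun x : R => x * x)).
    have H : \forall x \near t, 0 < x by exact: lt_nbhsr.
    by move: H; apply: filterS => x x0; rewrite /sqpos max_l ?ltW.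
  apply: (is_derive_eq (is_deriveM (is_derive_id _ _) (is_derive_id _ _))).
  by rewrite /GRing.scale /= mulr1 mulr_natl mulr2n.
- rewrite mulr0.
  have H : h^-1 *: ((sqpos \o shift 0) (h *: (1 : R)) - sqpos 0) @[h --> 0^'] --> (0 : R).
    apply/cvgrPdist_le => e e0; near=> h.
    have h0 : h != 0 by near: h; exact: nbhs_dnbhs_neq.
    have he : `|h| < e by near: h; exact: dnbhs0_lt.
    rewrite /= /shift /= addr0 -[h *: 1]/(h * 1) mulr1 {2}/sqpos maxxx expr0n subr0 sub0r normrN.
    rewrite -[_ *: _]/(_ * _) /sqpos normrM normfV.
    rewrite ler_pdivrMl ?normr_gt0// ger0_norm ?sqr_ge0//.
    have [hp|hn] := leP 0 h; first by move: he; rewrite ger0_norm// expr2 => he; nra.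
    by rewrite expr0n mulr_ge0// ltW.
  by split; [exact: (cvgP _ H)|exact: cvg_lim].
Unshelve. all: end_near. Qed.

Lemma max0_continuous : continuous (fun t : R => Num.max t 0).
Proof.
move=> t; apply/cvgrPdist_lt => e e0; near=> s.
have : `|t - s| < e by near: s; apply/nbhs_normP; exists e.
rewrite !ltr_norml => /andP[h1 h2].
by case: (leP t 0) => ?; case: (leP s 0) => ?; apply/andP; split; lra.
Unshelve. all: end_near. Qed.

Lemma sqpos_continuous : continuous sqpos.
Proof.
by move=> t; apply/differentiable_continuous/derivable1_diffP; have [] := is_derive_sqpos t.
Qed.

(* A [C1] cutoff: [1] for [s <= 1] and [0] for [s >= 2]. *)
Definition cutoff s : R := sqpos (1 - sqpos (s - 1)).

(** Minus the derivative of [cutoff]: nonnegative, and zero outside the transition interval from 1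
    to 2. *)
Definition cutoff_slope s : R := 4 * Num.max (1 - sqpos (s - 1)) 0 * Num.max (s - 1) 0.

Lemma is_derive_cutoff s : is_derive s 1 cutoff (- cutoff_slope s).
Proof.
have d1 : is_derive s 1 (fun t : R => t - 1) 1.
  by apply: (is_derive_eq (is_deriveB (is_derive_id _ _) (is_derive_cst (1 : R) _ _))); rewrite subr0.
have d2 := @is_derive1_comp _ sqpos (fun t : R => t - 1) s _ _ (is_derive_sqpos (s - 1)) d1.
have d3 : is_derive s 1 (fun t : R => 1 - sqpos (t - 1)) (0 - (2 * Num.max (s - 1) 0 * 1)).
  exact: (is_deriveB (is_derive_cst (1 : R) _ _) d2).
have := @is_derive1_comp _ sqpos (fun t : R => 1 - sqpos (t - 1)) s _ _ (is_derive_sqpos _) d3.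
congr (is_derive _ _ _ _); rewrite /cutoff_slope; ring.
Qed.

Lemma cutoff_slope_continuous : continuous cutoff_slope.
Proof.
have c1 : continuous (fun s : R => s - 1).
  by move=> s; apply: cvgB; [exact: cvg_id|exact: cvg_cst].
have c2 : continuous (fun s : R => 1 - sqpos (s - 1)).
  move=> s; apply: cvgB; first exact: cvg_cst.
  by apply: (@continuous_comp _ _ _ (fun t : R => t - 1)); [exact: c1|exact: sqpos_continuous].
have c3 : continuous (fun s : R => Num.max (s - 1) 0).
  by move=> s; apply: (@continuous_comp _ _ _ (fun t : R => t - 1) (fun t => Num.max t 0));
    [exact: c1|exact: max0_continuous].
have c4 : continuous (fun s : R => Num.max (1 - sqpos (s - 1)) 0).
  by move=> s; apply: (@continuous_comp _ _ _ (fun t : R => 1 - sqpos (t - 1)) (fun t => Num.max t 0));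
    [exact: c2|exact: max0_continuous].
by move=> s; apply: cvgM; [apply: cvgM; [exact: cvg_cst|exact: c4]|exact: c3].
Qed.

Lemma cutoff_slope_ge0 s : 0 <= cutoff_slope s.
Proof. by rewrite /cutoff_slope !mulr_ge0// le_max lexx orbT. Qed.

Lemma cutoff_slope_eq0 s : s <= 1 -> cutoff_slope s = 0.
Proof. by move=> s1; rewrite /cutoff_slope [Num.max (s - 1) 0]max_r ?mulr0// subr_le0. Qed.

Lemma sqpos_ge1 s : 2 <= s -> 1 <= sqpos (s - 1).
Proof.
move=> s2; rewrite /sqpos max_l; last by lra.
by rewrite expr2; nra.
Qed.

Lemma cutoff_eq0 s : 2 <= s -> cutoff s = 0.
Proof.
by move=> /sqpos_ge1 s2; rewrite /cutoff {1}/sqpos max_r ?expr0n// subr_le0.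
Qed.

Lemma cutoff_slope_eq0_ge s : 2 <= s -> cutoff_slope s = 0.
Proof.
by move=> /sqpos_ge1 s2; rewrite /cutoff_slope [X in 4 * X]max_r ?mulr0 ?mul0r// subr_le0.
Qed.

Lemma cutoff_slope_gt0 : 0 < cutoff_slope (3 / 2).
Proof.
rewrite /cutoff_slope /sqpos.
have -> : Num.max (3 / 2 - 1) 0 = 2^-1 :> R by rewrite max_l; lra.
rewrite max_l; last by rewrite expr2; lra.
by rewrite expr2; lra.
Qed.

End cutoff.

Section exterior.
Context {R : realType} {n : nat}.
Local Notation E := 'rV[R]_n.

(* Two segments, along each of which some coordinate is constant and exceeds [r] in
   absolute value, join any point to [(r + 1, ..., r + 1)]. *)
Lemma zero_gradient_outside (f : E -> R) df (r : R) : (1 < n)%N -> 0 < r ->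
  has_gradient f df -> (forall i y, r < `|y| -> df i y = 0) ->
  exists c, forall y, r < `|y| -> f y = c.
Proof.
move=> n1 r0 fP df0; pose m := r + 1.
have seg (x z : E) (k : 'I_n) : x ord0 k = z ord0 k -> r < `|x ord0 k| -> f x = f z.
  move=> xz rx; have [t _] := gradient_MVT x (z - x) fP.
  rewrite [x + _]addrC subrK big1 => [/eqP|i _].
    by rewrite subr_eq0 eq_sym => /eqP.
  rewrite df0 ?mulr0//; apply: lt_le_trans (coord_le_norm _ k).
  by rewrite !mxE xz subrr mulr0 addr0 -xz.
exists (f (\row_j m)) => y ry.
have [k yk] : exists k, r < `|y ord0 k|.
  apply: contrapT => /forallNP H; move: ry; apply/negP; rewrite -leNgt.
  by apply: norm_le_coord => [|i]; [exact: ltW|rewrite leNgt; exact/negP].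
(* The first segment keeps coordinate [k], the second coordinate [j]. In dimension 1 the exterior is
   disconnected and no such [j] exists. *)
have [j jk] : exists j : 'I_n, j != k.
  have [k0|k0] := eqVneq k (Ordinal (ltnW n1)); last by exists (Ordinal (ltnW n1)); rewrite eq_sym.
  by exists (Ordinal n1); rewrite k0.
pose p : E := \row_j (if j == k then y ord0 k else m).
rewrite (seg y p k) ?mxE ?eqxx//.
rewrite (seg p (\row_j m) j) ?mxE ?(negbTE jk)//.
by rewrite ger0_norm ?addr_ge0 ?ltW// ltrDl.
Qed.

End exterior.

(** * The energy conservation law at the critical exponent *)

Section energy.
Context {R : realType} {n : nat}.
Local Notation E := 'rV[R]_n.
Local Notation mu := (@lebesgue_rV R n).
Local Notation "''e_' i" := (delta_mx ord0 i : E) (at level 8, i at level 2).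

Definition energy (u : 'I_n -> E -> R) (y : E) : R := \sum_i 2^-1 * (u i y * u i y).

Definition sqnorm (y : E) : R := \sum_k y ord0 k * y ord0 k.

Lemma C1_sqnorm : C1 sqnorm (fun k y => 2 * y ord0 k).
Proof.
have := C1_sum (index_enum 'I_n) (fun k => C1_mul (C1_coord (R := R) k) (C1_coord k)).
congr C1; apply/funext => k; apply/funext => y.
rewrite (bigD1 k)//= eqxx mulr1 big1 ?addr0 => [|i ik]; first by rewrite mulr_natl mulr2n.
by rewrite (negbTE ik) mulr0 addr0.
Qed.

(* The energy flux is divergence free because [a = n / 2]. *)
Lemma energy_flux (a q : R) u du Q (eta : E -> R) deta :
  -1 < a -> a = n%:R / 2 -> classical_profile a u du Q ->
  C1 eta deta -> bounded_support eta ->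
  \int[mu]_y (\sum_k ((1 + a)^-1 * y ord0 k * energy u y -
    u k y * (energy u y + (Q y - q))) * deta k y) = 0.
Proof.
move=> a1 an [Cu div CQ] Ce se.
pose c : R := (1 + a)^-1.
have a10 : 1 + a != 0 by rewrite gt_eqF// -ltrBlDl sub0r.
pose F i (y : E) : R := \sum_j (c * y ord0 j - u j y) * du i j y + a / (1 + a) * u i y.
pose dEn k y : R := \sum_i 2^-1 * (u i y * du i k y + u i y * du i k y).
have CE : C1 (energy u) dEn.
  exact: (C1_sum (index_enum 'I_n) (fun i => C1_scale 2^-1 (C1_mul (Cu i) (Cu i)))).
pose K k (y : E) : R := c * y ord0 k * energy u y - u k y * (energy u y + (Q y - q)).
have CK k := C1_sub (C1_mul (C1_scale c (C1_coord k)) CE)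
  (C1_mul (Cu k) (C1_add CE (C1_sub CQ (C1_cst q)))).
pose dK k l (y : E) : R := (c * y ord0 k * dEn l y + energy u y * (c * (k == l)%:R)) -
  (u k y * (dEn l y + (F l y - 0)) + (energy u y + (Q y - q)) * du k l y).
have {}CK k : C1 (K k) (dK k) by exact: CK.
(* The constant [q] and the pressure multiply the divergence of [u], which is 0. What is left
   balances since [a / (1 + a) |u|^2] equals [n / (1 + a)] times the energy. *)
have divK y : \sum_k dK k k y = 0.
  pose w j : R := c * y ord0 j - u j y.
  have E1 : \sum_k dK k k y = \sum_k w k * dEn k y + n%:R * c * energy u y - \sum_k u k y * F k y.
    transitivity (\sum_k (w k * dEn k y + c * energy u y - u k y * F k y -
        (energy u y + (Q y - q)) * du k k y)).
      by apply: eq_bigr => k _; rewrite /dK /w eqxx mulr1; ring.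
    rewrite !sumrB big_split /= -[\sum_k (energy u y + (Q y - q)) * du k k y]mulr_sumr div mulr0 subr0.
    congr (_ + _ - _); rewrite sumr_const card_ord -mulrA [RHS]mulr_natl; ring.
  have E2 : \sum_k u k y * F k y = \sum_k w k * dEn k y + n%:R * c * energy u y.
    transitivity (\sum_k (\sum_j u k y * (w j * du k j y) + n%:R * c * (2^-1 * (u k y * u k y)))).
      apply: eq_bigr => k _; rewrite /F mulrDr mulr_sumr; congr (_ + _).
      by rewrite {1}an /c; field.
    rewrite big_split /= -[\sum_k n%:R * c * _]mulr_sumr exchange_big /=; congr (_ + _).
    apply: eq_bigr => j _; rewrite /dEn mulr_sumr; apply: eq_bigr => k _.
    by move: (u k y) (w j) (du k j y) => x1 x2 x3; field.
  by rewrite E1 E2 subrr.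
pose g k y : R := K k y * eta y.
have Cg k := C1_mul (CK k) Ce.
pose dg k y : R := K k y * deta k y + eta y * dK k k y.
have [M eM] := se.
have sg k : bounded_support (g k) by exists M => y My; rewrite /g eM ?mulr0.
have cg k : continuous (g k) := C1_continuous (Cg k).
have cdg k : continuous (dg k) := (Cg k).2 k.
have gP k y : is_derive y 'e_k (g k) (dg k y) := has_gradient_partial k y (Cg k).1.
have i0 k : \int[mu]_y dg k y = 0.
  by rewrite /Rintegral (integral_derive0 (cg k) (cdg k) (sg k) (gP k)).
have ii k := continuous_integrable (cdg k) (bounded_support_is_derive (sg k) (gP k)).
have [_ H] := Rintegral_sum (index_enum 'I_n) ii.
rewrite big1 in H; last by move=> k _; exact: i0.
rewrite -[RHS]H; apply: eq_Rintegral => y _.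
by rewrite /dg big_split /= -[X in _ = _ + X]mulr_sumr divK mulr0 addr0.
Qed.

End energy.

Section critical.
Context {R : realType} {n : nat}.
Local Notation E := 'rV[R]_n.
Local Notation mu := (@lebesgue_rV R n).

Lemma sqnorm_ge (y : E) : `|y| ^+ 2 <= sqnorm y.
Proof.
have -> : sqnorm y = enorm y ^+ 2.
  rewrite sqr_sqrtr; first by apply: eq_bigr => i _; rewrite expr2.
  by apply: sumr_ge0 => i _; rewrite sqr_ge0.
by rewrite lerXn2r ?nnegrE ?sqrtr_ge0// norm_le_enorm.
Qed.

Lemma sqnorm_le (y : E) : sqnorm y <= n%:R * `|y| ^+ 2.
Proof.
apply: (@le_trans _ _ (\sum_(i < n) `|y| ^+ 2)).
  apply: ler_sum => i _; rewrite -expr2 -real_normK ?num_real//.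
  by rewrite lerXn2r ?nnegrE// coord_le_norm.
by rewrite sumr_const card_ord -[leLHS]mulr_natl.
Qed.

Lemma sqnormZ (t : R) (y : E) : sqnorm (t *: y) = t ^+ 2 * sqnorm y.
Proof. by rewrite mulr_sumr; apply: eq_bigr => i _; rewrite !mxE expr2; ring. Qed.

Lemma sqnorm_ge0 (y : E) : 0 <= sqnorm y.
Proof. by apply: sumr_ge0 => i _; rewrite -expr2 sqr_ge0. Qed.

Lemma energy_ge0 (u : 'I_n -> E -> R) y : 0 <= energy u y.
Proof. by apply: sumr_ge0 => i _; rewrite mulr_ge0 ?invr_ge0// -expr2 sqr_ge0. Qed.

(* Here [grad Q] has degree [- n - 1] near infinity. *)
Lemma critical_pressure (a r : R) u du Q : (1 < n)%N -> -1 < a -> a = n%:R / 2 -> 0 < r ->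
  classical_profile a u du Q -> (forall i, homogeneous_outside r (- a) (u i)) ->
  forall t : R, 1 <= t -> exists c, forall y : E, r < `|y| ->
    Q (t *: y) = (t ^+ n)^-1 * (Q y + c).
Proof.
move=> n1 a1 an r0 cp hu t t1.
have t0 : 0 < t by exact: lt_le_trans ltr01 t1.
have tn : 0 < t ^+ n by rewrite exprn_gt0.
pose F i (y : E) : R := \sum_j ((1 + a)^-1 * y ord0 j - u j y) * du i j y + a / (1 + a) * u i y.
have CQ : C1 Q F := profile_eq cp.
have CH := C1_sub (C1_scale (t ^+ n) (C1_dilation t CQ)) CQ.
have rt (y : E) : r < `|y| -> r < `|t *: y|.
  by move=> ry; rewrite normrZ gtr0_norm// (lt_le_trans ry)// ler_peMl.
have LL : t ^+ n * (t * (t `^ (- a) * t `^ (- a - 1))) = 1.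
  have pD s1 s2 : t `^ s1 * t `^ s2 = t `^ (s1 + s2).
    by rewrite powRD//; apply/implyP => _; rewrite gt_eqF.
  rewrite pD -[X in X * t `^ _](powRr1 (ltW t0)) pD.
  have -> : 1 + (- a + (- a - 1)) = - n%:R by rewrite an; field.
  by rewrite powRN (powR_mulrn _ (ltW t0)) divff// gt_eqF.
have key (S P : R) : t ^+ n * (t * P) = 1 -> t ^+ n * (t * - (P * S)) + S = 0.
  by move=> h; rewrite !mulrN !mulrA -[t ^+ n * t * P]mulrA h mul1r addNr.
(* With [b = a] the linear part of the force disappears, and the remaining advection has degree
   [- 2 a - 1 = - n - 1]. Hence [t ^+ n * Q (t *: y) - Q y] has zero gradient outside the ball. *)
have [|c cP] := zero_gradient_outside n1 r0 CH.1.
  move=> i y ry.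
  have -> : F i (t *: y) = - (t `^ (- a) * t `^ (- a - 1) * \sum_j u j y * du i j y).
    rewrite /F (far_force cp r0 hu i (rt y ry)) subrr !mul0r sub0r.
    by rewrite (far_advection cp hu i t0 ry (rt y ry)).
  rewrite /F (far_force cp r0 hu i ry) subrr !mul0r sub0r opprK.
  exact: key LL.
by exists c => y ry; rewrite -(cP y ry) addrC subrK mulrA mulVf ?mul1r// gt_eqF.
Qed.

(* Test the flux identity against cutoffs at scale [t]: by homogeneity the integral of
   [f1] does not depend on [t], while that of [f2] is [O(1 / t)]. *)
Lemma critical_far_zero (a r : R) u du Q : (1 < n)%N -> -1 < a -> a = n%:R / 2 -> 0 < r ->
  classical_profile a u du Q -> (forall i, homogeneous_outside r (- a) (u i)) ->
  forall i (y : E), r < `|y| -> u i y = 0.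
Proof.
move=> n1 a1 an r0 cp hu p y0 ry0; apply/eqP/negPn/negP => uy0.
have Cu := profile_C1 cp; have cu i := C1_continuous (Cu i).
have cQ : continuous Q := C1_continuous (profile_eq cp).
have n0 : 0 < (n%:R : R) by rewrite ltr0n ltnW.
have n2 : 2 <= (n%:R : R) by rewrite ler_nat.
have a0 : 0 < a by rewrite an divr_gt0.
have c0 : 0 < (1 + a)^-1 by rewrite invr_gt0 addr_gt0.
pose c : R := (1 + a)^-1.
have cS : continuous (@sqnorm R n) := C1_continuous C1_sqnorm.
have cE : continuous (energy u).
  by apply: continuous_sum => i; apply: continuous_mul; [exact: cst_continuous|exact: continuous_mul].
(* The reference point [y0] is pushed out to [y1] so that the transition layer of a cutoff through
   [y1] misses the ball of radius [r]. Comparing the sup and Euclidean norms costs a factor [n], so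
   this requires [3 / 2 * n <= tau ^+ 2]. *)
pose tau : R := 3 * n%:R / 2.
have tau1 : 1 <= tau by rewrite /tau; lra.
have tau0 : 0 < tau by exact: lt_le_trans ltr01 tau1.
pose y1 := tau *: y0.
have ry1 : r < `|y1|.
  by rewrite normrZ gtr0_norm// (lt_le_trans ry0)// ler_peMl.
have E1 : 0 < energy u y1.
  rewrite /energy (bigD1 p)//=.
  apply: ltr_wpDr; first by apply: sumr_ge0 => i _; rewrite mulr_ge0 ?invr_ge0// -expr2 sqr_ge0.
  rewrite mulr_gt0 ?invr_gt0// -expr2 lt_def sqr_ge0 andbT sqrf_eq0.
  by rewrite hu// mulf_neq0// gt_eqF// powR_gt0.
have S0 : 0 < sqnorm y0.
  by apply: lt_le_trans (sqnorm_ge y0); rewrite exprn_gt0// (lt_trans r0).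
have S1 : 0 < sqnorm y1 by rewrite sqnormZ mulr_gt0// exprn_gt0.
(* Puts [y1] at parameter [3 / 2], in the middle of the transition layer, where the slope is
   positive. *)
pose k0 : R := 3 / 2 / sqnorm y1.
have k00 : 0 < k0 by rewrite !divr_gt0.
pose X (x : E) : R := cutoff_slope (k0 * sqnorm x).
have cX : continuous X.
  have ck : continuous (fun x : E => k0 * sqnorm x).
    by apply: continuous_mul => //; exact: cst_continuous.
  by move=> x; apply: (@continuous_comp _ _ _ (fun x : E => k0 * sqnorm x));
    [exact: ck|exact: cutoff_slope_continuous].
have X0 (x : E) : 0 <= X x by exact: cutoff_slope_ge0.
have Xin (x : E) : `|x| <= r -> X x = 0.
  move=> xr; apply: cutoff_slope_eq0.
  rewrite /k0 mulrAC ler_pdivrMr// mul1r.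
  have h1 := sqnorm_le x.
  have h2 : `|x| ^+ 2 <= `|y0| ^+ 2 by rewrite lerXn2r ?nnegrE// (le_trans xr)// ltW.
  have h3 := sqnorm_ge y0.
  rewrite sqnormZ.
  apply: (@le_trans _ _ (3 / 2 * (n%:R * sqnorm y0))).
    rewrite ler_pM2l ?divr_gt0// (le_trans h1)// ler_pM2l//.
    exact: le_trans h2 h3.
  rewrite mulrA ler_pM2r// expr2 /tau; nra.
pose M0 : R := 2 / k0 + 1.
have M01 : 1 <= M0 by rewrite /M0 lerDr divr_ge0// ltW.
have M00 : 0 <= M0 by exact: le_trans ler01 M01.
have far2 (x : E) : M0 < `|x| -> 2 <= k0 * sqnorm x.
  move=> Mx; have h := sqnorm_ge x.
  have x1 : 1 <= `|x| by rewrite (le_trans M01)// ltW.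
  have h2 : `|x| <= `|x| ^+ 2 by rewrite expr2 ler_peMl.
  rewrite mulrC -ler_pdivrMr//; move: Mx h h2; rewrite /M0; lra.
have Xout (x : E) : M0 < `|x| -> X x = 0.
  by move=> /far2; exact: cutoff_slope_eq0_ge.
pose ux (x : E) : R := \sum_k u k x * x ord0 k.
have cux : continuous ux.
  by apply: continuous_sum => k; apply: continuous_mul; [exact: cu|exact: (C1_continuous (C1_coord k))].
(* [psi] and [phi] are the two fluxes at scale 1; those at scale [t], called [f1] and [f2] below,
   are their rescalings. *)
pose psi x : R := 2 * k0 * X x * (c * energy u x * sqnorm x).
pose phi x : R := 2 * k0 * X x * (ux x * (energy u x + Q x)).
have c2X : continuous (fun x => 2 * k0 * X x).
  by apply: continuous_mul => //; exact: cst_continuous.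
have cpsi : continuous psi.
  apply: continuous_mul => //; apply: continuous_mul => //.
  by apply: continuous_mul => //; exact: cst_continuous.
have cphi : continuous phi.
  apply: continuous_mul => //; apply: continuous_mul => //.
  exact: continuous_add.
have psi1 : 0 < psi y1.
  rewrite /psi /X /k0 divfK ?gt_eqF// mulr_gt0//; last by rewrite !mulr_gt0.
  by rewrite mulr_gt0 ?cutoff_slope_gt0// mulr_gt0// !divr_gt0.
pose psi0 := psi y1 / 2.
have psi00 : 0 < psi0 by rewrite divr_gt0.
have [d d0 dP] := continuous_unif `|y1| cpsi psi00.
pose rho := Num.min (d / 2) ((`|y1| - r) / 2).
have rho0 : 0 < rho by rewrite lt_min !divr_gt0// subr_gt0.
have near1 (x : E) : `|y1 - x| <= rho -> psi0 <= psi x /\ r < `|x|.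
  rewrite /rho le_min => /andP[h1 h2]; split.
    have := dP y1 x (lexx _); rewrite ltr_norml => /(_ _)/andP[|_].
      by rewrite (le_lt_trans h1)// ltr_pdivrMr// ltr_pMr// ltr1n.
    by rewrite /psi0; lra.
  have := ler_normD (y1 - x) x; rewrite subrK; move: h2; lra.
have [C4 C40 phiC] := continuous_bounded_on_ball M0 cphi.
have main (t : R) : 1 <= t -> psi0 * (2 * rho) ^+ n <= C4 * (2 * M0) ^+ n / t.
  move=> t1.
  have t0 : 0 < t by exact: lt_le_trans ltr01 t1.
  have tne : t != 0 by rewrite gt_eqF.
  have [cl clP] := critical_pressure n1 a1 an r0 cp hu t1.
  pose La : R := (t ^+ n)^-1.
  have La0 : 0 < La by rewrite invr_gt0 exprn_gt0.
  (* The constant for which [Q (t *: x) - q = La * Q x] outside the ball, so that the shifted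
     pressure scales like the energy. *)
  pose q := La * cl.
  pose k1 := k0 / t ^+ 2.
  have k10 : 0 < k1 by rewrite divr_gt0// exprn_gt0.
  pose eta (y : E) : R := cutoff (k1 * sqnorm y).
  pose deta k (y : E) : R := - cutoff_slope (k1 * sqnorm y) * (k1 * (2 * y ord0 k)).
  have cns : continuous (fun s : R => - cutoff_slope s).
    by move=> s; apply: cvgN; exact: cutoff_slope_continuous.
  have Ce : C1 eta deta.
    apply: (@C1_comp _ _ cutoff (fun s => - cutoff_slope s)).
    - by move=> x; exact: is_derive_cutoff.
    - by move=> x; exact: cns.
    - exact: (C1_scale k1 C1_sqnorm).
  have scale (y : E) : y = t *: (t^-1 *: y) by rewrite scalerA divff// scale1r.
  have nscale (y : E) : `|t^-1 *: y| = `|y| / t by rewrite normrZ gtr0_norm ?invr_gt0// mulrC.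
  have k1S (x : E) : k1 * sqnorm (t *: x) = k0 * sqnorm x.
    by rewrite sqnormZ /k1; field.
  have se : bounded_support eta.
    exists (t * M0) => y My; rewrite /eta [y in sqnorm y]scale k1S cutoff_eq0//.
    by apply: far2; rewrite nscale ltr_pdivlMr// mulrC.
  have flux := energy_flux q a1 an cp Ce se.
  pose Xt (y : E) : R := 2 * k1 * cutoff_slope (k1 * sqnorm y).
  pose f1 y : R := Xt y * (c * energy u y * sqnorm y).
  pose f2 y : R := Xt y * (ux y * (energy u y + (Q y - q))).
  have flE (y : E) : \sum_k ((1 + a)^-1 * y ord0 k * energy u y -
      u k y * (energy u y + (Q y - q))) * deta k y = f2 y - f1 y.
    rewrite /f1 /f2; set e := energy u y; set z := Xt y.
    have -> : z * (c * e * sqnorm y) = \sum_k z * (c * e * (y ord0 k * y ord0 k)).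
      by rewrite !mulr_sumr.
    have -> : z * (ux y * (e + (Q y - q))) =
        \sum_k z * (u k y * y ord0 k * (e + (Q y - q))).
      by rewrite mulr_suml mulr_sumr.
    by rewrite -sumrB; apply: eq_bigr => k _; rewrite /deta /z /Xt /c; ring.
  have cXt : continuous Xt.
    apply: continuous_mul; first exact: cst_continuous.
    have ck : continuous (fun x : E => k1 * sqnorm x).
      by apply: continuous_mul => //; exact: cst_continuous.
    by move=> x; apply: (@continuous_comp _ _ _ (fun x : E => k1 * sqnorm x));
      [exact: ck|exact: cutoff_slope_continuous].
  have Xtscale (x : E) : Xt (t *: x) = 2 * k1 * X x by rewrite /Xt k1S.
  have Xtout (y : E) : t * M0 < `|y| -> Xt y = 0.
    move=> My; rewrite [y]scale Xtscale Xout ?mulr0//.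
    by rewrite nscale ltr_pdivlMr// mulrC.
  have cf1 : continuous f1.
    apply: continuous_mul => //; apply: continuous_mul => //.
    by apply: continuous_mul => //; exact: cst_continuous.
  have cf2 : continuous f2.
    apply: continuous_mul => //; apply: continuous_mul => //.
    apply: continuous_add => //; apply: continuous_sub => //; exact: cst_continuous.
  have sf1 : bounded_support f1 by exists (t * M0) => y My; rewrite /f1 Xtout ?mul0r.
  have sf2 : bounded_support f2 by exists (t * M0) => y My; rewrite /f2 Xtout ?mul0r.
  have i1 := continuous_integrable cf1 sf1; have i2 := continuous_integrable cf2 sf2.
  have f12 : \int[mu]_y f1 y = \int[mu]_y f2 y.
    have := flux; under eq_Rintegral do rewrite flE.
    by rewrite RintegralB// => /eqP; rewrite subr_eq0 => /eqP.
  pose L : R := t `^ (- a).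
  have LL : L * L = La.
    rewrite /L /La -powRD; last by apply/implyP => _.
    have -> : - a + - a = - n%:R by rewrite an; field.
    by rewrite powRN (powR_mulrn _ (ltW t0)).
  have L0 : 0 <= L by exact: powR_ge0.
  have L1 : L <= 1.
    by rewrite -(powRr0 t) /L; apply: ler_powR => //; lra.
  have rt (x : E) : r < `|x| -> r < `|t *: x|.
    by move=> rx; rewrite normrZ gtr0_norm// (lt_le_trans rx)// ler_peMl.
  have Escale (x : E) : r < `|x| -> energy u (t *: x) = La * energy u x.
    move=> rx; rewrite /energy mulr_sumr; apply: eq_bigr => i _.
    by rewrite hu ?rt// -/L -LL; ring.
  have uxscale (x : E) : r < `|x| -> ux (t *: x) = L * t * ux x.
    move=> rx; rewrite /ux mulr_sumr; apply: eq_bigr => i _.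
    by rewrite hu ?rt// -/L mxE; ring.
  have f1scale (x : E) : r < `|x| -> f1 (t *: x) = La * psi x.
    move=> rx; rewrite /f1 Xtscale Escale// sqnormZ /psi /k1.
    by move: (X x) (energy u x) (sqnorm x) => z1 z2 z3; field.
  have f2scale (x : E) : f2 (t *: x) = La * L / t * phi x.
    have [xr|rx] := leP `|x| r; first by rewrite /f2 /phi Xtscale Xin// !mulr0 !mul0r mulr0.
    rewrite /f2 Xtscale Escale// uxscale// clP// /phi /k1 /q -/La.
    by move: (X x) (energy u x) (ux x) (Q x) => z1 z2 z3 z4; field.
  (* In place of a change of variables, both integrals are compared with volumes of balls enlarged
     by [t]: the factor [t ^+ n] cancels [La]. The second flux retains [L / t], of which [L <= 1] is
     discarded. *)
  have low : La * psi0 * (2 * (t * rho)) ^+ n <= \int[mu]_y f1 y.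
    apply: (@Rintegral_ge_ball _ _ _ (t *: y1)) => //.
    - by rewrite mulr_ge0// ltW.
    - move=> y yy; have yx : `|y1 - t^-1 *: y| <= rho.
        have -> : y1 - t^-1 *: y = t^-1 *: (t *: y1 - y).
          by rewrite scalerBr scalerA mulVf// scale1r.
        by rewrite nscale ler_pdivrMr// mulrC.
      have [h1 h2] := near1 _ yx.
      by rewrite [y]scale f1scale// ler_pM2l.
    - move=> y; rewrite /f1 mulr_ge0//; first by rewrite mulr_ge0 ?cutoff_slope_ge0// mulr_ge0// ltW.
      by rewrite !mulr_ge0 ?energy_ge0 ?sqnorm_ge0// ltW.
  have up : \int[mu]_y f2 y <= La / t * C4 * (2 * (t * M0)) ^+ n.
    apply: (@Rintegral_le_ball _ _ _ 0) => //.
    - by rewrite mulr_ge0// ltW.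
    - move=> y; rewrite sub0r normrN => yM.
      have xM : `|t^-1 *: y| <= M0 by rewrite nscale ler_pdivrMr// mulrC.
      rewrite [y]scale f2scale.
      have -> : La * L / t * phi (t^-1 *: y) = La / t * (L * phi (t^-1 *: y)) by ring.
      rewrite ler_pM2l ?divr_gt0//.
      rewrite (le_trans (ler_norm _))// normrM (ger0_norm L0).
      by rewrite (le_trans (ler_piMl _ L1))// phiC.
    - by move=> y; rewrite sub0r normrN => My; rewrite /f2 Xtout// mul0r.
  have := le_trans low (eq_ind_r (fun z => z <= _) up f12).
  have -> : La * psi0 * (2 * (t * rho)) ^+ n = psi0 * (2 * rho) ^+ n.
    rewrite [2 * (t * rho)]mulrCA exprMn /La mulrACA mulVf ?mul1r//.
    by rewrite expf_neq0.
  have -> : La / t * C4 * (2 * (t * M0)) ^+ n = C4 * (2 * M0) ^+ n / t.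
    rewrite [2 * (t * M0)]mulrCA exprMn /La.
    by field; rewrite tne expf_neq0.
  by [].
pose A := C4 * (2 * M0) ^+ n; pose B := psi0 * (2 * rho) ^+ n.
have A0 : 0 <= A by rewrite mulr_ge0 ?exprn_ge0 ?mulr_ge0// ltW.
have B0 : 0 < B by rewrite mulr_gt0// exprn_gt0// mulr_gt0.
(* Taking [t = A / B + 1] in the bound [B * t <= A] gives [A + B <= A], a contradiction. *)
have AB : 1 <= A / B + 1 by rewrite lerDr divr_ge0// ltW.
have := main _ AB; rewrite -/A -/B ler_pdivlMr ?(lt_le_trans ltr01 AB)//.
by rewrite mulrDr mulr1 mulrCA divff ?mulr1 ?gt_eqF// gerDl leNgt B0.
Qed.

End critical.

Theorem theorem4p2 (R : realType) (N : nat) (hN : (2 <= N)%N)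
  (alpha beta : R) (v V : 'rV[R]_N -> 'rV[R]_N) (q : 'rV[R]_N -> R)
  (halpha : -1 < alpha)
  (hv : Ck_on 1 setT v)
  (hprofile : self_similar_profile alpha v q)
  (hV : C1_on_sphere V)
  (hhom : homogeneous_near_infinity beta V v)
  (hcase :
    [\/ [/\ 0 < beta, beta < alpha & associated_pressure v q],
        alpha < beta
      | [/\ alpha = beta, beta = N%:R / 2 & associated_pressure v q]]) :
  (beta != 0 -> forall y, v y = 0) /\
  (beta = 0 -> exists c, forall y, v y = c).
Proof.
have [Q cp] := self_similar_classical hv hprofile.
have [r r0 hu] := homogeneous_near_infinity_coord hhom.
have N0 : (0 < N)%N by exact: ltnW.
have [b1 far] : -1 < beta /\ forall i j y, r < `|y| ->
    vort (fun i j => partial j ((fun y => v y ord0 i) : _ -> R^o)) i j y = 0.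
  (* The first two cases both reduce to [alpha != beta] with [beta > -1]. In the third the velocity
     itself vanishes outside the ball, and so do its derivatives since the exterior is open. *)
  case: hcase => [[b0 ba _]|ab|[ab bN _]].
  - have b1 : -1 < beta by exact: lt_trans (ltrN10 R) b0.
    by split=> // i j y; exact: (far_vort_zero cp r0 halpha hu (negbT (gt_eqF ba)) b1).
  - have b1 : -1 < beta by exact: lt_trans halpha ab.
    by split=> // i j y; exact: (far_vort_zero cp r0 halpha hu (negbT (lt_eqF ab)) b1).
  - have b1 : -1 < beta by rewrite -ab.
    split=> // i j y ry; rewrite -ab in hu; rewrite -ab in bN.
    have u0 := critical_far_zero hN halpha bN r0 cp hu.
    suff du0 k l : partial l ((fun y => v y ord0 k) : _ -> R^o) y = 0.
      by rewrite /vort !du0 subrr.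
    apply: is_derive_near0 (has_gradient_partial l y (profile_C1 cp k).1).
    have : \forall z \near y, r < `|z|.
      exact: (cvgr_gt _ (@norm_continuous _ _ y)).
    by apply: filterS => z; exact: u0 k z.
have cst := profile_constant cp r0 halpha hu N0 b1 far.
split=> [b0 y|_]; last by exists (v 0) => y; apply/rowP => i; exact: cst.
apply/rowP => i; rewrite mxE; have := cst i y => /= ->.
exact: (constant_homogeneous r0 hu N0 b0 (cst i)).
Qed.
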